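(* Let $G$ be a group with a linear character $\chi$, let $H$ be a cocommutative $(G,\chi)$-module nonlocal vertex bialgebra, let $V$ be a $(G,\chi)$-module nonlocal vertex algebra with a structure $Y_V^H$ of $\phi$-compatible $H$-module nonlocal vertex algebra such that $$R_V(g)Y_V^H(h,x)v=Y_V^H(R_H(g)h,\chi(g)x)R_V(g)v\quad\text{for }g\in G,\ h\in H,\ v\in V,$$ let $\rho:V\to V\otimes H$ be a right $H$-comodule nonlocal vertex algebra structure on $V$ which is compatible with $Y_V^H$ and is a $G$-module homomorphism, let $\chi_\phi$ be a linear character of $G$ with $\phi(x,\chi(g)z)=\chi_\phi(g)\phi(\chi_\phi(g)^{-1}x,z)$ for $g\in G$, and let $(W,Y_W^H,Y_W^V)$ be a $(G,\chi_\phi)$-equivariant $\phi$-coordinated quasi $(H,V)$-module. For $v\in V$, set $$Y_W^{\sharp\rho}(v,x)=\sum Y_W^V(v_{(1)},x)Y_W^H(v_{(2)},x),\qquad \rho(v)=\sum v_{(1)}\otimes v_{(2)}.$$ Then $(W,Y_W^{\sharp\rho})$ is a $(G,\chi_\phi)$-equivariant $\phi$-coordinated quasi $\mathfrak D_{Y_V^H}^\rho(V)$-module.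
   Context: All vector spaces are over $\mathbb C$; $W((x_1,x_2))=W[[x_1,x_2]][x_1^{-1},x_2^{-1}]$; powers $(x\pm z)^n$ are expanded in nonnegative powers of the second variable; $R^\times$ denotes the nonzero elements of a ring $R$. A nonlocal vertex algebra is a vector space $V$ with a linear map $Y(\cdot,x):V\to(\mathrm{End}\,V)[[x,x^{-1}]]$ and $\mathbf 1\in V$ such that $Y(u,x)v\in V((x))$; $Y(\mathbf 1,x)v=v$, $Y(v,x)\mathbf 1\in V[[x]]$ with $\lim_{x\to0}Y(v,x)\mathbf 1=v$; and for $u,v\in V$ there is $k\ge 0$ with $(x_1-x_2)^kY(u,x_1)Y(v,x_2)\in \mathrm{Hom}(V,V((x_1,x_2)))$ and $\big((x_1-x_2)^kY(u,x_1)Y(v,x_2)\big)|_{x_1=x_2+x_0}=x_0^kY(Y(u,x_0)v,x_2)$. Modules $(W,Y_W)$ satisfy the analogous axioms. A nonlocal vertex bialgebra is a nonlocal vertex algebra $H$ with a coalgebra structure $(\Delta,\varepsilon)$ such that $\Delta,\varepsilon$ are homomorphisms of nonlocal vertex algebras. An $H$-module nonlocal vertex algebra is a nonlocal vertex algebra $V$ with an $H$-module structure $Y_V^H$ with $Y_V^H(h,x)v\in V\otimes\mathbb C((x))$, $Y_V^H(h,x)\mathbf 1=\varepsilon(h)\mathbf 1$, $Y_V^H(h,x_1)Y(u,x_2)v=\sum Y(Y_V^H(h_{(1)},x_1-x_2)u,x_2)Y_V^H(h_{(2)},x_1)v$. A right $H$-comodule nonlocal vertex algebra structure on $V$ is a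 homomorphism of nonlocal vertex algebras $\rho:V\to V\otimes H$ with $(\rho\otimes1)\rho=(1\otimes\Delta)\rho$, $(1\otimes\varepsilon)\rho=\mathrm{Id}_V$; it is compatible with $Y_V^H$ if $\rho(Y_V^H(h,x)v)=(Y_V^H(h,x)\otimes1)\rho(v)$. For $H$ cocommutative and $\rho$, $Y_V^H$ compatible, $\mathfrak D_{Y_V^H}^\rho(V)$ is the nonlocal vertex algebra on the space $V$ with vacuum $\mathbf 1$ and vertex operator map $a\mapsto\sum Y(a_{(1)},x)Y_V^H(a_{(2)},x)$. A $(G,\chi)$-module nonlocal vertex algebra is a nonlocal vertex algebra $V$ with a representation $R:G\to\mathrm{GL}(V)$ such that $R(g)\mathbf 1=\mathbf 1$, $R(g)Y(v,x)R(g)^{-1}=Y(R(g)v,\chi(g)x)$. A $(G,\chi)$-module nonlocal vertex bialgebra is a nonlocal vertex bialgebra that is a $(G,\chi)$-module nonlocal vertex algebra on which $G$ acts by coalgebra automorphisms. $R_H,R_V$ denote the representations on $H,V$. Under the hypotheses, $\mathfrak D_{Y_V^H}^\rho(V)$ is a $(G,\chi)$-module nonlocal vertex algebra with the representation $R_V$. Fix $\phi(x,z)=e^{zp(x)\frac{d}{dx}}x\in\mathbb C((x))[[z]]$ with $p(x)\in\mathbb C((x))$, $p\neq0$. $\mathbb C_*((x_1,x_2))$ is the fraction field of $\mathbb C((x_1,x_2))$. For $F\in\mathbb C_*((x_1,x_2))$, $F(\phi(x,z),x)\in\mathbb C((x))((z))$ is its image under the field embedding extending the ring embedding $f(x_1,x)\mapsto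 f(\phi(x,z),x)$, $\mathbb C((x_1,x))\to\mathbb C((x))[[z]]$. $\mathbb C_\phi((x_1,x_2))$ is the set of $F\in\mathbb C_*((x_1,x_2))$ with $p(x_1)\partial_{x_1}F=-p(x_2)\partial_{x_2}F$. For such $F$, $F(\phi(x,z),x)\in\mathbb C((z))$, and $\pi_\phi(F)=F(\phi(x,z),x)$ defines an injective algebra homomorphism $\pi_\phi:\mathbb C_\phi((x_1,x_2))\to\mathbb C((z))$ with image denoted $\mathbb C_\phi((z))$. $\mathbb C_{\chi_\phi(G)}[x]$ is the multiplicative monoid generated in $\mathbb C[x]$ by $x-\chi_\phi(g)$, $g\in G$. $\iota_{x_2,x_1}:\mathbb C_*((x_1,x_2))\to\mathbb C((x_2))((x_1))$ is the canonical expansion embedding. A $\phi$-compatible $H$-module nonlocal vertex algebra ($H$ a $(G,\chi)$-module nonlocal vertex bialgebra) is an $H$-module nonlocal vertex algebra $(V,Y_V^H)$ with $Y_V^H(h,z)v\in V\otimes\mathbb C_\phi((z))$ for all $h,v$, and such that for $h\in H$, $v\in V$ there is $q(x)\in\mathbb C_{\chi_\phi(G)}[x]$ with $q(x_2/x_1)\widehat Y_V^H(h,x_1,x_2)v\in V\otimes\mathbb C((x_1,x_2))$, where $\widehat Y_V^H(h,x_1,x_2)v=(1\otimes\pi_\phi^{-1})Y_V^H(h,z)v\in V\otimes\mathbb C_\phi((x_1,x_2))$. A $\phi$-coordinated quasi $V$-module is a vector space $W$ with a linear map $Y_W(\cdot,x):V\to(\mathrm{End}\,W)[[x,x^{-1}]]$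 with $Y_W(u,x)w\in W((x))$, $Y_W(\mathbf 1,x)=1_W$, and for $u,v\in V$ there is $f\in\mathbb C((x_1,x_2))^\times$ with $f(x_1,x_2)Y_W(u,x_1)Y_W(v,x_2)\in\mathrm{Hom}(W,W((x_1,x_2)))$ and $\big(f(x_1,x_2)Y_W(u,x_1)Y_W(v,x_2)\big)|_{x_1=\phi(x_2,z)}=f(\phi(x_2,z),x_2)Y_W(Y(u,z)v,x_2)$. For a $(G,\chi)$-module nonlocal vertex algebra $V$ and $\chi_\phi$ satisfying the stated relation, it is $(G,\chi_\phi)$-equivariant if $Y_W(R(g)v,x)=Y_W(v,\chi_\phi(g)^{-1}x)$ and for $u,v\in V$ there is $q(x)\in\mathbb C_{\chi_\phi(G)}[x]$ with $q(x_1/x_2)Y_W(u,x_1)Y_W(v,x_2)\in\mathrm{Hom}(W,W((x_1,x_2)))$. A $(G,\chi_\phi)$-equivariant $\phi$-coordinated quasi $(H,V)$-module is a vector space $W$ with a $(G,\chi_\phi)$-equivariant $\phi$-coordinated quasi $H$-module structure $Y_W^H$ and a $(G,\chi_\phi)$-equivariant $\phi$-coordinated quasi $V$-module structure $Y_W^V$ such that for $h\in H$, $v\in V$, $w\in W$: $Y_W^H(h,x)w\in W\otimes\mathbb C((x))$ and $Y_W^H(h,x_1)Y_W^V(v,x_2)=\sum Y_W^V\big(\iota_{x_2,x_1}\widehat Y_V^H(h_{(1)},x_1,x_2)v,x_2\big)Y_W^H(h_{(2)},x_1)$. *)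

(* Defs.v *)
From HB Require Import structures.
From mathcomp Require Import all_boot all_order all_algebra.
From mathcomp Require Import boolp classical_sets functions cardinality fsbigop.
From mathcomp Require Import zify.

Set Implicit Arguments.
Unset Strict Implicit.
Unset Printing Implicit Defensive.

Import Order.TTheory GRing.Theory Num.Theory.
Local Open Scope ring_scope.
Local Open Scope quotient_scope.

(* Formal distributions are coefficient functions: [f : int -> W] stands for
   \sum_n f n x^n and [F : int -> int -> W] for \sum_(m, n) F m n x1^m x2^n.
   Every infinite sum of coefficients is written with the finitely supported
   sum [\sum_(i \in A) _] of fsbigop (whose value is 0 if the support is
   infinite, which does not occur under the hypotheses used below). *)

(* [bdd1 f] : f is in W((x)); [bdd2 F] : F is in W((x1, x2)). *)
Definition bdd1 (W : nmodType) (f : int -> W) : Prop :=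
  exists N : int, forall n : int, n < N -> f n = 0.
Definition bdd2 (W : nmodType) (F : int -> int -> W) : Prop :=
  exists N : int, forall m n : int, (m < N) || (n < N) -> F m n = 0.

Section LaurentSeries.
Variable K : fieldType.

Record laurent := Laurent { coefL :> int -> K; _ : `[< bdd1 coefL >] }.

HB.instance Definition _ := [isSub for coefL].
HB.instance Definition _ := gen_eqMixin laurent.
HB.instance Definition _ := gen_choiceMixin laurent.

Implicit Types f g h : laurent.

Lemma laurentP f g : (forall n, f n = g n) <-> f = g.
Proof.
split=> [fg|-> //]; apply: val_inj; apply: functional_extensionality_dep.
exact: fg.
Qed.

Lemma coefL_bdd f : bdd1 f. Proof. by case: f => f /= /asboolP. Qed.

Lemma bdd1_0 : `[< bdd1 (fun=> 0 : K) >].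
Proof. by apply/asboolP; exists 0. Qed.

(* The Laurent series with prescribed coefficients (0 if they do not vanish
   in low degrees). *)
Definition mkL (c : int -> K) : laurent := insubd (Laurent bdd1_0) c.

Lemma mkLE c n : bdd1 c -> mkL c n = c n.
Proof.
by move=> bc; rewrite /mkL -[coefL _]/(val _) val_insubd; case: asboolP.
Qed.

Definition addL f g := mkL (fun n => f n + g n).
Definition oppL f := mkL (fun n => - f n).
Definition mulL f g :=
  mkL (fun n => \sum_(m \in [set: int]%classic) (f m * g (n - m))).
(* a x^i *)
Definition monoL (a : K) (i : int) := mkL (fun n => if n == i then a else 0).

Lemma monoLE a i n : monoL a i n = if n == i then a else 0.
Proof.
by rewrite mkLE //; exists i => m mi; case: eqP => // E; rewrite E ltxx in mi.
Qed.

Lemma addLE f g n : addL f g n = f n + g n.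
Proof.
have [a Ha] := coefL_bdd f; have [b Hb] := coefL_bdd g.
rewrite mkLE //; exists (Num.min a b) => m; rewrite lt_min => /andP[ma mb].
by rewrite Ha // Hb // addr0.
Qed.

Lemma oppLE f n : oppL f n = - f n.
Proof.
have [a Ha] := coefL_bdd f.
by rewrite mkLE //; exists a => m ma; rewrite Ha // oppr0.
Qed.

Lemma fsbig_window (E : nmodType) (F : int -> E) (a : int) (M : nat) :
  (forall n : int, n < a -> F n = 0) ->
  (forall n : int, a + M%:Z <= n -> F n = 0) ->
  \sum_(n \in [set: int]%classic) F n = \sum_(i < M) F (a + i%:Z).
Proof.
move=> Flo Fhi.
rewrite (@fsbigE _ _ _ _ _ [seq a + i%:Z | i <- iota 0 M]) //.
- rewrite big_map -[M in iota 0 M]subn0 big_mkord.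
  by apply: eq_bigl => i; rewrite in_setT.
- by rewrite map_inj_uniq ?iota_uniq // => i j /addrI [].
- move=> n _ Hn; have [/Flo //|an] := ltP n a.
  apply: Fhi; rewrite leNgt; apply: contra Hn => nM.
  apply/mapP; exists `|n - a|%N; last by lia.
  by rewrite mem_iota; lia.
Qed.

Definition lowbd f (a : int) := forall n : int, n < a -> f n = 0.

Lemma conv_lo f g a b (n : int) : lowbd f a -> lowbd g b -> n < a + b ->
  \sum_(m \in [set: int]%classic) (f m * g (n - m)) = 0.
Proof.
move=> fa gb nab; apply: fsbig1 => m _.
have [/fa -> |am] := ltP m a; first by rewrite mul0r.
by rewrite gb ?mulr0 //; lia.
Qed.

Lemma mulLE f g n :
  mulL f g n = \sum_(m \in [set: int]%classic) (f m * g (n - m)).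
Proof.
have [a Ha] := coefL_bdd f; have [b Hb] := coefL_bdd g.
by rewrite mkLE //; exists (a + b) => m; apply: conv_lo.
Qed.

Lemma mulL_lo f g a b : lowbd f a -> lowbd g b -> lowbd (mulL f g) (a + b).
Proof. by move=> fa gb n nab; rewrite mulLE (conv_lo fa gb). Qed.

Lemma mulLE_lo f g a b k : lowbd f a -> lowbd g b ->
  mulL f g (a + b + k%:Z) =
  \sum_(i < k.+1) f (a + i%:Z) * g (b + (k - i)%N%:Z).
Proof.
move=> fa gb; rewrite mulLE (@fsbig_window _ _ a k.+1) => [|n na|n na].
- apply: eq_bigr => i _; congr (_ * g _).
  by have := leq_ord i; lia.
- by rewrite fa ?mul0r.
- by rewrite gb ?mulr0 //; lia.
Qed.

Definition trL (a : int) (M : nat) f : {poly K} := \poly_(i < M) f (a + i%:Z).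

Lemma mulL_tr f g a b k M : lowbd f a -> lowbd g b -> (k < M)%N ->
  mulL f g (a + b + k%:Z) = (trL a M f * trL b M g)`_k.
Proof.
move=> fa gb kM; rewrite mulLE_lo // coefM; apply: eq_bigr => i _.
by rewrite !coef_poly (leq_ltn_trans (leq_ord i) kM)
           (leq_ltn_trans (leq_subr _ _) kM).
Qed.

Lemma coefM_trunc (p p' q : {poly K}) k :
  (forall i, (i <= k)%N -> p`_i = p'`_i) -> (p * q)`_k = (p' * q)`_k.
Proof.
move=> pp'; rewrite !coefM; apply: eq_bigr => i _.
by rewrite pp' // leq_ord.
Qed.

Lemma lowbd_ext f g a : lowbd f a -> lowbd g a ->
  (forall k : nat, f (a + k%:Z) = g (a + k%:Z)) -> f = g.
Proof.
move=> fa ga fg; apply/laurentP => n; have [na|an] := ltP n a.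
  by rewrite fa // ga.
have := fg `|n - a|%N; have -> : a + `|n - a|%N%:Z = n by lia.
by [].
Qed.

Lemma addLA : associative addL.
Proof. by move=> f g h; apply/laurentP => n; rewrite !addLE addrA. Qed.
Lemma addLC : commutative addL.
Proof. by move=> f g; apply/laurentP => n; rewrite !addLE addrC. Qed.
Lemma monoL0E i n : monoL 0 i n = 0.
Proof. by rewrite monoLE if_same. Qed.
Lemma add0L : left_id (monoL 0 0) addL.
Proof. by move=> f; apply/laurentP => n; rewrite addLE monoL0E add0r. Qed.
Lemma addNL : left_inverse (monoL 0 0) oppL addL.
Proof.
by move=> f; apply/laurentP => n; rewrite addLE oppLE monoL0E addNr.
Qed.

HB.instance Definition _ :=
  GRing.isZmodule.Build laurent addLA addLC add0L addNL.

Lemma mulLC : commutative mulL.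
Proof.
move=> f g; have [a fa] := coefL_bdd f; have [b gb] := coefL_bdd g.
apply: (@lowbd_ext _ _ (a + b)); first exact: mulL_lo.
  by rewrite addrC; apply: mulL_lo.
move=> k; rewrite (mulL_tr fa gb (ltnSn k)).
by rewrite [a + b]addrC (mulL_tr gb fa (ltnSn k)) mulrC.
Qed.

Lemma mulL_tr3 f g h a b c k : lowbd f a -> lowbd g b -> lowbd h c ->
  mulL (mulL f g) h (a + b + c + k%:Z) =
  (trL a k.+1 f * trL b k.+1 g * trL c k.+1 h)`_k.
Proof.
move=> fa gb hc; rewrite (mulL_tr (mulL_lo fa gb) hc (ltnSn k)).
apply: coefM_trunc => i ik; rewrite coef_poly ltnS ik.
by rewrite (@mulL_tr _ _ _ _ _ k.+1).
Qed.

Lemma mulLA : associative mulL.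
Proof.
move=> f g h; have [a fa] := coefL_bdd f; have [b gb] := coefL_bdd g.
have [c hc] := coefL_bdd h; apply: (@lowbd_ext _ _ (a + b + c)).
- by rewrite -addrA; apply/mulL_lo => //; apply/mulL_lo.
- by apply/mulL_lo => //; apply/mulL_lo.
- move=> k; rewrite mulL_tr3 // mulLC.
  have -> : a + b + c = b + c + a by lia.
  by rewrite mulL_tr3 // mulrC mulrA.
Qed.

Lemma mulL_mono a i f n : mulL (monoL a i) f n = a * f (n - i).
Proof.
rewrite mulLE (@fsbig_window _ _ i 1) => [|m mi|m mi].
- by rewrite big_ord1 addr0 monoLE eqxx.
- by rewrite monoLE lt_eqF ?mul0r.
- by rewrite monoLE gt_eqF ?mul0r //; lia.
Qed.

Lemma mul1L : left_id (monoL 1 0) mulL.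
Proof.
by move=> f; apply/laurentP => n; rewrite mulL_mono mul1r subr0.
Qed.

Lemma mulLDl : left_distributive mulL addL.
Proof.
move=> f g h; have [a fa] := coefL_bdd f; have [b gb] := coefL_bdd g.
have [c hc] := coefL_bdd h; set d := Num.min a b.
have fd : lowbd f d by move=> n nd; apply: fa; lia.
have gd : lowbd g d by move=> n nd; apply: gb; lia.
have fgd : lowbd (addL f g) d by move=> n nd; rewrite addLE fd // gd // addr0.
apply: (@lowbd_ext _ _ (d + c)); first exact: mulL_lo.
  by move=> n nd; rewrite addLE !(@mulL_lo _ _ d c) // addr0.
move=> k; rewrite addLE !mulLE_lo // -big_split; apply: eq_bigr => i _ /=.
by rewrite addLE mulrDl.
Qed.

Lemma nonzero1L : monoL 1 0 != monoL 0 0.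
Proof.
apply/eqP => /laurentP /(_ 0); rewrite !monoLE eqxx => /eqP.
by rewrite oner_eq0.
Qed.

HB.instance Definition _ := GRing.Zmodule_isComNzRing.Build laurent
  mulLA mulLC mul1L mulLDl nonzero1L.

Lemma coefL0 n : (0 : laurent) n = 0. Proof. exact: monoL0E. Qed.
Lemma coefLD f g n : (f + g) n = f n + g n. Proof. exact: addLE. Qed.
Lemma coefLN f n : (- f) n = - f n. Proof. exact: oppLE. Qed.
Lemma coefLM f g n :
  (f * g) n = \sum_(m \in [set: int]%classic) (f m * g (n - m)).
Proof. exact: mulLE. Qed.
Lemma coefL1 n : (1 : laurent) n = (n == 0)%:R.
Proof. by rewrite -[1]/(monoL 1 0) monoLE; case: eqP. Qed.
Lemma coefL_monoM a i f n : (monoL a i * f) n = a * f (n - i).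
Proof. exact: mulL_mono. Qed.

Lemma laurent_lead f : f != 0 -> exists2 a, lowbd f a & f a != 0.
Proof.
move=> f0; have [a fa] := coefL_bdd f.
have [k fk] : exists k : nat, f (a + k%:Z) != 0.
  apply: contrapT => /forallNP H; move/eqP: f0; apply.
  apply: (@lowbd_ext _ _ a) => // [n _|k]; first by rewrite coefL0.
  by rewrite coefL0; apply/eqP/negP => /negP; apply: H.
have : exists k : nat, f (a + k%:Z) != 0 by exists k.
move=> /ex_minnP [m fm mmin]; exists (a + m%:Z) => // n na.
have [/fa //|an] := ltP n a; apply/eqP/negP => /negP fn.
have nE : n = a + `|n - a|%N%:Z by lia.
rewrite nE in fn; have := mmin _ fn; lia.
Qed.

(* The first n coefficients of the inverse of the power series u. *)
Fixpoint inv_coefs (u : nat -> K) (n : nat) : seq K :=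
  if n is n'.+1 then
    let s := inv_coefs u n' in
    rcons s ((u 0%N)^-1 * ((n' == 0%N)%:R - \sum_(i < n') s`_i * u (n' - i)%N))
  else [::].

Lemma size_inv_coefs u n : size (inv_coefs u n) = n.
Proof. by elim: n => //= n IH; rewrite size_rcons IH. Qed.

Lemma nth_inv_coefs u n i : (i < n)%N ->
  (inv_coefs u n)`_i = (inv_coefs u i.+1)`_i.
Proof.
elim: n => // n IH; rewrite ltnS leq_eqVlt => /predU1P[-> //|ltin].
by rewrite /= nth_rcons size_inv_coefs ltin IH.
Qed.

Lemma inv_coefsP (u : nat -> K) k : u 0%N != 0 ->
  \sum_(i < k.+1) (inv_coefs u i.+1)`_i * u (k - i)%N = (k == 0%N)%:R.
Proof.
move=> u0; rewrite big_ord_recr /= subnn nth_rcons size_inv_coefs ltnn eqxx.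
rewrite mulrAC mulVf // mul1r addrC -addrA.
rewrite [- _ + _](_ : _ = 0) ?addr0 //; apply/eqP; rewrite addrC subr_eq0.
by apply/eqP/eq_bigr => i _; rewrite (nth_inv_coefs _ (ltn_ord i)).
Qed.

Lemma laurent_inv_ex f : f != 0 -> exists g, g * f = 1.
Proof.
move=> /laurent_lead [a fa fa0].
pose u (i : nat) := f (a + i%:Z).
pose c (n : int) := if n < - a then 0 else
  (inv_coefs u (absz (n + a)).+1)`_(absz (n + a)).
have cE n : mkL c n = c n.
  by rewrite mkLE //; exists (- a) => m ma; rewrite /c ma.
have ca : lowbd (mkL c) (- a) by move=> n na; rewrite cE /c na.
exists (mkL c); apply: (@lowbd_ext _ _ (- a + a)).
- exact: mulL_lo.
- by move=> n; rewrite addNr coefL1 => n0; rewrite lt_eqF.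
- move=> k; rewrite [LHS]mulLE_lo // coefL1.
  have -> : (- a + a + k%:Z == 0) = (k == 0%N) by lia.
  rewrite -(@inv_coefsP u k) ?/u ?addr0 //; apply: eq_bigr => i _.
  rewrite cE /c ifN; last by lia.
  by have -> : absz (- a + i%:Z + a) = i by lia.
Qed.

Definition invL f : laurent := xget 0 [set g | g * f = 1]%classic.

Lemma mulVL f : f != 0 -> invL f * f = 1.
Proof.
move=> /laurent_inv_ex [g gf]; rewrite /invL.
by case: xgetP => [h _ -> //|/(_ g)]; case.
Qed.

Lemma invL0 : invL 0 = 0.
Proof.
rewrite /invL; case: xgetP => // g _ /eqP.
by rewrite /= mulr0 eq_sym oner_eq0.
Qed.

HB.instance Definition _ := GRing.ComNzRing_isField.Build laurent mulVL invL0.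

End LaurentSeries.

Lemma coefL_sum (K : fieldType) (I : Type) (r : seq I) (F : I -> laurent K) n :
  (\sum_(i <- r) F i) n = \sum_(i <- r) F i n.
Proof.
by apply: (big_morph (fun f : laurent K => f n)) => [f g|];
   rewrite (coefLD, coefL0).
Qed.

(* The ring K((x1, x2)), as the subring of K((x2))((x1)) of the series whose
   exponents in both variables are bounded below. *)
Section Laurent2.
Variable K : fieldType.

Definition is_laurent2 : {pred laurent (laurent K)} :=
  fun f => `[< bdd2 (fun m n => f m n) >].

Lemma is_laurent2_subring : subring_closed is_laurent2.
Proof.
split.
- apply/asboolP; exists 0 => m n mn; rewrite coefL1.
  case: eqP => [m0|_]; last by rewrite coefL0.
  by rewrite coefL1; case: eqP => // n0; move: mn; rewrite m0 n0.
- move=> f g /asboolP[a fa] /asboolP[b gb]; apply/asboolP.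
  exists (Num.min a b) => m n mn.
  by rewrite !(coefLD, coefLN) fa ?gb ?subr0 //; lia.
- move=> f g /asboolP[a fa] /asboolP[b gb]; apply/asboolP.
  exists (a + b) => m n mn; rewrite coefLM coefL_sum big1 // => i _.
  rewrite coefLM fsbig1 // => j _.
  have [?|?] := boolP ((i < a) || (j < a)); first by rewrite fa ?mul0r.
  by rewrite gb ?mulr0 //; lia.
Qed.

HB.instance Definition _ :=
  GRing.isSubringClosed.Build _ is_laurent2 is_laurent2_subring.

Record laurent2 := Laurent2 { val2 :> laurent (laurent K); _ : is_laurent2 val2 }.

HB.instance Definition _ := [isSub for val2].
HB.instance Definition _ := [Choice of laurent2 by <:].
HB.instance Definition _ := [SubChoice_isSubComNzRing of laurent2 by <:].

Definition unit2 : {pred laurent2} := fun f => `[< exists g, g * f = 1 >].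
Definition inv2 (f : laurent2) := xget f [set g | g * f = 1]%classic.

Lemma mulV2 : {in unit2, left_inverse 1 inv2 *%R}.
Proof.
move=> f /asboolP[g gf]; rewrite /inv2.
by case: xgetP => [h _ ->|/(_ g)].
Qed.
Lemma unit2P f g : g * f = 1 -> unit2 f.
Proof. by move=> gf; apply/asboolP; exists g. Qed.
Lemma inv2_out : {in [predC unit2], inv2 =1 id}.
Proof.
move=> f /asboolP nf; rewrite /inv2.
by case: xgetP => // g _ gf; case: nf; exists g.
Qed.
HB.instance Definition _ :=
  GRing.ComNzRing_hasMulInverse.Build laurent2 mulV2 unit2P inv2_out.

Lemma laurent2_integral : GRing.integral_domain_axiom laurent2.
Proof.
move=> f g fg; have : val f * val g == 0 by rewrite -[_ * _]/(val (f * g)) fg.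
by rewrite mulf_eq0; case/orP=> /eqP E; apply/orP; [left|right];
   apply/eqP/val_inj.
Qed.
HB.instance Definition _ := GRing.ComUnitRing_isIntegral.Build laurent2 laurent2_integral.

(* The element of K((x1, x2)) with prescribed coefficients (0 if they do not
   vanish when one of the exponents is low). *)
Definition mk2 (c : int -> int -> K) : laurent2 :=
  insubd (0 : laurent2) (mkL (fun m => mkL (c m))).

Lemma mk2E c m n : bdd2 c -> mk2 c m n = c m n.
Proof.
move=> [N cN].
have E i j : mkL (fun m => mkL (c m)) i j = c i j.
  rewrite mkLE; first by rewrite mkLE //; exists N => k kN; rewrite cN ?kN ?orbT.
  exists N => k kN; apply/laurentP => l; rewrite coefL0 mkLE ?cN ?kN //.
  by exists N => ? ?; rewrite cN ?kN.
rewrite /mk2 -[val2 _]/(val _) val_insubd ifT ?E //.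
by apply/asboolP; exists N => i j ij; rewrite E cN.
Qed.

(* a x1^i x2^j *)
Definition mono2 (a : K) (i j : int) : laurent2 :=
  mk2 (fun m n => if (m == i) && (n == j) then a else 0).

Lemma mono2E a i j : val (mono2 a i j) = monoL (monoL a j) i.
Proof.
apply/laurentP => m; apply/laurentP => n; rewrite [LHS]mk2E.
  by rewrite monoLE; case: eqP => _; rewrite ?coefL0 // monoLE.
exists (Num.min i j) => k l kl; case: eqP => //= ki; case: eqP => //= lj.
by move: kl; rewrite ki lj; lia.
Qed.

Lemma mono2D a b i j : mono2 (a + b) i j = mono2 a i j + mono2 b i j.
Proof.
apply: val_inj; rewrite [RHS]/= !mono2E.
apply/laurentP => m; apply/laurentP => n.
rewrite coefLD !monoLE; case: (m == i); last by rewrite addr0.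
by rewrite coefLD !monoLE; case: (n == j); rewrite ?addr0.
Qed.

Lemma mono2M a b i j k l :
  mono2 (a * b) (i + k) (j + l) = mono2 a i j * mono2 b k l.
Proof.
apply: val_inj; rewrite [RHS]/= !mono2E.
apply/laurentP => m; apply/laurentP => n; rewrite coefL_monoM.
rewrite !monoLE; have -> : (m - i == k) = (m == i + k) by lia.
case: (m == i + k); last by rewrite mulr0.
rewrite coefL_monoM !monoLE; have -> : (n - j == l) = (n == j + l) by lia.
by case: (n == j + l); rewrite ?mulr0.
Qed.

Lemma mono2_1 : mono2 1 0 0 = 1.
Proof. by apply: val_inj; rewrite mono2E. Qed.

(* The field of fractions K_*((x1, x2)), as a K-vector space. *)
Definition frac2 := {fraction laurent2}.
HB.instance Definition _ := GRing.Field.on frac2.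

Definition toF (f : laurent2) : frac2 := FracField.tofrac f.
Definition scale_frac2 (a : K) (F : frac2) : frac2 := toF (mono2 a 0 0) * F.

Lemma scale_frac2A a b F :
  scale_frac2 a (scale_frac2 b F) = scale_frac2 (a * b) F.
Proof.
by rewrite /scale_frac2 mulrA /toF -tofracM -mono2M !addr0.
Qed.
Lemma scale_frac2_1 : left_id 1 scale_frac2.
Proof. by move=> F; rewrite /scale_frac2 mono2_1 /toF tofrac1 mul1r. Qed.
Lemma scale_frac2Dr : right_distributive scale_frac2 +%R.
Proof. by move=> a F G; rewrite /scale_frac2 mulrDr. Qed.
Lemma scale_frac2Dl F : {morph scale_frac2^~ F : a b / a + b}.
Proof.
by move=> a b; rewrite /scale_frac2 mono2D /toF tofracD mulrDl.
Qed.
HB.instance Definition _ := GRing.Zmodule_isLmodule.Build K frac2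
  scale_frac2A scale_frac2_1 scale_frac2Dr scale_frac2Dl.

(* The extension to the fraction field of an embedding of K((x1, x2)) in a
   field L. *)
Definition frac_ext (L : fieldType) (i : laurent2 -> L) (F : frac2) : L :=
  i \n_(repr F) / i \d_(repr F).

(* The extension to the fraction field of a derivation of K((x1, x2)). *)
Definition frac_der (D : laurent2 -> laurent2) (F : frac2) : frac2 :=
  let n := \n_(repr F) in let d := \d_(repr F) in
  toF (D n * d - n * D d) / toF (d ^+ 2).

(* The expansion K_*((x1, x2)) -> K((x2))((x1)). *)
Definition iota_x2x1 : frac2 -> laurent (laurent K) :=
  frac_ext (fun f : laurent2 => val2 f).

Definition d1 (f : laurent2) : laurent2 :=
  mk2 (fun m n => (f (m + 1) n) *~ (m + 1)).
Definition d2 (f : laurent2) : laurent2 :=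
  mk2 (fun m n => (f m (n + 1)) *~ (n + 1)).

(* p(x1) and p(x2) *)
Definition in_x1 (p : laurent K) : laurent2 :=
  mk2 (fun m n => if n == 0 then p m else 0).
Definition in_x2 (p : laurent K) : laurent2 :=
  mk2 (fun m n => if m == 0 then p n else 0).

(* q(x1 / x2) and q(x2 / x1) *)
Definition ratio_x1x2 (q : {poly K}) : laurent2 :=
  \sum_(k < size q) mono2 q`_k k (- k%:Z).
Definition ratio_x2x1 (q : {poly K}) : laurent2 :=
  \sum_(k < size q) mono2 q`_k (- k%:Z) k.

End Laurent2.

(* The tensor product of two K-vector spaces: formal sums of pairs, two of them
   being identified when all bilinear maps take the same value on them. *)
Section Tensor.
Variables (K : fieldType) (V U : lmodType K).

Definition bilinear_map (E : lmodType K) (F : V -> U -> E) : Prop :=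
  (forall u, linear (F^~ u)) /\ (forall v, linear (F v)).

Definition tsum (E : nmodType) (F : V -> U -> E) (s : seq (V * U)) : E :=
  \sum_(p <- s) F p.1 p.2.

Definition tens_eq (s t : seq (V * U)) : bool :=
  `[< forall (E : lmodType K) (F : V -> U -> E),
        bilinear_map F -> tsum F s = tsum F t >].

Lemma tens_eq_refl : reflexive tens_eq.
Proof. by move=> s; apply/asboolP. Qed.
Lemma tens_eq_sym : symmetric tens_eq.
Proof. by move=> s t; apply/asboolP/asboolP => st E F bF; rewrite st. Qed.
Lemma tens_eq_trans : transitive tens_eq.
Proof.
move=> t s r /asboolP st /asboolP tr; apply/asboolP => E F bF.
by rewrite st // tr.
Qed.

Canonical tens_equiv :=
  EquivRel tens_eq tens_eq_refl tens_eq_sym tens_eq_trans.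

Definition tens := {eq_quot tens_eq}.
HB.instance Definition _ : EqQuotient _ tens_eq tens := EqQuotient.on tens.
HB.instance Definition _ := Choice.on tens.

(* Sweedler sum: [sweedler F t] is \sum F v_i u_i for t = \sum v_i (x) u_i;
   it does not depend on the decomposition if F is bilinear. *)
Definition sweedler (E : nmodType) (F : V -> U -> E) (t : tens) : E :=
  tsum F (repr t).

Definition tens_of (s : seq (V * U)) : tens := \pi_tens s.
Definition pure (v : V) (u : U) : tens := tens_of [:: (v, u)].

Lemma sweedler_of (E : lmodType K) (F : V -> U -> E) s :
  bilinear_map F -> sweedler F (tens_of s) = tsum F s.
Proof.
move=> bF; rewrite /sweedler.
have /eqmodP/asboolP/(_ E F bF) // : repr (tens_of s) = s %[mod tens].
exact: reprK.
Qed.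

Lemma tens_ext (s t : tens) :
  (forall (E : lmodType K) (F : V -> U -> E),
     bilinear_map F -> sweedler F s = sweedler F t) -> s = t.
Proof.
by move=> st; rewrite -[s]reprK -[t]reprK; apply/eqmodP/asboolP.
Qed.

Definition tens_add (s t : tens) := tens_of (repr s ++ repr t).
Definition tens_scale (a : K) (t : tens) :=
  tens_of [seq (a *: p.1, p.2) | p <- repr t].
Definition tens_opp (t : tens) := tens_scale (-1) t.

Lemma tsum_cat (E : nmodType) (F : V -> U -> E) s t :
  tsum F (s ++ t) = tsum F s + tsum F t.
Proof. by rewrite /tsum big_cat. Qed.

Lemma bilinearZl (E : lmodType K) (F : V -> U -> E) a v u :
  bilinear_map F -> F (a *: v) u = a *: F v u.
Proof.
move=> [/(_ u) lF _].
have F0 : F 0 u = 0.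
  by have := lF (-1) 0 0; rewrite scaler0 addr0 scaleN1r addNr.
by have := lF a v 0; rewrite F0 !addr0.
Qed.

Section SweedlerOps.
Variables (E : lmodType K) (F : V -> U -> E) (bF : bilinear_map F).

Lemma sweedlerD s t : sweedler F (tens_add s t) = sweedler F s + sweedler F t.
Proof. by rewrite sweedler_of // tsum_cat. Qed.

Lemma sweedlerZ a t : sweedler F (tens_scale a t) = a *: sweedler F t.
Proof.
rewrite sweedler_of // /tsum big_map scaler_sumr; apply: eq_bigr => p _.
exact: bilinearZl.
Qed.

Lemma sweedlerN t : sweedler F (tens_opp t) = - sweedler F t.
Proof. by rewrite sweedlerZ scaleN1r. Qed.

Lemma sweedler0 : sweedler F (tens_of [::]) = 0.
Proof. by rewrite sweedler_of // /tsum big_nil. Qed.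

End SweedlerOps.

Let swE := (sweedlerD, sweedlerZ, sweedlerN, sweedler0).

Lemma tens_addA : associative tens_add.
Proof. by move=> r s t; apply: tens_ext => E F bF; rewrite !swE // addrA. Qed.
Lemma tens_addC : commutative tens_add.
Proof. by move=> s t; apply: tens_ext => E F bF; rewrite !swE // addrC. Qed.
Lemma tens_add0 : left_id (tens_of [::]) tens_add.
Proof. by move=> t; apply: tens_ext => E F bF; rewrite !swE // add0r. Qed.
Lemma tens_addN : left_inverse (tens_of [::]) tens_opp tens_add.
Proof. by move=> t; apply: tens_ext => E F bF; rewrite !swE // addNr. Qed.

HB.instance Definition _ :=
  GRing.isZmodule.Build tens tens_addA tens_addC tens_add0 tens_addN.

Lemma tens_scaleA a b t : tens_scale a (tens_scale b t) = tens_scale (a * b) t.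
Proof. by apply: tens_ext => E F bF; rewrite !swE // scalerA. Qed.
Lemma tens_scale1 : left_id 1 tens_scale.
Proof. by move=> t; apply: tens_ext => E F bF; rewrite !swE // scale1r. Qed.
Lemma tens_scaleDr : right_distributive tens_scale +%R.
Proof. by move=> a s t; apply: tens_ext => E F bF; rewrite !swE // scalerDr. Qed.
Lemma tens_scaleDl t : {morph tens_scale^~ t : a b / a + b}.
Proof. by move=> a b; apply: tens_ext => E F bF; rewrite !swE // scalerDl. Qed.

HB.instance Definition _ := GRing.Zmodule_isLmodule.Build K tens
  tens_scaleA tens_scale1 tens_scaleDr tens_scaleDl.

Lemma sweedler_linear (E : lmodType K) (F : V -> U -> E) :
  bilinear_map F -> linear (sweedler F).
Proof.
move=> bF a s t.
by rewrite -[_ + _]/(tens_add (tens_scale a s) t) sweedlerD // sweedlerZ.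
Qed.

Lemma sweedler_pure (E : lmodType K) (F : V -> U -> E) v u :
  bilinear_map F -> sweedler F (pure v u) = F v u.
Proof. by move=> bF; rewrite sweedler_of // /tsum big_seq1. Qed.

Lemma pure_bilinear : bilinear_map pure.
Proof.
split=> [u|v] a w w'; apply: tens_ext => E F bF;
  by rewrite sweedler_linear // !sweedler_pure //; case: bF => l r; rewrite ?l ?r.
Qed.

Lemma tens_ofE s : tens_of s = \sum_(p <- s) pure p.1 p.2.
Proof.
apply: tens_ext => E F bF; rewrite sweedler_of // /tsum.
have swD : {morph sweedler F : s t / s + t} by move=> ? ?; apply: sweedlerD.
rewrite (big_morph (sweedler F) swD (sweedler0 bF)).
by apply: eq_bigr => p _; rewrite sweedler_pure.
Qed.

End Tensor.

Local Open Scope classical_set_scope.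
Local Open Scope ring_scope.

Section FormalCalculus.
Variable K : fieldType.
Implicit Types (W V : lmodType K) (f psi : laurent (laurent K)).

(* The product f(x1, x2) F(x1, x2). *)
Definition smul f W (F : int -> int -> W) : int -> int -> W := fun m n =>
  \sum_(ab \in [set: int * int]) (f ab.1 ab.2 *: F (m - ab.1) (n - ab.2)).

(* F(x1, x2)|_{x1 = psi(x2, z)} for F in W((x1, x2)) and psi in K((x2))((z));
   the first exponent of the result is that of z, the second that of x2. *)
Definition subst psi W (F : int -> int -> W) : int -> int -> W := fun a b =>
  \sum_(mn \in [set: int * int])
     ((psi ^ mn.1) a (b - mn.2) *: F mn.1 mn.2).

(* x2 + x0 in K((x2))((x0)) *)
Definition x2_plus_x0 : laurent (laurent K) :=
  monoL (monoL 1 1) 0 + monoL (monoL 1 0) 1.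

(* x1 - x2 in K((x1))((x2)) *)
Definition x1_minus_x2 : laurent (laurent K) :=
  monoL (monoL 1 1) 0 - monoL (monoL 1 0) 1.

(* x1 - x2 in K((x1, x2)) *)
Definition diff_x1x2 : laurent2 K := mono2 1 1 0 - mono2 1 0 1.

(* c(x1 - x2) for c in V (x) K((x)), as a function of the exponents of x1, x2. *)
Definition at_x1_minus_x2 V (c : int -> V) : int -> int -> V := fun s t =>
  \sum_(m \in [set: int]) ((x1_minus_x2 ^ m) t s *: c m).

(* Tensor products of V with a space P of Laurent series are identified with
   their images in V((x)). [decomposition P c s] : c(x) = \sum v_i f_i(x), where s is the list of the
   pairs (v_i, f_i) and the f_i satisfy P. *)
Definition decomposition (P : set (laurent K)) V (c : int -> V)
    (s : seq (V * laurent K)) : Prop :=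
  (forall vf, vf \in s -> P vf.2) /\
  (forall n, c n = \sum_(vf <- s) vf.2 n *: vf.1).

Definition in_tensor (P : set (laurent K)) V (c : int -> V) : Prop :=
  exists s, decomposition P c s.

Definition deriv_laurent (g : laurent K) : laurent K :=
  mkL (fun n => (g (n + 1)) *~ (n + 1)).

Variable p : laurent K.

(* exp(z p(x) d/dx) x, in K((x))((z)), for K of characteristic 0 *)
Definition phi : laurent (laurent K) :=
  mkL (fun k => if k is Posz j then
                  monoL (j`!%:R)^-1 0 *
                  iter j (fun g => p * deriv_laurent g) (monoL 1 1)
                else 0).

(* F(phi(x, z), x), for F in K((x1, x2)) and then for F in K_*((x1, x2)) *)
Definition at_phi (F : laurent2 K) : laurent (laurent K) :=
  mkL (fun a => @mkL K (fun b => @subst phi K^o (fun m n => F m n) a b)).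
Definition frac_at_phi : frac2 K -> laurent (laurent K) := frac_ext at_phi.

(* K_phi((x1, x2)), pi_phi and K_phi((z)) *)
Definition Kphi2 : set (frac2 K) :=
  [set F | toF (in_x1 p) * frac_der (@d1 K) F
           = - (toF (in_x2 p) * frac_der (@d2 K) F)].
Definition pi_phi (F : frac2 K) : laurent K :=
  mkL (fun k => frac_at_phi F k 0).
Definition Kphi : set (laurent K) := pi_phi @` Kphi2.
Definition pi_phi_inv (g : laurent K) : frac2 K :=
  xget 0 (Kphi2 `&` [set F | pi_phi F = g]).

(* (1 (x) pi_phi^-1) c, for c in V (x) K_phi((z)), computed on some
   decomposition of c; the result does not depend on it. *)
Definition lift_phi V (c : int -> V) : tens V (frac2 K) :=
  tens_of [seq (vf.1, pi_phi_inv vf.2) | vf <- xget [::] (decomposition Kphi c)].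

(* The product of T in V (x) K_*((x1, x2)) by F *)
Definition tens_mul V (F : frac2 K) (T : tens V (frac2 K)) : tens V (frac2 K) :=
  sweedler (fun v F' => pure v (F * F')) T.

(* T is in V (x) K((x1, x2)) *)
Definition tens_integral V (T : tens V (frac2 K)) : Prop :=
  exists s : seq (V * laurent2 K), T = tens_of [seq (vf.1, toF vf.2) | vf <- s].

(* iota_{x2, x1} on V (x) K_*((x1, x2)), with the exponents of x1 and x2 *)
Definition tens_iota V (T : tens V (frac2 K)) : int -> int -> V := fun s t =>
  sweedler (fun v F => iota_x2x1 F s t *: v) T.

End FormalCalculus.

(* [Y : V -> int -> W -> W] is a vertex operator map: [Y v n w] is the
   coefficient of x^n in Y(v, x) w. *)
Section VertexAlgebra.
Variable K : fieldType.
Implicit Types V U H W : lmodType K.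

Definition vop V W := V -> int -> W -> W.

Record vertex_map V W (Y : vop V W) : Prop := VertexMap {
  vm_bilinear : forall n, bilinear_map (fun v => Y v n);
  vm_bdd : forall v w, bdd1 (fun n => Y v n w) }.

(* Y(u, x1) Y(v, x2) w *)
Definition vop2 V W (Y : vop V W) (u v : V) (w : W) : int -> int -> W :=
  fun m n => Y u m (Y v n w).

Definition weak_assoc V W (Y : vop V V) (YW : vop V W) : Prop :=
  forall u v, exists k : nat, forall w,
    let F := smul (diff_x1x2 K ^+ k) (vop2 YW u v w) in
    bdd2 F /\
    forall a b, subst (x2_plus_x0 K) F a b = YW (Y u (a - k%:Z) v) b w.

Record nva V (Y : vop V V) (vac : V) : Prop := NVA {
  nva_map : vertex_map Y;
  nva_vacl : forall n v, Y vac n v = if n == 0 then v else 0;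
  nva_creation : forall v (n : int), n < 0 -> Y v n vac = 0;
  nva_vacr : forall v, Y v 0 vac = v;
  nva_assoc : weak_assoc Y Y }.

Record nva_module V (Y : vop V V) (vac : V) W (YW : vop V W) : Prop :=
  NVAModule {
  mod_map : vertex_map YW;
  mod_vac : forall n w, YW vac n w = if n == 0 then w else 0;
  mod_assoc : weak_assoc Y YW }.

Record nva_hom V (Y : vop V V) (vac : V) U (YU : vop U U) (vacU : U)
    (f : V -> U) : Prop := NVAHom {
  hom_linear : linear f;
  hom_vac : f vac = vacU;
  hom_vop : forall u n v, f (Y u n v) = YU (f u) n (f v) }.

Definition tens_vop V U (Y : vop V V) (YU : vop U U) : vop (tens V U) (tens V U) :=
  fun s n t =>
    sweedler (fun u h => sweedler (fun v k =>
      \sum_(m \in [set: int]) pure (Y u m v) (YU h (n - m) k)) t) s.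

Definition scalar_vop : vop K^o K^o := fun a n b => if n == 0 then a * b else 0.

Record coalgebra H (Delta : H -> tens H H) (eps : H -> K^o) : Prop := Coalgebra {
  coalg_linear : linear Delta;
  counit_linear : linear eps;
  coassoc : forall h,
    sweedler (fun a b => pure (Delta a) b) (Delta h) =
    sweedler (fun a b => sweedler (fun c d => pure (pure a c) d) (Delta b))
             (Delta h);
  counitl : forall h, sweedler (fun a b => eps a *: b) (Delta h) = h;
  counitr : forall h, sweedler (fun a b => eps b *: a) (Delta h) = h }.

Definition cocommutative H (Delta : H -> tens H H) : Prop :=
  forall h, sweedler (fun a b => pure b a) (Delta h) = Delta h.

Record nv_bialgebra H (Y : vop H H) (vac : H) (Delta : H -> tens H H)
    (eps : H -> K^o) : Prop := NVBialgebra {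
  bialg_nva : nva Y vac;
  bialg_coalg : coalgebra Delta eps;
  bialg_Delta : nva_hom Y vac (tens_vop Y Y) (pure vac vac) Delta;
  bialg_eps : nva_hom Y vac scalar_vop (1 : K^o) eps }.

(* Y(A(x1, x2), x2) c(x1), where A(x1, x2) is V-valued and c(x1) W-valued *)
Definition act_at_x2 V W (Y : vop V W) (A : int -> int -> V) (c : int -> W) :
    int -> int -> W := fun i j =>
  \sum_(st \in [set: int * int]) Y (A st.1 st.2) (j - st.2) (c (i - st.1)).

Record h_module_nva H (Y : vop H H) (vac : H) (Delta : H -> tens H H)
    (eps : H -> K^o) V (YV : vop V V) (vacV : V) (YVH : vop H V) : Prop :=
  HModuleNVA {
  hmod_nva : nva YV vacV;
  hmod_module : nva_module Y vac YVH;
  hmod_tensor : forall h v, in_tensor setT (fun n => YVH h n v);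
  hmod_vac : forall h n, YVH h n vacV = if n == 0 then eps h *: vacV else 0;
  hmod_vop : forall h u v i j,
    YVH h i (YV u j v) =
    sweedler (fun a b =>
      act_at_x2 YV (at_x1_minus_x2 (fun m => YVH a m u)) (fun m => YVH b m v) i j)
      (Delta h) }.

Record comodule_nva H (Y : vop H H) (vac : H) (Delta : H -> tens H H)
    (eps : H -> K^o) V (YV : vop V V) (vacV : V) (rho : V -> tens V H) : Prop :=
  ComoduleNVA {
  comod_hom : nva_hom YV vacV (tens_vop YV Y) (pure vacV vac) rho;
  comod_coassoc : forall v,
    sweedler (fun a b => pure (rho a) b) (rho v) =
    sweedler (fun a b => sweedler (fun c d => pure (pure a c) d) (Delta b)) (rho v);
  comod_counit : forall v, sweedler (fun a b => eps b *: a) (rho v) = v }.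

Definition comodule_compatible H V (YVH : vop H V) (rho : V -> tens V H) : Prop :=
  forall h n v,
    rho (YVH h n v) = sweedler (fun a b => pure (YVH h n a) b) (rho v).

(* \sum Y(v_(1), x) Y^H(v_(2), x); for W = V this is the vertex operator map of
   the deformed algebra D_{Y^H}^rho(V), which has the same vacuum as V. *)
Definition deformed_vop H V W (rho : V -> tens V H) (Y : vop V W) (YH : vop H W) :
    vop V W := fun v n w =>
  sweedler (fun a b => \sum_(m \in [set: int]) Y a (n - m) (YH b m w)) (rho v).

End VertexAlgebra.

Section Equivariance.
Variables (K : fieldType) (G : groupType).
Implicit Types V H W : lmodType K.

Record linear_character (chi : G -> K) : Prop := LinearCharacter {
  char1 : chi 1%g = 1;
  charM : forall g h, chi (g * h)%g = chi g * chi h }.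

Record representation V (R : G -> V -> V) : Prop := Representation {
  rep_linear : forall g, linear (R g);
  rep1 : forall v, R 1%g v = v;
  repM : forall g h v, R (g * h)%g v = R g (R h v) }.

Record g_module_nva (chi : G -> K) V (Y : vop V V) (vac : V) (R : G -> V -> V) :
    Prop := GModuleNVA {
  gmod_nva : nva Y vac;
  gmod_rep : representation R;
  gmod_vac : forall g, R g vac = vac;
  gmod_vop : forall g v n w,
    R g (Y v n (R g^-1%g w)) = chi g ^ n *: Y (R g v) n w }.

Record g_module_nv_bialgebra (chi : G -> K) H (Y : vop H H) (vac : H)
    (Delta : H -> tens H H) (eps : H -> K^o) (R : G -> H -> H) : Prop :=
  GModuleNVBialgebra {
  gbialg_bialg : nv_bialgebra Y vac Delta eps;
  gbialg_gmod : g_module_nva chi Y vac R;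
  gbialg_Delta : forall g h,
    Delta (R g h) = sweedler (fun a b => pure (R g a) (R g b)) (Delta h);
  gbialg_eps : forall g h, eps (R g h) = eps h }.

(* the monoid generated by the polynomials x - chi(g) *)
Definition char_monoid (chi : G -> K) (q : {poly K}) : Prop :=
  exists s : seq G, q = \prod_(g <- s) ('X - (chi g)%:P).

Variables (p : laurent K) (chi_phi : G -> K).

(* phi(x, chi(g) z) = chi_phi(g) phi(chi_phi(g)^-1 x, z) *)
Definition phi_characters (chi : G -> K) : Prop := forall g (k j : int),
  chi g ^ k * phi p k j = chi_phi g * ((chi_phi g)^-1 ^ j * phi p k j).

Record phi_compatible H (Y : vop H H) (vac : H) (Delta : H -> tens H H)
    (eps : H -> K^o) V (YV : vop V V) (vacV : V) (YVH : vop H V) : Prop :=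
  PhiCompatible {
  pc_hmod : h_module_nva Y vac Delta eps YV vacV YVH;
  pc_tensor : forall h v, in_tensor (Kphi p) (fun n => YVH h n v);
  pc_poles : forall h v, exists2 q, char_monoid chi_phi q &
    tens_integral (tens_mul (toF (ratio_x2x1 q))
                            (lift_phi p (fun n => YVH h n v))) }.

Record phi_quasi_module V (Y : vop V V) (vac : V) W (YW : vop V W) : Prop :=
  PhiQuasiModule {
  pqm_map : vertex_map YW;
  pqm_vac : forall n w, YW vac n w = if n == 0 then w else 0;
  pqm_assoc : forall u v, exists2 f : laurent2 K, f != 0 & forall w,
    let F := smul f (vop2 YW u v w) in
    bdd2 F /\
    forall a b, subst (phi p) F a b =
                smul (at_phi p f) (fun k n => YW (Y u k v) n w) a b }.

Record equivariant_phi_quasi_module V (Y : vop V V) (vac : V) (R : G -> V -> V)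
    W (YW : vop V W) : Prop := EquivariantPhiQuasiModule {
  eqm_quasi : phi_quasi_module Y vac YW;
  eqm_equivariant : forall g v n w,
    YW (R g v) n w = (chi_phi g)^-1 ^ n *: YW v n w;
  eqm_poles : forall u v, exists2 q, char_monoid chi_phi q &
    forall w, bdd2 (smul (ratio_x1x2 q) (vop2 YW u v w)) }.

Record hv_module H (Y : vop H H) (vac : H) (Delta : H -> tens H H)
    (RH : G -> H -> H) V (YV : vop V V) (vacV : V) (RV : G -> V -> V)
    (YVH : vop H V) W (YWH : vop H W) (YWV : vop V W) : Prop := HVModule {
  hv_H : equivariant_phi_quasi_module Y vac RH YWH;
  hv_V : equivariant_phi_quasi_module YV vacV RV YWV;
  hv_tensor : forall h w, in_tensor setT (fun n => YWH h n w);
  hv_vop : forall h v w i j,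
    YWH h i (YWV v j w) =
    sweedler (fun a b =>
      act_at_x2 YWV (tens_iota (lift_phi p (fun n => YVH a n v)))
                (fun m => YWH b m w) i j) (Delta h) }.

End Equivariance.

(* Main.v *)
From HB Require Import structures.
Require Import Defs.
From mathcomp Require Import all_boot all_order all_algebra.
From mathcomp Require Import boolp classical_sets functions cardinality fsbigop reals.
From mathcomp Require Import zify ring.
From mathcomp.real_closed Require Import complex.

(* Moving Y_W^H(u_(2), x1) to the right of Y_W^V(v_(1), x2) in the product of
   two operators Y_W^(sharp rho) costs a factor iota(F), F in K_phi((x1, x2)),
   whose poles are cleared by some q(x2/x1). Since Y_W^H(h, x1) Y_W^H(h', x2) w
   lies in W (x) K((x1, x2)), the cleared product is a K((x1, x2))-linear
   combination of series Y_W^V(u_(1), x1) Y_W^V(v', x2) w', to which the axioms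
   of the V-module W apply termwise; up to a monomial, q(x2/x1) is q'(x1/x2) for
   another q' of the same monoid, because chi_phi is a character.
   Under x1 = phi(x2, z) the operator p(x1) d/dx1 + p(x2) d/dx2 becomes
   p(x2) d/dx2, so that F turns into a series in z alone, namely pi_phi(F); and
   Y_W^H(h, x1) Y_W^H(h', x2) w turns into Y_W^H(Y(h, z) h', x2) w, because
   f(phi(x2, z), x2) <> 0 for f <> 0. The result is the iterate of the deformed
   vertex operators once rho is known to be a homomorphism compatible with the
   H-action, by coassociativity and cocommutativity. *)

Set Implicit Arguments.
Unset Strict Implicit.
Unset Printing Implicit Defensive.

Import Order.TTheory GRing.Theory Num.Theory.
Local Open Scope quotient_scope.
Local Open Scope classical_set_scope.
Local Open Scope ring_scope.

(** * Finitely supported sums *)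

(** The obstacle is that the series live in different spaces. A product Y_W^V(u, x1) Y_W^V(v, x2) w
    lies in W((x1))((x2)), the expansion iota(F) of a fraction lies in K((x2))((x1)), and series of
    the two kinds cannot in general be multiplied; only K((x1, x2)) acts on both. So the fractions
    have to be cleared before Y_W^V(u_(1), x1) is applied: the multiplier goes in across this
    operator, turns every iota(F) into an element of K((x1, x2)), and these elements come out again.
    The multiplier must not depend on w. It is a product f2 f1: f1 clears the fractions attached to
    u and v, and f2 serves the finitely many pairs of vectors of V that arise after clearing; the
    decomposition of the H-part, which does depend on w, is chosen afterwards. The two sides of
    associativity match because both are images of one identity in V (x) K_*((x1, x2)), under iota
    on one side and under x1 = phi(x2, z) on the other. *)

Definition fsupp (I : choiceType) (E : nmodType) (F : I -> E) : Prop :=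
  finite_set [set i | F i != 0].

Section FiniteSums.
Implicit Types (I J : choiceType) (E : nmodType).

Lemma fsum_seq I E (F : I -> E) (r : seq I) : uniq r ->
  (forall i, i \notin r -> F i = 0) ->
  \sum_(i \in [set: I]) F i = \sum_(i <- r) F i.
Proof.
move=> ur Fr; rewrite (@fsbigE _ _ _ _ _ r) //; last by move=> i _; apply: Fr.
by apply: eq_bigl => i; rewrite in_setT.
Qed.

Lemma fsupp_seq I E (F : I -> E) : fsupp F ->
  exists2 r : seq I, uniq r & forall i, i \notin r -> F i = 0.
Proof.
move=> /finite_seqP[r rE]; exists (undup r); first exact: undup_uniq.
move=> i; rewrite mem_undup => /negP ir; apply/eqP/negP => /negP Fi0.
have : [set i | F i != 0] i by [].
by rewrite rE.
Qed.

Lemma fsupp_sub I E (F : I -> E) (r : seq I) :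
  (forall i, i \notin r -> F i = 0) -> fsupp F.
Proof.
move=> Fr; apply: (@sub_finite_set _ _ [set` r]); last exact: finite_seq.
by move=> i /= Fi; apply: contraT => /Fr/eqP; rewrite (negbTE Fi).
Qed.

Lemma fsum_eq I E (F G : I -> E) : F =1 G ->
  \sum_(i \in [set: I]) F i = \sum_(i \in [set: I]) G i.
Proof. by move=> FG; apply: eq_fsbigr => i _; apply: FG. Qed.

Lemma fsum0 I E (F : I -> E) : (forall i, F i = 0) ->
  \sum_(i \in [set: I]) F i = 0.
Proof. by move=> F0; apply: fsbig1 => i _. Qed.

Lemma fsum_add I E (F G : I -> E) : fsupp F -> fsupp G ->
  \sum_(i \in [set: I]) (F i + G i) =
  \sum_(i \in [set: I]) F i + \sum_(i \in [set: I]) G i.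
Proof.
move=> /fsupp_seq[r _ Fr] /fsupp_seq[s _ Gs].
have rs i : i \notin undup (r ++ s) -> (F i = 0) * (G i = 0).
  by rewrite mem_undup mem_cat negb_or => /andP[/Fr -> /Gs ->].
rewrite !(@fsum_seq _ _ _ (undup (r ++ s))) ?undup_uniq ?big_split // => i /rs[];
  by do ?[move=> ->]; rewrite ?addr0.
Qed.

Lemma fsupp_big I E (X : Type) (s : seq X) (F : X -> I -> E) :
  (forall x, fsupp (F x)) -> fsupp (fun i => \sum_(x <- s) F x i).
Proof.
move=> fF; elim: s => [|x s IH].
  by apply: (@fsupp_sub _ _ _ [::]) => i _; rewrite big_nil.
case/fsupp_seq: IH => r _ Fr; case/fsupp_seq: (fF x) => t _ Ft.
apply: (@fsupp_sub _ _ _ (r ++ t)) => i; rewrite mem_cat negb_or big_cons.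
by move=> /andP[/Fr -> /Ft ->]; rewrite addr0.
Qed.

Lemma fsum_big I E (X : Type) (s : seq X) (F : X -> I -> E) :
  (forall x, fsupp (F x)) ->
  \sum_(i \in [set: I]) (\sum_(x <- s) F x i) =
  \sum_(x <- s) \sum_(i \in [set: I]) F x i.
Proof.
move=> fF; elim: s => [|x s IH].
  by rewrite big_nil; apply: fsum0 => i; rewrite big_nil.
rewrite big_cons -IH -fsum_add //; last exact: fsupp_big.
by apply: fsum_eq => i; rewrite big_cons.
Qed.

Lemma fsum_morph I (E E' : nmodType) (g : E -> E') (F : I -> E) :
  {morph g : x y / x + y} -> g 0 = 0 -> fsupp F ->
  g (\sum_(i \in [set: I]) F i) = \sum_(i \in [set: I]) g (F i).
Proof.
move=> gD g0 /fsupp_seq[r ur Fr].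
rewrite !(@fsum_seq _ _ _ r) //; first exact: (big_morph g gD g0).
by move=> i /Fr ->.
Qed.

(** Joint finiteness of the support is essential: a sum with infinite support is 0 by convention, so
    without it the two sides could silently differ. *)
Lemma fsum_exch I J E (F : I -> J -> E) : fsupp (fun ij => F ij.1 ij.2) ->
  \sum_(i \in [set: I]) \sum_(j \in [set: J]) F i j =
  \sum_(j \in [set: J]) \sum_(i \in [set: I]) F i j.
Proof.
move=> /fsupp_seq[r _ Fr].
pose a := undup (map fst r); pose b := undup (map snd r).
have ij0 i j : (i \notin a) || (j \notin b) -> F i j = 0.
  move=> ij; apply: (Fr (i, j)); apply: contraL ij; rewrite negb_or !negbK !mem_undup.
  by move=> ijr; apply/andP; split; apply/mapP; exists (i, j).
rewrite (@fsum_seq _ _ _ a) ?undup_uniq // => [|i ia]; last first.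
  by apply: fsum0 => j; rewrite ij0 ?ia.
rewrite [RHS](@fsum_seq _ _ _ b) ?undup_uniq // => [|j jb]; last first.
  by apply: fsum0 => i; rewrite ij0 ?jb ?orbT.
rewrite (eq_bigr (fun i => \sum_(j <- b) F i j)) => [|i _]; last first.
  by apply: fsum_seq => [|j jb]; rewrite ?undup_uniq // ij0 ?jb ?orbT.
rewrite [RHS](eq_bigr (fun j => \sum_(i <- a) F i j)) => [|j _]; last first.
  by apply: fsum_seq => [|i ia]; rewrite ?undup_uniq // ij0 ?ia.
exact: exchange_big.
Qed.

Lemma fsum_pair I J E (F : I * J -> E) : fsupp F ->
  \sum_(x \in [set: I * J]) F x =
  \sum_(i \in [set: I]) \sum_(j \in [set: J]) F (i, j).
Proof.
move=> /fsupp_seq[r _ Fr].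
pose a := undup (map fst r); pose b := undup (map snd r).
have ij0 i j : (i \notin a) || (j \notin b) -> F (i, j) = 0.
  move=> ij; apply: (Fr (i, j)); apply: contraL ij; rewrite negb_or !negbK !mem_undup.
  by move=> ijr; apply/andP; split; apply/mapP; exists (i, j).
rewrite [RHS](@fsum_seq _ _ _ a) ?undup_uniq // => [|i ia]; last first.
  by apply: fsum0 => j; rewrite ij0 ?ia.
rewrite [RHS](eq_bigr (fun i => \sum_(j <- b) F (i, j))) => [|i _]; last first.
  by apply: fsum_seq => [|j jb]; rewrite ?undup_uniq // ij0 ?jb ?orbT.
rewrite (@fsum_seq _ _ _ [seq (i, j) | i <- a, j <- b]).
- by rewrite big_allpairs.
- by apply: allpairs_uniq; rewrite ?undup_uniq // => -[? ?] [? ?].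
- move=> [i j] ij; apply: ij0; rewrite -negb_and; apply: contra ij => /andP[ia jb].
  by apply/allpairsP; exists (i, j).
Qed.

Lemma fsum_bij I J E (h : I -> J) (F : J -> E) : bijective h ->
  \sum_(j \in [set: J]) F j = \sum_(i \in [set: I]) F (h i).
Proof. exact: reindex_fsbigT. Qed.

Lemma fsum_shift (T : zmodType) E (F : T -> E) c :
  \sum_(i \in [set: T]) F i = \sum_(i \in [set: T]) F (i - c).
Proof. by apply: fsum_bij; exists (fun i => i + c) => i; rewrite ?subrK ?addrK. Qed.

Lemma fsum_rev (T : zmodType) E (F : T -> E) c :
  \sum_(i \in [set: T]) F i = \sum_(i \in [set: T]) F (c - i).
Proof. by apply: fsum_bij; exists (fun i => c - i) => i; rewrite subKr. Qed.

Lemma fsum_single I E (F : I -> E) x : (forall i, i != x -> F i = 0) ->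
  \sum_(i \in [set: I]) F i = F x.
Proof.
move=> Fx; rewrite (@fsum_seq _ _ _ [:: x]) ?big_seq1 // => i.
by rewrite inE; apply: Fx.
Qed.

Lemma fsum_scaler (K : pzRingType) (E : lmodType K) I (F : I -> E) a : fsupp F ->
  a *: (\sum_(i \in [set: I]) F i) = \sum_(i \in [set: I]) (a *: F i).
Proof.
by apply: fsum_morph; [move=> x y; rewrite scalerDr | rewrite scaler0].
Qed.

Lemma fsum_scalel (K : pzRingType) (E : lmodType K) I (F : I -> K) (v : E) :
  fsupp F ->
  (\sum_(i \in [set: I]) F i) *: v = \sum_(i \in [set: I]) (F i *: v).
Proof.
apply: (fsum_morph (g := fun x => x *: v)); last exact: scale0r.
by move=> x y; rewrite scalerDl.
Qed.

(** One crude symmetric window for all indices. The finiteness proofs below take for [B] a sum of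
    absolute values of the constants in sight, so that only linear arithmetic remains. *)
Definition inbox (B x : int) := (- B <= x <= B).

Definition box (B : int) : seq int :=
  [seq i%:Z - (absz B)%:Z | i <- iota 0 (absz B + absz B).+1].

Lemma mem_box B x : inbox B x -> x \in box B.
Proof.
move=> /andP[Bx xB]; apply/mapP; exists (absz (x + (absz B)%:Z)); last by lia.
by rewrite mem_iota; lia.
Qed.

Lemma fsupp1 E (F : int -> E) B : (forall a, ~~ inbox B a -> F a = 0) -> fsupp F.
Proof.
move=> FB; apply: (@fsupp_sub _ _ _ (box B)) => i iB; apply: FB.
by apply: contra iB; apply: mem_box.
Qed.

Lemma fsupp11 E (F : int * int -> E) B :
  (forall a b, ~~ (inbox B a && inbox B b) -> F (a, b) = 0) -> fsupp F.
Proof.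
move=> FB; apply: (@fsupp_sub _ _ _ [seq (a, b) | a <- box B, b <- box B]).
move=> [a b] iB; apply: FB; apply: contra iB => /andP[aB bB].
by apply/allpairsP; exists (a, b); rewrite !mem_box.
Qed.

Lemma fsupp12 E (F : int * (int * int) -> E) B :
  (forall a b c, ~~ [&& inbox B a, inbox B b & inbox B c] -> F (a, (b, c)) = 0) ->
  fsupp F.
Proof.
move=> FB; apply: (@fsupp_sub _ _ _
  [seq (a, bc) | a <- box B, bc <- [seq (b, c) | b <- box B, c <- box B]]).
move=> [a [b c]] iB; apply: FB; apply: contra iB => /and3P[aB bB cB].
apply/allpairsP; exists (a, (b, c)); split; rewrite ?mem_box //.
by apply/allpairsP; exists (b, c); rewrite !mem_box.
Qed.

Lemma fsupp_bij (I J : choiceType) (E : nmodType) (h : I -> J) (F : J -> E) :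
  bijective h -> fsupp F -> fsupp (F \o h).
Proof.
move=> [g hK gK] /fsupp_seq[r _ Fr]; apply: (@fsupp_sub _ _ _ (map g r)) => i ir.
apply: Fr; apply: contra ir => ir; apply/mapP.
by exists (h i); rewrite ?hK.
Qed.

Lemma fsupp21 E (F : (int * int) * int -> E) B :
  (forall a b c, ~~ [&& inbox B a, inbox B b & inbox B c] -> F ((a, b), c) = 0) ->
  fsupp F.
Proof.
move=> FB; apply: (@fsupp_sub _ _ _
  [seq (ab, c) | ab <- [seq (a, b) | a <- box B, b <- box B], c <- box B]).
move=> [[a b] c] iB; apply: FB; apply: contra iB => /and3P[aB bB cB].
apply/allpairsP; exists ((a, b), c); split; rewrite ?mem_box //.
by apply/allpairsP; exists (a, b); rewrite !mem_box.
Qed.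

Lemma fsupp_marg I J E (F : I * J -> E) : fsupp F ->
  fsupp (fun i => \sum_(j \in [set: J]) F (i, j)).
Proof.
move=> /fsupp_seq[r _ Fr]; apply: (@fsupp_sub _ _ _ (map fst r)) => i ir.
apply: fsum0 => j; apply: Fr; apply: contra ir => ijr.
by apply/mapP; exists (i, j).
Qed.

Lemma fsupp_slice I J E (F : I * J -> E) i : fsupp F -> fsupp (fun j => F (i, j)).
Proof.
move=> /fsupp_seq[r _ Fr]; apply: (@fsupp_sub _ _ _ (map snd r)) => j jr.
by apply: Fr; apply: contra jr => ijr; apply/mapP; exists (i, j).
Qed.

Lemma fsum_swap13 E (F : int -> int -> int -> E) :
  fsupp (fun x : (int * int) * int => F x.1.1 x.1.2 x.2) ->
  \sum_(ij \in [set: int * int]) \sum_(l \in [set: int]) F ij.1 ij.2 l =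
  \sum_(lj \in [set: int * int]) \sum_(i \in [set: int]) F i lj.2 lj.1.
Proof.
move=> fF; rewrite -(fsum_pair fF) (fsum_bij (h := fun x => ((x.2, x.1.2), x.1.1))).
  rewrite fsum_pair //; apply: (fsupp_bij (F := fun x => F x.1.1 x.1.2 x.2)) => //.
  by exists (fun x => ((x.2, x.1.2), x.1.1)) => -[[]].
by exists (fun x => ((x.2, x.1.2), x.1.1)) => -[[]].
Qed.

Lemma fsum_swap23 E (F : int -> int -> int -> E) :
  fsupp (fun x : (int * int) * int => F x.1.1 x.1.2 x.2) ->
  \sum_(ij \in [set: int * int]) \sum_(l \in [set: int]) F ij.1 ij.2 l =
  \sum_(il \in [set: int * int]) \sum_(j \in [set: int]) F il.1 j il.2.
Proof.
move=> fF; rewrite -(fsum_pair fF) (fsum_bij (h := fun x => ((x.1.1, x.2), x.1.2))).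
  rewrite fsum_pair //; apply: (fsupp_bij (F := fun x => F x.1.1 x.1.2 x.2)) => //.
  by exists (fun x => ((x.1.1, x.2), x.1.2)) => -[[]].
by exists (fun x => ((x.1.1, x.2), x.1.2)) => -[[]].
Qed.

Lemma fsupp22 E (F : (int * int) * (int * int) -> E) B :
  (forall a b c d, ~~ [&& inbox B a, inbox B b, inbox B c & inbox B d] ->
     F ((a, b), (c, d)) = 0) ->
  fsupp F.
Proof.
move=> FB; pose r := [seq (b, c) | b <- box B, c <- box B].
apply: (@fsupp_sub _ _ _ [seq (ab, cd) | ab <- r, cd <- r]).
move=> [[a b] [c d]] iB; apply: FB; apply: contra iB => /and4P[aB bB cB dB].
by apply/allpairsP; exists ((a, b), (c, d)); split => //=; apply/allpairsP;
  [exists (a, b) | exists (c, d)]; rewrite !mem_box.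
Qed.

End FiniteSums.

(** * Products of formal series *)

(* [bddA F] : F is in W((x2))((x1)); [bddB F] : F is in W((x1))((x2)). *)
Definition bddA (W : nmodType) (F : int -> int -> W) : Prop :=
  forall M : int, exists N : int,
  forall m n : int, m <= M -> (m < N) || (n < N) -> F m n = 0.
Definition swap2 (W : Type) (F : int -> int -> W) : int -> int -> W :=
  fun m n => F n m.
Definition bddB (W : nmodType) (F : int -> int -> W) : Prop := bddA (swap2 F).

Section Convolution.
Variable K : fieldType.
Implicit Types (W : lmodType K) (f g : int -> int -> K).

Definition conv f W (F : int -> int -> W) : int -> int -> W := fun m n =>
  \sum_(ab \in [set: int * int]) (f ab.1 ab.2 *: F (m - ab.1) (n - ab.2)).

Definition coefs (f : laurent (laurent K)) : int -> int -> K := fun a b => f a b.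

Lemma coefsD (f g : laurent (laurent K)) a b : coefs (f + g) a b = coefs f a b + coefs g a b.
Proof. by rewrite /coefs !coefLD. Qed.

Lemma coefs0 a b : coefs 0 a b = 0.
Proof. by rewrite /coefs !coefL0. Qed.

Lemma coefs_mono (c : K) i j a b :
  coefs (monoL (monoL c j) i) a b = if (a == i) && (b == j) then c else 0.
Proof.
rewrite /coefs monoLE; case: (a == i); last by rewrite coefL0.
by rewrite monoLE.
Qed.

Lemma coefs1 a b : coefs 1 a b = if (a == 0) && (b == 0) then 1 else 0.
Proof. exact: coefs_mono. Qed.

Lemma coefs_mk2 (c : int -> int -> K) a b : bdd2 c -> coefs (mk2 c) a b = c a b.
Proof. exact: mk2E. Qed.

Lemma coefs_mono2 (c : K) i j a b :
  coefs (mono2 c i j) a b = if (a == i) && (b == j) then c else 0.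
Proof.
by rewrite -coefs_mono -[val2 _]/(val (mono2 c i j)) mono2E.
Qed.

Lemma coefs_inj (h h' : laurent (laurent K)) : coefs h = coefs h' -> h = h'.
Proof.
move=> E; apply/laurentP => a; apply/laurentP => b.
by rewrite -[LHS]/(coefs h a b) E.
Qed.

Lemma coefs_monoM (c : K) i j (f : laurent (laurent K)) a b :
  coefs (monoL (monoL c j) i * f) a b = c * coefs f (a - i) (b - j).
Proof. by rewrite /coefs !coefL_monoM. Qed.

Lemma funext2 (T : Type) (F G : int -> int -> T) : (forall m n, F m n = G m n) -> F = G.
Proof. by move=> FG; apply: funext => m; apply: funext => n. Qed.

Lemma bdd2_bddA (W : nmodType) (F : int -> int -> W) : bdd2 F -> bddA F.
Proof. by move=> [N FN] M; exists N => m n _; apply: FN. Qed.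

Lemma bdd2_swap2 (W : nmodType) (F : int -> int -> W) : bdd2 F -> bdd2 (swap2 F).
Proof. by move=> [N FN]; exists N => m n mn; apply: FN; rewrite orbC. Qed.

Lemma bddA_lo (W : nmodType) (F : int -> int -> W) : bddA F ->
  exists2 N : int, N <= 0 & forall m n, m < N -> F m n = 0.
Proof.
move=> /(_ 0)[N FN]; exists (Num.min N 0); first by lia.
by move=> m n mN; apply: FN; lia.
Qed.

Lemma bddA_at (W : nmodType) (F : int -> int -> W) (M : int) : bddA F ->
  exists2 N : int, N <= 0 &
    forall m n, m <= M -> (m < N) || (n < N) -> F m n = 0.
Proof.
move=> /(_ M)[N FN]; exists (Num.min N 0); first by lia.
by move=> m n mM mN; apply: FN; lia.
Qed.

(** Below [N0] every bound serves, and only finitely many n lie between [N0] and M: the least of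
    their bounds serves them all. *)
Lemma uniform_bound (P : int -> int -> Prop) (N0 : int) :
  (forall n N N' : int, N' <= N -> P n N -> P n N') ->
  (forall n N : int, n < N0 -> P n N) -> (forall n, exists N, P n N) ->
  forall M : int, exists N, forall n : int, n <= M -> P n N.
Proof.
move=> Pmono P0 Pex M.
suff [N' H] : exists N' : int, forall k : nat, (k <= absz (M - N0)%R)%N ->
    P (N0 + k%:Z) N'.
  exists N' => m mM; have [mN|Nm] := ltP m N0; first exact: P0.
  by have := H (absz (m - N0)); have -> : N0 + (absz (m - N0))%:Z = m; [|apply]; lia.
elim: (absz (M - N0)) => [|k [N' IH]].
  by have [N' H] := Pex N0; exists N' => k; rewrite leqn0 => /eqP->; rewrite addr0.
have [N'' H] := Pex (N0 + k.+1%:Z); exists (Num.min N' N'') => i.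
rewrite leq_eqVlt => /predU1P[->|ik]; first by apply: Pmono H; lia.
by apply: Pmono (IH i _); lia.
Qed.

Lemma bddA_of (W : nmodType) (F : int -> int -> W) (N : int) :
  (forall m n, m < N -> F m n = 0) -> (forall m, bdd1 (F m)) -> bddA F.
Proof.
move=> F0 F1 M.
have [||m|N' H] := @uniform_bound (fun m N' => forall n : int, n < N' -> F m n = 0) N _ _ _ M.
- by move=> m P P' P'P H n nP'; apply: H; lia.
- by move=> m P mN n _; apply: F0.
- exact: F1.
exists (Num.min N N') => m n mM mn; have [mN|Nm] := ltP m N; first exact: F0.
by apply: (H m mM); lia.
Qed.

Lemma coefs_bddA (f : laurent (laurent K)) : bddA (coefs f).
Proof.
have [N fN] := coefL_bdd f; apply: (@bddA_of _ _ N) => [m n mN|m].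
  by rewrite /coefs fN ?coefL0.
exact: coefL_bdd.
Qed.

Lemma coefs_bdd2 (f : laurent2 K) : bdd2 (coefs f).
Proof. by case: f => f /= /asboolP. Qed.

(** The exponents of x1 are bounded below in both factors and have the fixed sum m, so they are also
    bounded above; under this upper bound the exponents of x2 are bounded below in both factors, and
    they have the fixed sum n. *)
Lemma conv_fsupp f W (F : int -> int -> W) m n : bddA f -> bddA F ->
  fsupp (fun ab : int * int => f ab.1 ab.2 *: F (m - ab.1) (n - ab.2)).
Proof.
move=> bf bF; have [N N0 fN] := bddA_lo bf; have [N' N'0 FN] := bddA_lo bF.
have [P P0 fP] := bddA_at (m - N') bf; have [Q Q0 FQ] := bddA_at (m - N) bF.
apply: (@fsupp11 _ _ (`|m| + `|n| - N - N' - P - Q)) => a b /= ab.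
have [aN|Na] := ltP a N; first by rewrite fN ?scale0r.
have [aN'|N'a] := ltP (m - a) N'; first by rewrite FN ?scaler0.
have [bP|Pb] := ltP b P; first by rewrite fP ?scale0r //; lia.
rewrite FQ ?scaler0 //; first by lia.
by move: ab; rewrite /inbox; lia.
Qed.

Lemma conv_bddA f W (F : int -> int -> W) : bddA f -> bddA F -> bddA (conv f F).
Proof.
move=> bf bF M; have [N N0 fN] := bddA_lo bf; have [N' N'0 FN] := bddA_lo bF.
have [P P0 fP] := bddA_at (M - N') bf; have [Q Q0 FQ] := bddA_at (M - N) bF.
exists (N + N' + P + Q) => m n mM mn; apply: fsum0 => -[a b] /=.
have [aN|Na] := ltP a N; first by rewrite fN ?scale0r.
have [aN'|N'a] := ltP (m - a) N'; first by rewrite FN ?scaler0.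
have [bP|Pb] := ltP b P; first by rewrite fP ?scale0r //; lia.
by rewrite FQ ?scaler0 //; lia.
Qed.

Lemma conv_bdd2 f W (F : int -> int -> W) : bdd2 f -> bdd2 F -> bdd2 (conv f F).
Proof.
move=> [N fN] [N' FN]; exists (N + N') => m n mn; apply: fsum0 => -[a b] /=.
have [aN|Na] := boolP ((a < N) || (b < N)); first by rewrite fN ?scale0r.
by rewrite FN ?scaler0 //; lia.
Qed.

Lemma convA f g W (F : int -> int -> W) : bddA f -> bddA g -> bddA F ->
  conv (@conv f K^o g) F = conv f (conv g F).
Proof.
move=> bf bg bF; apply: funext2 => m n.
transitivity (\sum_(c \in [set: int * int]) \sum_(a \in [set: int * int])
  (f a.1 a.2 * g (c.1 - a.1) (c.2 - a.2)) *: F (m - c.1) (n - c.2)).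
  apply: fsum_eq => c; rewrite /conv.
  by apply: fsum_scalel; apply: (@conv_fsupp f K^o g c.1 c.2 bf bg).
(* The three exponents of x1 add up to m and are bounded below, hence above by [M]; this in turn
   bounds the three exponents of x2, which add up to n. *)
rewrite fsum_exch; last first.
  have [N1 N10 f1] := bddA_lo bf; have [N2 N20 g1] := bddA_lo bg.
  have [N3 N30 F1] := bddA_lo bF; pose M : int := `|m| - N1 - N2 - N3.
  have [P1 P10 f2] := bddA_at M bf; have [P2 P20 g2] := bddA_at M bg.
  have [P3 P30 F2] := bddA_at M bF.
  apply: (@fsupp22 _ _ (`|m| + `|n| - N1 - N2 - N3 - P1 - P2 - P3)) => c1 c2 a1 a2 /= B.
  have [h1|h1] := ltP a1 N1; first by rewrite f1 ?mul0r ?scale0r.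
  have [h2|h2] := ltP (c1 - a1) N2; first by rewrite g1 ?mulr0 ?scale0r.
  have [h3|h3] := ltP (m - c1) N3; first by rewrite F1 ?scaler0.
  have [h4|h4] := ltP a2 P1; first by rewrite f2 ?mul0r ?scale0r // /M; lia.
  have [h5|h5] := ltP (c2 - a2) P2; first by rewrite g2 ?mulr0 ?scale0r // /M; lia.
  rewrite F2 ?scaler0 //; first by rewrite /M; lia.
  by move: B; rewrite /inbox; lia.
apply: fsum_eq => a; rewrite (fsum_shift _ (- a)).
rewrite [in RHS]/conv fsum_scaler; last exact: conv_fsupp.
apply: fsum_eq => c; rewrite scalerA /= !opprK !addrK !opprD.
by congr (_ *: F _ _); rewrite addrAC addrA.
Qed.

Lemma conv_swap2 f W (F : int -> int -> W) : conv (swap2 f) (swap2 F) = swap2 (conv f F).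
Proof.
apply: funext2 => m n; rewrite /swap2 /conv (fsum_bij (h := fun x => (x.2, x.1))) //.
by exists (fun x => (x.2, x.1)) => -[].
Qed.

Lemma convA_B f g W (F : int -> int -> W) : bdd2 f -> bdd2 g -> bddB F ->
  conv (@conv f K^o g) F = conv f (conv g F).
Proof.
move=> bf bg bF; suff E : swap2 (conv (@conv f K^o g) F) = swap2 (conv f (conv g F)).
  by rewrite -[LHS]/(swap2 (swap2 _)) E.
rewrite -(conv_swap2 _ F) -(conv_swap2 f (conv g F)) -(conv_swap2 g F).
rewrite -(@conv_swap2 f K^o g).
by apply: convA => //; apply/bdd2_bddA/bdd2_swap2.
Qed.

Lemma conv_bddB f W (F : int -> int -> W) : bdd2 f -> bddB F -> bddB (conv f F).
Proof.
by move=> bf bF; rewrite /bddB -conv_swap2; apply: conv_bddA => //; apply/bdd2_bddA/bdd2_swap2.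
Qed.

Lemma conv_fsuppB f W (F : int -> int -> W) m n : bdd2 f -> bddB F ->
  fsupp (fun ab : int * int => f ab.1 ab.2 *: F (m - ab.1) (n - ab.2)).
Proof.
move=> bf bF; have [r ur rP] := fsupp_seq (conv_fsupp n m (bdd2_bddA (bdd2_swap2 bf)) bF).
apply: (@fsupp_sub _ _ _ [seq (x.2, x.1) | x <- r]) => -[a b] ab.
by apply: (rP (b, a)); apply: contra ab => ab; apply/mapP; exists (b, a).
Qed.

(* [admissible f F] : the coefficients of f F are finite sums. *)
Definition admissible f W (F : int -> int -> W) : Prop := forall m n,
  fsupp (fun ab : int * int => f ab.1 ab.2 *: F (m - ab.1) (n - ab.2)).

Lemma admissibleA f W (F : int -> int -> W) : bddA f -> bddA F -> admissible f F.
Proof. by move=> bf bF m n; apply: conv_fsupp. Qed.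

Lemma admissibleB f W (F : int -> int -> W) : bdd2 f -> bddB F -> admissible f F.
Proof. by move=> bf bF m n; apply: conv_fsuppB. Qed.

Lemma bddA_sum W (X : Type) (s : seq X) (F : X -> int -> int -> W) :
  (forall x, bddA (F x)) -> bddA (fun m n => \sum_(x <- s) F x m n).
Proof.
move=> bF M; elim: s => [|x s [N IH]]; first by exists 0 => m n _ _; rewrite big_nil.
have [N' H] := bF x M; exists (Num.min N N') => m n mM mn.
by rewrite big_cons IH ?H ?addr0 //; lia.
Qed.

Lemma conv_sum f W (X : Type) (s : seq X) (F : X -> int -> int -> W) :
  (forall x, admissible f (F x)) ->
  conv f (fun m n => \sum_(x <- s) F x m n) =
  fun m n => \sum_(x <- s) conv f (F x) m n.
Proof.
move=> aF; apply: funext2 => m n; rewrite -fsum_big; last by move=> x; apply: aF.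
by apply: fsum_eq => ab; rewrite scaler_sumr.
Qed.

Lemma convDl f g W (F : int -> int -> W) : admissible f F -> admissible g F ->
  forall m n, conv (fun a b => f a b + g a b) F m n = conv f F m n + conv g F m n.
Proof.
move=> af ag m n; rewrite -fsum_add //.
by apply: fsum_eq => ab; rewrite scalerDl.
Qed.

Lemma convDr f W (F G : int -> int -> W) : admissible f F -> admissible f G ->
  forall m n, conv f (fun a b => F a b + G a b) m n = conv f F m n + conv f G m n.
Proof.
move=> aF aG m n; rewrite -fsum_add //.
by apply: fsum_eq => ab; rewrite scalerDr.
Qed.

Lemma convZl c f W (F : int -> int -> W) : admissible f F ->
  forall m n, conv (fun a b => c * f a b) F m n = c *: conv f F m n.
Proof.
by move=> aF m n; rewrite fsum_scaler //; apply: fsum_eq => ab; rewrite scalerA.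
Qed.

Lemma convZr c f W (F : int -> int -> W) : admissible f F ->
  forall m n, conv f (fun a b => c *: F a b) m n = c *: conv f F m n.
Proof.
move=> aF m n; rewrite fsum_scaler //; apply: fsum_eq => ab.
by rewrite !scalerA mulrC.
Qed.

Lemma coefs_fsupp (f g : laurent (laurent K)) m n :
  fsupp (fun ab : int * int => f ab.1 ab.2 * g (m - ab.1) (n - ab.2)).
Proof. by apply: (@conv_fsupp (coefs f) K^o (coefs g)); apply: (@coefs_bddA). Qed.

Lemma coefsM (f g : laurent (laurent K)) : coefs (f * g) = @conv (coefs f) K^o (coefs g).
Proof.
apply: funext2 => m n; rewrite /coefs coefLM.
rewrite (fsum_morph (g := fun h : laurent K => h n)); last first.
- have [N fN] := coefL_bdd f; have [N' gN] := coefL_bdd g.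
  apply: (@fsupp1 _ _ (`|m| + `|N| + `|N'|)) => a; rewrite /inbox => aB.
  have [aN|Na] := ltP a N; first by rewrite fN ?mul0r.
  by rewrite gN ?mulr0 //; lia.
- exact: coefL0.
- by move=> x y; rewrite coefLD.
rewrite /conv fsum_pair /=; last exact: coefs_fsupp.
by apply: fsum_eq => a; rewrite coefLM.
Qed.

Lemma conv1 W (F : int -> int -> W) : conv (coefs 1) F = F.
Proof.
apply: funext2 => m n; rewrite /conv (fsum_single (x := (0, 0))) /= => [|[a b] ab].
  by rewrite coefs1 !eqxx !subr0 scale1r.
rewrite /= coefs1; case: ifP => [/andP[/eqP a0 /eqP b0]|_]; last by rewrite scale0r.
by rewrite a0 b0 eqxx in ab.
Qed.

End Convolution.

(* K((x2))((x1)), sealed: unification of the concrete nested field structures is too costly. *)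
Definition LL (K : fieldType) : fieldType := laurent (laurent K).

Record sealed_field (L : fieldType) := SealedField {
  sfield :> fieldType;
  seal : L -> sfield;
  unseal : sfield -> L;
  sealK : cancel seal unseal;
  unsealK : cancel unseal seal;
  unsealD : forall f g, unseal (f + g) = unseal f + unseal g;
  unsealM : forall f g, unseal (f * g) = unseal f * unseal g;
  unseal1 : unseal 1 = 1 }.

(** Closed with [Qed], so that the copy is opaque and only the identities recorded in the structure
    can be used. *)
Definition sealed (L : fieldType) : sealed_field L.
Proof. by exists L id id. Qed.

Definition LF (K : fieldType) : fieldType := sealed (LL K).

Definition R2 (K : fieldType) : idomainType := laurent2 K.

(** * The field K((x2))((x1)) acting on series *)

Section LF.
Variable K : fieldType.
Implicit Types (f g : LF K) (u v : R2 K) (W : lmodType K).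

Definition unsealL f : laurent (laurent K) := unseal f.
Definition sealL (f : laurent (laurent K)) : LF K := seal (sealed (LL K)) f.

Lemma sealLK : cancel sealL unsealL. Proof. exact: sealK. Qed.
Lemma unsealLK : cancel unsealL sealL. Proof. exact: unsealK. Qed.
Lemma unsealLD f g : unsealL (f + g) = unsealL f + unsealL g.
Proof. exact: (unsealD (s := sealed (LL K))). Qed.
Lemma unsealLM f g : unsealL (f * g) = unsealL f * unsealL g.
Proof. exact: (unsealM (s := sealed (LL K))). Qed.
Lemma unsealL1 : unsealL 1 = 1. Proof. exact: (unseal1 (sealed (LL K))). Qed.
Lemma unsealL0 : unsealL 0 = 0.
Proof. by apply: (@addrI _ (unsealL 0)); rewrite -unsealLD !addr0. Qed.
Lemma unsealLN f : unsealL (- f) = - unsealL f.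
Proof. by apply: (@addrI _ (unsealL f)); rewrite -unsealLD !subrr unsealL0. Qed.

Definition coef2 f : int -> int -> K := coefs (unsealL f).
Definition zcoef f (a : int) : laurent K := coefL (unsealL f) a.
Definition toLF u : LF K := sealL (val2 u).
Definition monoLF (c : K) i j : LF K := sealL (monoL (monoL c j) i).
Definition mono2R (c : K) i j : R2 K := mono2 c i j.
Definition mkR2 (c : int -> int -> K) : R2 K := mk2 c.
Definition mkLF (c : int -> laurent K) : LF K := sealL (mkL c).

Lemma coef2_sealL (f : laurent (laurent K)) : coef2 (sealL f) = coefs f.
Proof. by rewrite /coef2 sealLK. Qed.
Lemma zcoefE f a b : zcoef f a b = coef2 f a b. Proof. by []. Qed.
Lemma coef2D f g a b : coef2 (f + g) a b = coef2 f a b + coef2 g a b.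
Proof. by rewrite /coef2 unsealLD coefsD. Qed.
Lemma coef2N f a b : coef2 (- f) a b = - coef2 f a b.
Proof. by rewrite /coef2 unsealLN /coefs !coefLN. Qed.
Lemma coef2B f g a b : coef2 (f - g) a b = coef2 f a b - coef2 g a b.
Proof. by rewrite coef2D coef2N. Qed.
Lemma coef2_0 a b : coef2 0 a b = 0. Proof. by rewrite /coef2 unsealL0 coefs0. Qed.
Lemma coef2_1 : coef2 1 = fun a b => if (a == 0) && (b == 0) then 1 else 0.
Proof. by apply: funext2 => a b; rewrite /coef2 unsealL1 coefs1. Qed.
Lemma coef2M f g : coef2 (f * g) = @conv K (coef2 f) K^o (coef2 g).
Proof. by rewrite /coef2 unsealLM coefsM. Qed.
Lemma coef2_inj f g : coef2 f = coef2 g -> f = g.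
Proof. by move=> /(@coefs_inj K) E; rewrite -[f]unsealLK E unsealLK. Qed.
Lemma coef2_bddA f : bddA (coef2 f). Proof. exact: coefs_bddA. Qed.
Lemma coef2_mono c i j a b : coef2 (monoLF c i j) a b = if (a == i) && (b == j) then c else 0.
Proof. by rewrite coef2_sealL coefs_mono. Qed.
Lemma coef2_monoM c i j f a b : coef2 (monoLF c i j * f) a b = c * coef2 f (a - i) (b - j).
Proof. by rewrite /coef2 unsealLM sealLK coefs_monoM. Qed.
Lemma coef2_fsupp f g m n :
  fsupp (fun ab : int * int => coef2 f ab.1 ab.2 * coef2 g (m - ab.1) (n - ab.2)).
Proof. exact: coefs_fsupp. Qed.
Lemma monoLF1 : monoLF 1 0 0 = 1.
Proof. by apply: coef2_inj; apply: funext2 => a b; rewrite coef2_mono coef2_1. Qed.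

Lemma zcoef_bdd f : exists N : int, forall n, n < N -> zcoef f n = 0.
Proof. exact: coefL_bdd. Qed.
Lemma zcoef_mkLF c : bdd1 c -> zcoef (mkLF c) = c.
Proof. by move=> bc; apply: funext => n; rewrite /zcoef sealLK mkLE. Qed.
Lemma zcoefM f g n : zcoef (f * g) n = \sum_(m \in [set: int]) (zcoef f m * zcoef g (n - m)).
Proof. by rewrite /zcoef unsealLM; apply: coefLM. Qed.
Lemma zcoef_inj f g : zcoef f = zcoef g -> f = g.
Proof.
move=> E; suff fg : unsealL f = unsealL g by rewrite -[f]unsealLK fg unsealLK.
by apply/laurentP => n; rewrite -/(zcoef f n) E.
Qed.

Lemma toLF_inj u v : toLF u = toLF v -> u = v.
Proof. by move=> /(can_inj sealLK)/val_inj. Qed.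
Lemma toLFD u v : toLF (u + v) = toLF u + toLF v.
Proof. by apply: (can_inj unsealLK); rewrite unsealLD !sealLK. Qed.
Lemma toLFM u v : toLF (u * v) = toLF u * toLF v.
Proof. by apply: (can_inj unsealLK); rewrite unsealLM !sealLK. Qed.
Lemma toLF1 : toLF 1 = 1.
Proof. by apply: (can_inj unsealLK); rewrite unsealL1 sealLK. Qed.
Lemma toLF0 : toLF 0 = 0.
Proof. by apply: (@addrI _ (toLF 0)); rewrite -toLFD !addr0. Qed.
Lemma toLFN u : toLF (- u) = - toLF u.
Proof. by apply: (@addrI _ (toLF u)); rewrite -toLFD !subrr toLF0. Qed.
Lemma toLFB u v : toLF (u - v) = toLF u - toLF v.
Proof. by rewrite toLFD toLFN. Qed.
Lemma toLF_mono c i j : toLF (mono2R c i j) = monoLF c i j.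
Proof. by rewrite /monoLF -mono2E. Qed.
Lemma coef2_toLF u : coef2 (toLF u) = coefs (val2 u).
Proof. by rewrite coef2_sealL. Qed.
Lemma coef2_mkR2 c : bdd2 c -> coef2 (toLF (mkR2 c)) = c.
Proof. by move=> bc; apply: funext2 => m n; rewrite coef2_toLF; apply: mk2E. Qed.
Lemma coef2_bdd2 u : bdd2 (coef2 (toLF u)).
Proof. by rewrite coef2_toLF; apply: coefs_bdd2. Qed.
Lemma smul_coefs (f : laurent (laurent K)) W (F : int -> int -> W) :
  smul f F = conv (coef2 (sealL f)) F.
Proof. by rewrite coef2_sealL. Qed.
Lemma smul_coef2 (f : laurent2 K) W (F : int -> int -> W) : smul f F = conv (coef2 (toLF f)) F.
Proof. by rewrite coef2_toLF. Qed.

Lemma coef2_toLF_inj u v : coef2 (toLF u) = coef2 (toLF v) -> u = v.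
Proof. by move=> /coef2_inj/toLF_inj. Qed.

Lemma convM f g W (F : int -> int -> W) : bddA F ->
  conv (coef2 (f * g)) F = conv (coef2 f) (conv (coef2 g) F).
Proof. by move=> bF; rewrite coef2M convA //; apply: coef2_bddA. Qed.

Lemma conv_coef2_1 W (F : int -> int -> W) : conv (coef2 1) F = F.
Proof. by rewrite /coef2 unsealL1; apply: conv1. Qed.

Lemma convM_B u v W (F : int -> int -> W) : bddB F ->
  conv (coef2 (toLF (u * v))) F = conv (coef2 (toLF u)) (conv (coef2 (toLF v)) F).
Proof. by move=> bF; rewrite toLFM coef2M convA_B //; apply: coef2_bdd2. Qed.

End LF.

(** * Substitution for x1 *)

Section Substitution.
Variables (K : fieldType) (psi : laurent (laurent K)) (d : int).
Hypotheses (psi0 : psi != 0) (d0 : 0 <= d).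
Hypothesis psi_lo : forall m a b : int, (a < 0) || (b < m - a * d) -> (psi ^ m) a b = 0.
Implicit Types W : lmodType K.

(** With a and b fixed, a nonzero term has m, n >= N and m + n <= b + a d: the indices run over a
    finite triangle. *)
Lemma subst_fsupp W (F : int -> int -> W) a b : bdd2 F ->
  fsupp (fun mn : int * int => (psi ^ mn.1) a (b - mn.2) *: F mn.1 mn.2).
Proof.
move=> [N FN]; apply: (@fsupp11 _ _ (`|N| + `|b| + `|a * d|)) => m n /=; rewrite /inbox => B.
have [mn|mn] := boolP ((m < N) || (n < N)); first by rewrite FN ?scaler0.
by rewrite psi_lo ?scale0r //; lia.
Qed.

Lemma subst_bddA W (F : int -> int -> W) : bdd2 F -> bddA (subst psi F).
Proof.
move=> [N FN] M; exists (Num.min 0 (N + N - `|M| * d)) => a b aM ab.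
apply: fsum0 => -[m n] /=.
have [mn|mn] := boolP ((m < N) || (n < N)); first by rewrite FN ?scaler0.
have [a0|a0] := ltP a 0; first by rewrite psi_lo ?scale0r // a0.
rewrite psi_lo ?scale0r //; have : a * d <= `|M| * d by apply: ler_wpM2r => //; lia.
by lia.
Qed.

Lemma subst_sum W (X : Type) (s : seq X) (F : X -> int -> int -> W) a b :
  (forall x, bdd2 (F x)) ->
  subst psi (fun m n => \sum_(x <- s) F x m n) a b = \sum_(x <- s) subst psi (F x) a b.
Proof.
move=> bF; rewrite -fsum_big; last by move=> x; apply: subst_fsupp.
by apply: fsum_eq => mn; rewrite scaler_sumr.
Qed.

Lemma substZ W (c : int -> int -> K) (w : W) a b : bdd2 c ->
  subst psi (fun m n => c m n *: w) a b = @subst _ psi K^o c a b *: w.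
Proof.
move=> bc; rewrite fsum_scalel; last exact: (@subst_fsupp K^o).
by apply: fsum_eq => mn; rewrite scalerA.
Qed.

Lemma psiM a i m b : (psi ^ (m + i)) a b =
  \sum_(st \in [set: int * int]) (psi ^ i) st.1 st.2 * (psi ^ m) (a - st.1) (b - st.2).
Proof.
rewrite addrC expfzDr // -[LHS]/(coefs _ a b) coefsM.
by [].
Qed.

(** Multiplicativity of the substitution comes from psi^(i + m) = psi^i psi^m; the rest is the
    finiteness needed to reorder the sums. *)
Lemma subst_conv c W (F : int -> int -> W) : bdd2 c -> bdd2 F ->
  subst psi (conv c F) = @conv K (@subst _ psi K^o c) W (subst psi F).
Proof.
move=> bc bF; have [Nc Hc] := bc; have [NF HF] := bF.
pose N := Num.min 0 (Num.min Nc NF).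
have c0 (i j : int) : (i < N) || (j < N) -> c i j = 0 by move=> ij; apply: Hc; lia.
have F0 (i j : int) : (i < N) || (j < N) -> F i j = 0 by move=> ij; apply: HF; lia.
have N0 : N <= 0 by lia.
clearbody N; clear Nc NF Hc HF.
(* A nonzero term satisfies all eight inequalities with r = s d. Leaving r as an unknown between 0
   and a d keeps the arithmetic linear. *)
have term0 (a b i j s t m n : int) :
    (forall r : int, 0 <= r -> r <= a * d ->
      ~~ [&& N <= i, N <= j, N <= m, N <= n, 0 <= s, s <= a, i - r <= t - j &
             m - (a * d - r) <= b - t - n]) ->
    ((psi ^ i) s (t - j) * c i j) *: ((psi ^ m) (a - s) (b - t - n) *: F m n) = 0.
  move=> B.
  have [h|ij] := boolP ((i < N) || (j < N)); first by rewrite c0 ?mulr0 ?scale0r.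
  have [h|mn] := boolP ((m < N) || (n < N)); first by rewrite F0 ?scaler0.
  have [h|h1] := boolP ((s < 0) || (t - j < i - s * d)).
    by rewrite psi_lo ?mul0r ?scale0r.
  rewrite (@psi_lo m (a - s)) ?scale0r ?scaler0 //.
  have [sa|sa] := ltP a s; first by lia.
  rewrite mulrBl; have := B (s * d); rewrite mulr_ge0 //; last by lia.
  by rewrite ler_wpM2r // => /(_ isT isT); lia.
apply: funext2 => a b.
transitivity (\sum_(ij \in [set: int * int]) \sum_(mn \in [set: int * int])
  ((psi ^ mn.1) a (b - mn.2) * c ij.1 ij.2) *: F (mn.1 - ij.1) (mn.2 - ij.2)).
  rewrite fsum_exch; last first.
    apply: (@fsupp22 _ _ (`|b| + `|a * d| - N - N - N)) => i j m n /= B.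
    have [h|ij] := boolP ((i < N) || (j < N)); first by rewrite c0 ?mulr0 ?scale0r.
    have [h|mn] := boolP ((m - i < N) || (n - j < N)); first by rewrite F0 ?scaler0.
    by rewrite psi_lo ?mul0r ?scale0r //; move: B; rewrite /inbox; lia.
  apply: fsum_eq => mn; rewrite /conv fsum_scaler; last first.
    by apply: conv_fsupp; apply: bdd2_bddA.
  by apply: fsum_eq => ij; rewrite scalerA.
transitivity (\sum_(ij \in [set: int * int]) \sum_(st \in [set: int * int])
  \sum_(mn \in [set: int * int])
  (((psi ^ ij.1) st.1 (st.2 - ij.2) * c ij.1 ij.2) *:
   ((psi ^ mn.1) (a - st.1) (b - st.2 - mn.2) *: F mn.1 mn.2))).
  apply: fsum_eq => -[i j]; rewrite /= (fsum_shift _ (- (i, j))) fsum_exch; last first.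
    apply: (@fsupp22 _ _ (`|a| + `|b| + `|a * d| + `|i| + `|j| - N - N - N)) => s t m n /= B.
    by apply: term0 => r r0 ra; move: B; rewrite /inbox; lia.
  apply: fsum_eq => -[m n] /=; rewrite !opprK !addrK psiM -scalerA fsum_scalel; last first.
    exact: coefs_fsupp.
  (* The shift by j absorbs the factor x2^j that accompanies the coefficient [c i j], so that t
     becomes the exponent of x2 in the substituted series c. *)
  rewrite (fsum_shift _ (0, j)); apply: fsum_eq => -[s t] /=; rewrite !subr0.
  rewrite !scalerA -!mulrA [c i j * _]mulrC; congr (_ * (_ * _) *: _); congr coefL.
  by lia.
rewrite fsum_exch; last first.
  apply: (@fsupp22 _ _ (`|a| + `|b| + `|a * d| - N - N - N)) => i j s t /= B.
  apply: fsum0 => -[m n] /=.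
  by apply: term0 => r r0 ra; move: B; rewrite /inbox; lia.
apply: fsum_eq => -[s t] /=.
rewrite fsum_scalel; last exact: (@subst_fsupp K^o).
apply: fsum_eq => -[i j] /=; rewrite fsum_scaler //.
exact: subst_fsupp.
Qed.
End Substitution.

(** * The flow of p(x) d/dx *)

Lemma natr_split (R : comPzRingType) (a b : nat) (u v : R) :
  (a + b)%:R * (u * v) = a%:R * u * v + u * (b%:R * v).
Proof. by rewrite natrD mulrDl mulrA [X in _ + X = _]mulrCA. Qed.

Section Derivation.
Variables (K : numFieldType) (p : laurent K).
Implicit Types (f g : laurent K) (W : lmodType K).

Definition pderiv f : laurent K := p * deriv_laurent f.

Lemma derivLE g n : deriv_laurent g n = g (n + 1) *~ (n + 1).
Proof.
have [N gN] := coefL_bdd g; rewrite mkLE //; exists (N - 1) => m mN.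
by rewrite gN ?mul0rz //; lia.
Qed.

Lemma derivLD f g : deriv_laurent (f + g) = deriv_laurent f + deriv_laurent g.
Proof. by apply/laurentP => n; rewrite coefLD !derivLE coefLD mulrzDl. Qed.

Lemma coefLM_fsupp f g n : fsupp (fun m => f m * g (n - m)).
Proof.
have [N fN] := coefL_bdd f; have [N' gN] := coefL_bdd g.
apply: (@fsupp1 _ _ (`|n| + `|N| + `|N'|)) => m; rewrite /inbox => mB.
have [mN|Nm] := ltP m N; first by rewrite fN ?mul0r.
by rewrite gN ?mulr0 //; lia.
Qed.

Lemma derivLM f g :
  deriv_laurent (f * g) = deriv_laurent f * g + f * deriv_laurent g.
Proof.
apply/laurentP => n; rewrite coefLD derivLE !coefLM.
rewrite (fsum_morph (g := fun x : K => x *~ (n + 1))); last first.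
- exact: coefLM_fsupp.
- exact: mul0rz.
- by move=> x y; rewrite mulrzDl.
(* After this shift the two terms of index m contain the same product of coefficients, with weights
   m and n + 1 - m, whose sum is the weight n + 1 on the left. *)
rewrite [X in _ = X + _](fsum_shift _ 1) -fsum_add; last first.
- exact: coefLM_fsupp.
- have := coefLM_fsupp (monoL 1 1 * deriv_laurent f) g (n + 1).
  congr fsupp; apply: funext => m; rewrite coefL_monoM mul1r; congr (_ * g _).
  by lia.
apply: fsum_eq => m; rewrite !derivLE subrK.
have -> : n - (m - 1) = n - m + 1 by lia.
have -> : n + 1 - m = n - m + 1 by lia.
by rewrite mulrzAl mulrzAr -mulrzDr; congr (_ *~ _); lia.
Qed.

Lemma pderivD f g : pderiv (f + g) = pderiv f + pderiv g.
Proof. by rewrite /pderiv derivLD mulrDr. Qed.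

Lemma pderiv0 : pderiv 0 = 0.
Proof. by apply: (@addrI _ (pderiv 0)); rewrite -pderivD !addr0. Qed.

Lemma pderivM f g : pderiv (f * g) = pderiv f * g + f * pderiv g.
Proof. by rewrite /pderiv derivLM mulrDr mulrA mulrCA. Qed.

Lemma pderiv_const c : pderiv (monoL c 0) = 0.
Proof.
rewrite /pderiv [deriv_laurent _](_ : _ = 0) ?mulr0 //; apply/laurentP => n.
rewrite derivLE monoLE coefL0; case: eqP => [->|]; first by rewrite mulr0z.
by rewrite mul0rz.
Qed.

Lemma pderivZ c g : pderiv (monoL c 0 * g) = monoL c 0 * pderiv g.
Proof. by rewrite pderivM pderiv_const mul0r add0r. Qed.

Lemma coefLZ c g n : (monoL c 0 * g) n = c * g n.
Proof. by rewrite coefL_monoM subr0. Qed.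

Definition xpow (m : int) : laurent K := monoL 1 m.

Lemma xpowM m n : xpow m * xpow n = xpow (m + n).
Proof.
apply/laurentP => k; rewrite coefL_monoM mul1r !monoLE.
by have -> : (k - m == n) = (k == m + n) by lia.
Qed.

Lemma coefL_mulxpow g j b : (g * xpow j) b = g (b - j).
Proof. by rewrite mulrC coefL_monoM mul1r. Qed.

Lemma pderiv_xpow m l : pderiv (xpow m) l = p (l + 1 - m) * m%:~R.
Proof.
rewrite coefLM (fsum_single (x := l + 1 - m)) => [|i im].
  by rewrite derivLE monoLE ifT; [congr (_ * _%:~R)|]; lia.
rewrite derivLE monoLE ifF ?mul0rz ?mulr0 //; lia.
Qed.

(* A linear operator on K((x)) is given by its values on the monomials if it is
   continuous; here, moreover, it lowers the exponents by at most [s]. *)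
Definition continuous_by (s : int) (T : laurent K -> laurent K) : Prop :=
  (forall m b, b < m - s -> T (xpow m) b = 0) /\
  (forall g b, T g b = \sum_(m \in [set: int]) (g m * T (xpow m) b)).

Lemma continuous_by_comp s s' T T' : continuous_by s T -> continuous_by s' T' ->
  continuous_by (s + s') (T' \o T).
Proof.
move=> cT cT'; have [T0 TE] := cT; have [T'0 T'E] := cT'.
have T'' g b : T' (T g) b = \sum_(m \in [set: int]) (g m * T' (T (xpow m)) b).
  rewrite T'E.
  transitivity (\sum_(l \in [set: int]) \sum_(m \in [set: int])
    (g m * T (xpow m) l * T' (xpow l) b)).
    by apply: fsum_eq => l; rewrite TE mulr_fsuml.
  rewrite fsum_exch; last first.
    have [N gN] := coefL_bdd g.
    apply: (@fsupp11 _ _ (`|b| + `|N| + `|s| + `|s'|)) => l m; rewrite /inbox => /= B.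
    have [mN|Nm] := ltP m N; first by rewrite gN ?mul0r.
    have [h|h] := ltP l (m - s); first by rewrite T0 // mulr0 mul0r.
    by rewrite T'0 ?mulr0 //; lia.
  apply: fsum_eq => m; rewrite T'E.
  under fsum_eq do rewrite -mulrA.
  by rewrite -mulr_fsumr.
split=> // m b bm; rewrite /= T'E; apply: fsum0 => l.
have [h|h] := ltP l (m - s); first by rewrite T0 // mul0r.
by rewrite T'0 ?mulr0 //; lia.
Qed.

Variable d : int.
Hypotheses (d0 : 0 <= d) (p_lo : lowbd p (1 - d)).

Lemma pderiv_cont : continuous_by d pderiv.
Proof.
split=> [m b bm|g b]; first by rewrite pderiv_xpow p_lo ?mul0r //; lia.
rewrite coefLM (fsum_rev _ (b + 1)); apply: fsum_eq => m.
rewrite derivLE pderiv_xpow mulrzr.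
have -> : b - (b + 1 - m) + 1 = m by lia.
by rewrite !mulrzAr mulrC.
Qed.

Definition exp_coef (k : nat) g : laurent K := monoL (k`!%:R)^-1 0 * iter k pderiv g.

Lemma exp_coef_cont k : continuous_by (k%:Z * d) (exp_coef k).
Proof.
have iter_cont : continuous_by (k%:Z * d) (iter k pderiv).
  elim: k => [|k IH].
    split=> [m b bm|g b]; first by rewrite monoLE ifF //; lia.
    rewrite (fsum_single (x := b)) => [|i ib]; first by rewrite monoLE eqxx mulr1.
    by rewrite monoLE eq_sym (negbTE ib) mulr0.
  have := continuous_by_comp IH pderiv_cont; have -> // : k%:Z * d + d = k.+1%:Z * d by lia.
have [T0 TE] := iter_cont; split=> [m b bm|g b]; rewrite coefLZ ?T0 ?mulr0 // TE.
rewrite mulr_fsumr.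
by apply: fsum_eq => m; rewrite coefLZ; apply: mulrCA.
Qed.

(** A derivation commutes with its own exponential. *)
Lemma pderiv_exp_coef k g : pderiv (exp_coef k g) = exp_coef k (pderiv g).
Proof. by rewrite /exp_coef pderivZ -iterS iterSr. Qed.

Lemma natr_laurent n : n%:R = monoL (n%:R : K) 0 :> laurent K.
Proof.
elim: n => [|n IH]; first by [].
apply/laurentP => m; rewrite !mulrS coefLD IH !monoLE.
by case: eqP => // _; rewrite addr0.
Qed.

Lemma exp_coefS k g : k.+1%:R * exp_coef k.+1 g = pderiv (exp_coef k g).
Proof.
have kE : k.+1%:R * monoL (k.+1`!%:R)^-1 0 = monoL (k`!%:R)^-1 0 :> laurent K.
  apply/laurentP => n; rewrite natr_laurent coefLZ !monoLE.
  case: eqP => _; last by rewrite mulr0.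
  by rewrite factS natrM invfM mulrA divff ?mul1r // pnatr_eq0.
by rewrite /exp_coef mulrA kE pderivZ.
Qed.

Lemma exp_coef0 g : exp_coef 0 g = g.
Proof. by apply/laurentP => n; rewrite coefLZ fact0 invr1 mul1r. Qed.

(** The divided powers D^k / k! satisfy a Leibniz rule without binomial coefficients. Multiplying by
    k + 1, which is nonzero in characteristic 0, turns the term of order k + 1 into D of the term of
    order k; the weight k + 1 of each product then splits as i + (k + 1 - i). *)
Lemma exp_coefM k f g : exp_coef k (f * g) = \sum_(i < k.+1) exp_coef i f * exp_coef (k - i)%N g.
Proof.
elim: k => [|k IH]; first by rewrite big_ord1 !exp_coef0.
have k0 : k.+1%:R != 0 :> laurent K.
  apply/eqP => /laurentP /(_ 0); rewrite natr_laurent monoLE eqxx coefL0 => /eqP.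
  by rewrite pnatr_eq0.
apply: (mulfI k0); rewrite exp_coefS IH.
have -> : pderiv (\sum_(i < k.+1) exp_coef i f * exp_coef (k - i)%N g) =
    \sum_(i < k.+1) i.+1%:R * exp_coef i.+1 f * exp_coef (k - i)%N g +
    \sum_(i < k.+1) exp_coef i f * ((k - i).+1%:R * exp_coef (k - i).+1 g).
  rewrite (big_morph pderiv pderivD pderiv0) -big_split; apply: eq_bigr => i _.
  by rewrite pderivM -!exp_coefS.
have -> : \sum_(i < k.+1) i.+1%:R * exp_coef i.+1 f * exp_coef (k - i)%N g =
    \sum_(i < k.+2) i%:R * exp_coef i f * exp_coef (k.+1 - i)%N g.
  by rewrite [RHS]big_ord_recl !mul0r add0r; apply: eq_bigr => i _; rewrite subSS.
have -> : \sum_(i < k.+1) exp_coef i f * ((k - i).+1%:R * exp_coef (k - i).+1 g) =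
    \sum_(i < k.+2) exp_coef i f * ((k.+1 - i)%:R * exp_coef (k.+1 - i) g).
  rewrite [RHS]big_ord_recr /= subnn mul0r mulr0 addr0.
  by apply: eq_bigr => i _; rewrite subSn // leq_ord.
rewrite -big_split mulr_sumr; apply: eq_bigr => i _ /=.
have := natr_split i (k.+1 - i) (exp_coef i f) (exp_coef (k.+1 - i)%N g).
by rewrite subnKC // leq_ord.
Qed.

Definition exp_flow g : laurent (laurent K) :=
  mkL (fun n => if n is Posz k then exp_coef k g else 0).

Lemma exp_flowE g n : exp_flow g n = if n is Posz k then exp_coef k g else 0.
Proof. by rewrite mkLE //; exists 0; case. Qed.

(** The exponential of a derivation is an algebra homomorphism. *)
Lemma exp_flowM f g : exp_flow (f * g) = exp_flow f * exp_flow g.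
Proof.
have Elo h : lowbd (exp_flow h) 0 by case=> // n _; rewrite exp_flowE.
apply/laurentP => -[k|n]; last by rewrite (mulL_lo (Elo f) (Elo g)) // exp_flowE.
have := mulLE_lo k (Elo f) (Elo g); rewrite !add0r => ->; rewrite exp_flowE exp_coefM.
by apply: eq_bigr => i _; rewrite !exp_flowE.
Qed.

Lemma exp_flow1 : exp_flow 1 = 1.
Proof.
apply/laurentP => -[k|n]; rewrite exp_flowE coefL1 //.
have iter0 i : iter i pderiv 0 = 0 by elim: i => //= i ->; rewrite pderiv0.
case: k => [|k]; first by rewrite exp_coef0.
by rewrite /exp_coef iterSr (pderiv_const 1 : pderiv 1 = 0) iter0 mulr0.
Qed.

Lemma phiE : phi p = exp_flow (xpow 1).
Proof. by []. Qed.

(** The flow of x^-1 is an inverse of phi. *)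
Lemma phi_neq0 : phi p != 0.
Proof.
apply/eqP => phi0; have : exp_flow (xpow 1 * xpow (-1)) = 0 by rewrite exp_flowM -phiE phi0 mul0r.
by rewrite xpowM subrr -[xpow 0]/(1 : laurent K) exp_flow1 => /eqP; rewrite oner_eq0.
Qed.

(** Both sides are multiplicative in m and agree at m = 1. Negative m matter, since phi is
    substituted into Laurent series. *)
Lemma phi_exprz m : phi p ^ m = exp_flow (xpow m).
Proof.
have pos (n : nat) : phi p ^+ n = exp_flow (xpow n).
  elim: n => [|n IH]; first by rewrite expr0 -[xpow 0]/(1 : laurent K) exp_flow1.
  by rewrite exprS IH phiE -exp_flowM xpowM.
case: m => [n|n]; first exact: pos.
rewrite NegzE -exprnN pos.
apply: (mulIf (x := exp_flow (xpow n.+1))); first by rewrite -pos expf_neq0 // phi_neq0.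
by rewrite mulVf -?pos ?expf_neq0 ?phi_neq0 // pos -exp_flowM xpowM addNr exp_flow1.
Qed.

(* The coefficients of phi(x, z)^m. *)
Definition phi_pow (m a b : int) : K := (phi p ^ m) a b.

Lemma phi_powE m (k : nat) b : phi_pow m k b = exp_coef k (xpow m) b.
Proof. by rewrite /phi_pow phi_exprz exp_flowE. Qed.

Lemma phi_pow0 a b : phi_pow 0 a b = if (a == 0) && (b == 0) then 1 else 0.
Proof.
rewrite /phi_pow phi_exprz exp_flowE; case: a => [[|k]|k]; rewrite ?coefL0 //.
  by rewrite exp_coef0 monoLE; case: eqP.
have iter0 i : iter i pderiv 0 = 0 by elim: i => //= i ->; rewrite pderiv0.
by rewrite /exp_coef iterSr (pderiv_const 1 : pderiv (xpow 0) = 0) iter0 mulr0 coefL0.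
Qed.

(** Each power of z costs at most d in the exponent of x. This is the bound that the results on
    substitution require, with psi = phi. *)
Lemma phi_lo (m a b : int) : (a < 0) || (b < m - a * d) -> (phi p ^ m) a b = 0.
Proof.
rewrite phi_exprz exp_flowE; case: a => [k|k] ab; last by rewrite coefL0.
by have [T0 _] := exp_coef_cont k; apply: T0; lia.
Qed.

Lemma phi_pow_lo (m a b : int) : (a < 0) || (b < m - a * d) -> phi_pow m a b = 0.
Proof. exact: phi_lo. Qed.

Lemma subst_phi_pow W (F : int -> int -> W) a b : subst (phi p) F a b =
  \sum_(mn \in [set: int * int]) (phi_pow mn.1 a (b - mn.2) *: F mn.1 mn.2).
Proof. by []. Qed.

End Derivation.

(** * The substitution x1 = phi(x, z) *)

Section AtPhi.
Variables (K : numFieldType) (p : laurent K).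
Implicit Types (f g : R2 K) (W : lmodType K).

Definition eval_phi f : LF K := sealL (at_phi p f).

(** With this d, the operator p(x) d/dx lowers exponents by at most d; the maximum with 0 is taken
    because the substitution results assume d >= 0. *)
Lemma order_bound : exists2 d : int, 0 <= d & lowbd p (1 - d).
Proof.
have [N pN] := coefL_bdd p; exists (Num.max 0 (1 - N)); first by lia.
by move=> n nd; apply: pN; lia.
Qed.

Lemma subst_phi_bddA W (F : int -> int -> W) : bdd2 F -> bddA (subst (phi p) F).
Proof.
have [d d0 pd] := order_bound.
exact: (subst_bddA (phi_neq0 p) d0 (phi_lo d0 pd)).
Qed.

Lemma subst_phi_lo0 W (F : int -> int -> W) a b : bdd2 F -> a < 0 -> subst (phi p) F a b = 0.
Proof.
have [d d0 pd] := order_bound => bF a0.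
by apply: fsum0 => mn; rewrite (phi_lo d0 pd) ?scale0r // a0.
Qed.

(** Both nested [mkL] return the prescribed coefficients, never the default 0: no negative power of
    z occurs, and for each power of z the exponents of x are bounded below. *)
Lemma eval_phi_subst f : coef2 (eval_phi f) = @subst K (phi p) K^o (coef2 (toLF f)).
Proof.
rewrite coef2_sealL coef2_toLF; have bf : @bdd2 K^o (coefs (val2 f)) := @coefs_bdd2 _ f.
have bA := @subst_phi_bddA K^o _ bf.
have inner a : mkL (fun b => @subst _ (phi p) K^o (coefs (val2 f)) a b) =1
    @subst _ (phi p) K^o (coefs (val2 f)) a.
  by move=> b; rewrite mkLE //; have [N H] := bA a; exists N => n nN; rewrite H ?nN ?orbT.
apply: funext2 => a b; rewrite /coefs /at_phi mkLE; first exact: inner.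
exists 0 => m m0; apply/laurentP => n; rewrite [LHS]inner coefL0.
exact: (@subst_phi_lo0 K^o).
Qed.

Lemma eval_phi_coef f a b : coef2 (eval_phi f) a b =
  \sum_(mn \in [set: int * int]) (phi_pow p mn.1 a (b - mn.2) * coef2 (toLF f) mn.1 mn.2).
Proof. by rewrite eval_phi_subst subst_phi_pow. Qed.

Lemma subst_smul f W (F : int -> int -> W) : bdd2 F ->
  subst (phi p) (conv (coef2 (toLF f)) F) = conv (coef2 (eval_phi f)) (subst (phi p) F).
Proof.
have [d d0 pd] := order_bound => bF.
rewrite (subst_conv (phi_neq0 p) d0 (phi_lo d0 pd)) // ?eval_phi_subst //.
exact: coef2_bdd2.
Qed.

Lemma eval_phi_fsupp f a b :
  fsupp (fun mn : int * int => phi_pow p mn.1 a (b - mn.2) * coef2 (toLF f) mn.1 mn.2).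
Proof.
have [d d0 pd] := order_bound.
by apply: (@subst_fsupp _ _ _ (phi_neq0 p) d0 (phi_lo d0 pd) K^o); apply: coef2_bdd2.
Qed.

Lemma eval_phiM f g : eval_phi (f * g) = eval_phi f * eval_phi g.
Proof.
apply: coef2_inj; rewrite coef2M !eval_phi_subst toLFM coef2M.
have [d d0 pd] := order_bound.
by rewrite (subst_conv (phi_neq0 p) d0 (phi_lo d0 pd)) //; apply: coef2_bdd2.
Qed.

Lemma eval_phiD f g : eval_phi (f + g) = eval_phi f + eval_phi g.
Proof.
apply: coef2_inj; apply: funext2 => a b; rewrite coef2D !eval_phi_coef -fsum_add.
- by apply: fsum_eq => mn; rewrite toLFD coef2D mulrDr.
- exact: eval_phi_fsupp.
- exact: eval_phi_fsupp.
Qed.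

Lemma eval_phi0 : eval_phi 0 = 0.
Proof. by apply: (@addrI _ (eval_phi 0)); rewrite -eval_phiD !addr0. Qed.

Lemma eval_phiN f : eval_phi (- f) = - eval_phi f.
Proof. by apply: (@addrI _ (eval_phi f)); rewrite -eval_phiD !subrr eval_phi0. Qed.

Lemma eval_phi_mono c i j a b :
  coef2 (eval_phi (mono2R c i j)) a b = phi_pow p i a (b - j) * c.
Proof.
rewrite eval_phi_coef (fsum_single (x := (i, j))) /=; first by rewrite toLF_mono coef2_mono !eqxx.
move=> [m n] mn /=; rewrite toLF_mono coef2_mono; case: ifP; rewrite ?mulr0 //.
by move=> /andP[/eqP mi /eqP nj]; rewrite mi nj eqxx in mn.
Qed.

Lemma eval_phi_const c : eval_phi (mono2R c 0 0) = monoLF c 0 0.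
Proof.
apply: coef2_inj; apply: funext2 => a b; rewrite eval_phi_mono phi_pow0 subr0 coef2_mono.
by case: ifP => _; rewrite ?mul1r ?mul0r.
Qed.

Lemma mono2R1 : mono2R 1 0 0 = 1 :> R2 K.
Proof. exact: mono2_1. Qed.

Lemma eval_phi1 : eval_phi 1 = 1.
Proof. by rewrite -mono2R1 eval_phi_const monoLF1. Qed.

Definition x1_sub_x2 : R2 K := mono2R 1 1 0 - mono2R 1 0 1.

Lemma x1_sub_x2M g m n :
  coef2 (toLF (x1_sub_x2 * g)) m n = coef2 (toLF g) (m - 1) n - coef2 (toLF g) m (n - 1).
Proof.
by rewrite toLFM /x1_sub_x2 toLFB mulrBl !toLF_mono coef2B !coef2_monoM !mul1r !subr0.
Qed.

Definition diagonal f (b : int) : K := \sum_(j \in [set: int]) coef2 (toLF f) j (b - j).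

(** Since phi(x, 0) = x, the constant term in z is f(x, x). *)
Lemma eval_phi_diag f b : coef2 (eval_phi f) 0 b = diagonal f b.
Proof.
rewrite eval_phi_coef fsum_pair; last exact: eval_phi_fsupp.
apply: fsum_eq => m; rewrite (fsum_single (x := b - m)) => [|n nb] /=.
  by rewrite (phi_powE p m 0) exp_coef0 monoLE subKr eqxx mul1r.
by rewrite (phi_powE p m 0) exp_coef0 monoLE ifF ?mul0r //; lia.
Qed.

(** The quotient is obtained by partial sums along the antidiagonals. For n < N the omitted terms
    have an exponent of x2 below N, so the partial sum is the full diagonal sum, which is 0; thus
    the quotient keeps the same bound N, and division can be repeated. *)
Lemma x1_sub_x2_div f N :
  (forall m n : int, (m < N) || (n < N) -> coef2 (toLF f) m n = 0) ->
  (forall b, diagonal f b = 0) ->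
  exists2 g, f = x1_sub_x2 * g &
    forall m n : int, (m < N) || (n < N) -> coef2 (toLF g) m n = 0.
Proof.
move=> fN f0.
pose c (m n : int) : K :=
  - \sum_(j \in [set: int]) (if j <= m then coef2 (toLF f) j (m + n + 1 - j) else 0).
have cN m n : (m < N) || (n < N) -> c m n = 0.
  move=> mn; rewrite -[RHS]oppr0; congr (- _).
  have [mN|Nm] := ltP m N.
    by apply: fsum0 => j; case: ifP => // jm; rewrite fN //; lia.
  rewrite -[RHS](f0 (m + n + 1)); apply: fsum_eq => j.
  by case: ifP => // jm; rewrite fN //; lia.
have cE m n : coef2 (toLF (mkR2 c)) m n = c m n by rewrite coef2_mkR2 //; exists N.
exists (mkR2 c) => [|m n /cN]; last by rewrite cE.
apply: coef2_toLF_inj; apply: funext2 => m n.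
rewrite x1_sub_x2M !cE /c opprK addrC.
have fs (B : int) : fsupp (fun j => if j <= B then coef2 (toLF f) j (m + n - j) else 0).
  apply: (@fsupp1 _ _ (`|m| + `|n| + `|N|)) => j; rewrite /inbox => jB.
  by case: ifP => // _; rewrite fN //; lia.
transitivity (\sum_(j \in [set: int])
    ((if j <= m then coef2 (toLF f) j (m + n - j) else 0) +
     - (if j <= m - 1 then coef2 (toLF f) j (m + n - j) else 0))).
  rewrite (fsum_single (x := m)) => [|j jm].
    by rewrite lexx ifF ?subr0; [congr coef2|]; lia.
  by case: ifP => j1; case: ifP => j2; rewrite ?subrr //; lia.
rewrite fsum_add //; last first.
  apply: (@fsupp1 _ _ (`|m| + `|n| + `|N|)) => j; rewrite /inbox => jB.
  by case: ifP => // _; rewrite ?oppr0 // fN ?oppr0 //; lia.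
congr (_ + _).
  by apply: fsum_eq => j; case: ifP => // _; congr coef2; lia.
rewrite -(fsum_morph (g := fun x : K => - x)) //; last exact: oppr0.
- by congr (- _); apply: fsum_eq => j; case: ifP => // _; congr coef2; lia.
- by move=> x y; rewrite opprD.
Qed.

Hypothesis p0 : p != 0.

(** The coefficient of z in phi(x, z) - x is p. *)
Lemma eval_phi_x1_sub_x2 : eval_phi x1_sub_x2 != 0.
Proof.
apply/eqP => H; move/eqP: p0; apply; apply/laurentP => b.
have : coef2 (eval_phi x1_sub_x2) 1 b = 0 by rewrite H coef2_0.
rewrite /x1_sub_x2 eval_phiD (eval_phiN (mono2R 1 0 1)) coef2B
  !eval_phi_mono phi_pow0 mul0r subr0 mulr1 subr0.
rewrite (phi_powE p 1 1) /exp_coef /= invr1 coefLZ mul1r pderiv_xpow addrK mulr1.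
by rewrite coefL0.
Qed.

(** If f(phi(x, z), x) = 0, then f vanishes on the diagonal, so f = (x1 - x2) g with g bounded like
    f and again in the kernel. Repeating the division, the coefficients of f of total degree below 2
    N + k vanish for every k. *)
Lemma eval_phi_inj f : eval_phi f = 0 -> f = 0.
Proof.
move=> f0; have [N fN] := coef2_bdd2 f.
have key (k : nat) : forall g, (forall m n : int, (m < N) || (n < N) -> coef2 (toLF g) m n = 0) ->
    eval_phi g = 0 -> forall m n : int, m + n < N + N + k%:Z -> coef2 (toLF g) m n = 0.
  elim: k => [|k IH] g gN g0 m n mn; first by apply: gN; lia.
  have [h gE hN] : exists2 h, g = x1_sub_x2 * h &
      forall m n : int, (m < N) || (n < N) -> coef2 (toLF h) m n = 0.
    by apply: x1_sub_x2_div => // b; rewrite -eval_phi_diag g0 coef2_0.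
  have h0 : eval_phi h = 0.
    apply/eqP; move: g0; rewrite gE eval_phiM => /eqP.
    by rewrite mulf_eq0 (negbTE eval_phi_x1_sub_x2).
  by rewrite gE x1_sub_x2M !(IH h) ?subrr //; lia.
apply: coef2_toLF_inj; apply: funext2 => m n; rewrite toLF0 [RHS]coef2_0.
by apply: (key (absz (m + n - N - N)%R).+1 f fN f0); lia.
Qed.

End AtPhi.

(** * Fractions and K_phi((x1, x2)) *)

Lemma fractionE (R : idomainType) (x : {fraction R}) :
  x = FracField.tofrac \n_(repr x) / FracField.tofrac \d_(repr x).
Proof.
have d0 := denom_ratioP (repr x).
have fd0 : FracField.tofrac \d_(repr x) != 0 by rewrite tofrac_eq0.
apply: (mulIf fd0); rewrite divfK // -[x in LHS]reprK; unlock FracField.tofrac.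
rewrite -[LHS]FracField.pi_mul; apply/eqmodP; rewrite /= FracField.equivfE.
by rewrite /FracField.mulf !numden_Ratio ?mulr1 ?oner_neq0 // reprK mulrC.
Qed.

Section FracExt.
Variables (R : idomainType) (L : fieldType) (i : R -> L).
Hypothesis embD : forall f g : R, i (f + g) = i f + i g.
Hypothesis embM : forall f g : R, i (f * g) = i f * i g.
Hypothesis emb1 : i 1 = 1.
Hypothesis emb_inj : forall f : R, i f = 0 -> f = 0.

Definition tofr (f : R) : {fraction R} := FracField.tofrac f.

Lemma embedding_neq0 (f : R) : f != 0 -> i f != 0.
Proof. by apply: contra => /eqP/emb_inj ->. Qed.

Definition frac_extension (F : {fraction R}) : L := i \n_(repr F) / i \d_(repr F).

(** The value may be computed on any representation of the fraction: cross-multiplication is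
    preserved by i, and injectivity keeps the denominators nonzero. *)
Lemma frac_extension_div (F : {fraction R}) (a b : R) : b != 0 -> F = tofr a / tofr b ->
  frac_extension F = i a / i b.
Proof.
move=> b0 FE; move: (fractionE F) (denom_ratioP (repr F)); rewrite /frac_extension.
move: (\n_(repr F)) (\d_(repr F)) => n d; rewrite FE => /eqP E d0.
have b0' : tofr b != 0 by rewrite tofrac_eq0.
have d0' : tofr d != 0 by rewrite tofrac_eq0.
move: E; rewrite eqr_div // /tofr -!tofracM tofrac_eq => /eqP E.
by apply/eqP; rewrite eqr_div ?embedding_neq0 // -!embM E.
Qed.

Lemma frac_extension_tofr a : frac_extension (tofr a) = i a.
Proof. by rewrite (@frac_extension_div _ a 1) ?oner_neq0 // ?emb1 ?divr1 // /tofr tofrac1 divr1. Qed.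

Lemma fraction_div (F : {fraction R}) : exists a b : R, b != 0 /\ F = tofr a / tofr b.
Proof.
exists \n_(repr F), \d_(repr F); split; first exact: (denom_ratioP (repr F)).
exact: fractionE.
Qed.

Lemma frac_extensionD F G : frac_extension (F + G) = frac_extension F + frac_extension G.
Proof.
have [a [b [b0 FE]]] := fraction_div F; have [c [d [d0 GE]]] := fraction_div G.
have b0' : tofr b != 0 by rewrite tofrac_eq0.
have d0' : tofr d != 0 by rewrite tofrac_eq0.
rewrite (frac_extension_div b0 FE) (frac_extension_div d0 GE) (@frac_extension_div _ (a * d + c * b) (b * d)).
- by rewrite addf_div ?embedding_neq0 // embD !embM.
- by rewrite mulf_neq0.
- by rewrite FE GE addf_div // /tofr tofracD !tofracM.
Qed.

Lemma frac_extensionM F G : frac_extension (F * G) = frac_extension F * frac_extension G.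
Proof.
have [a [b [b0 FE]]] := fraction_div F; have [c [d [d0 GE]]] := fraction_div G.
rewrite (frac_extension_div b0 FE) (frac_extension_div d0 GE) (@frac_extension_div _ (a * c) (b * d)).
- by rewrite mulf_div !embM.
- by rewrite mulf_neq0.
- by rewrite FE GE mulf_div /tofr !tofracM.
Qed.

End FracExt.

Lemma quotient_rule (R : comPzRingType) (n d n' d' : R) :
  n' * (d * d) = n' * d * d + n * d' * d - n * d * d'.
Proof. by rewrite -!mulrA [d' * d]mulrC addrK. Qed.

(** The condition defining K_phi((x1, x2)), freed of denominators: for F = n / d and the derivation
    theta = a D1 + b D2, it becomes theta(n) d = n theta(d). *)
Lemma frac_derivation_eq0 (R : idomainType) (a b d n d1 d2 n1 n2 : R) : d != 0 ->
  tofr a * (tofr (n1 * d - n * d1) / tofr (d ^+ 2)) =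
    - (tofr b * (tofr (n2 * d - n * d2) / tofr (d ^+ 2))) ->
  (a * n1 + b * n2) * d = n * (a * d1 + b * d2).
Proof.
move=> d0; have d20 : tofr (d ^+ 2) != 0 by rewrite tofrac_eq0 expf_neq0.
rewrite !mulrA -[RHS]mulNr => H; move: (mulIf (invr_neq0 d20) H) => /eqP.
rewrite /tofr -!tofracM -tofracN tofrac_eq -subr_eq0 opprK => /eqP E.
by apply/eqP; rewrite -subr_eq0 -[X in _ == X]E; apply/eqP; ring.
Qed.

Section FracK.
Variable K : fieldType.
Implicit Types (F G : frac2 K).

(** The sealed copy records no compatibility with inverses; it follows from multiplicativity, the
    case y = 0 being treated apart. *)
Lemma seal_div (x y : LL K) : sealL (x / y) = sealL x / sealL y.
Proof.
have sM (u v : LL K) : sealL (u * v) = sealL u * sealL v.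
  by apply: (can_inj (@unsealLK K)); rewrite unsealLM !sealLK.
have s1 : sealL (1 : LL K) = 1 by apply: (can_inj (@unsealLK K)); rewrite unsealL1 sealLK.
have s0 : sealL (0 : LL K) = 0 by apply: (can_inj (@unsealLK K)); rewrite unsealL0 sealLK.
have [->|y0] := eqVneq y 0; first by rewrite s0 !invr0 !mulr0 s0.
have sy0 : sealL y != 0.
  by apply: contra y0 => /eqP; rewrite -s0 => /(can_inj (@sealLK K)) ->.
by apply: (mulIf sy0); rewrite divfK // -sM divfK.
Qed.

Lemma seal_frac_ext (i : laurent2 K -> LL K) F :
  sealL (frac_ext i F) = @frac_extension (R2 K) (LF K) (fun f => sealL (i f)) F.
Proof. exact: seal_div. Qed.

Definition frac_iota F : LF K := sealL (iota_x2x1 F).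

Lemma frac_iotaE F : frac_iota F = @frac_extension (R2 K) (LF K) (@toLF K) F.
Proof. exact: seal_frac_ext. Qed.

Lemma toLF_eq0 (f : R2 K) : toLF f = 0 -> f = 0.
Proof. by rewrite -(toLF0 K) => /toLF_inj. Qed.

Lemma frac_iotaD F G : frac_iota (F + G) = frac_iota F + frac_iota G.
Proof.
rewrite !frac_iotaE; apply: (@frac_extensionD (R2 K)); [exact: toLFD|exact: toLFM|exact: toLF_eq0].
Qed.

Lemma frac_iotaM F G : frac_iota (F * G) = frac_iota F * frac_iota G.
Proof.
rewrite !frac_iotaE; apply: (@frac_extensionM (R2 K)); [exact: toLFM|exact: toLF_eq0].
Qed.

Lemma frac_iota_tofrac (f : R2 K) : frac_iota (toF f) = toLF f.
Proof.
rewrite !frac_iotaE; apply: (@frac_extension_tofr (R2 K)); [exact: toLFM|exact: toLF1|exact: toLF_eq0].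
Qed.

Lemma frac_iotaZ c F : frac_iota (c *: F) = monoLF c 0 0 * frac_iota F.
Proof.
by rewrite -[c *: F]/(toF (mono2 c 0 0) * F) frac_iotaM frac_iota_tofrac toLF_mono.
Qed.

End FracK.

(** * The substitution on fractions, and its constancy in x on K_phi((x1, x2)) *)

Section FracAt.
Variables (K : numFieldType) (p : laurent K).
Hypothesis p0 : p != 0.
Implicit Types (F G : frac2 K).

Definition frac_eval_phi F : LF K := sealL (frac_at_phi p F).

Lemma frac_eval_phiE F : frac_eval_phi F = @frac_extension (R2 K) (LF K) (eval_phi p) F.
Proof. exact: seal_frac_ext. Qed.

Lemma frac_eval_phiD F G : frac_eval_phi (F + G) = frac_eval_phi F + frac_eval_phi G.
Proof.
rewrite !frac_eval_phiE; apply: (@frac_extensionD (R2 K));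
  [exact: eval_phiD|exact: eval_phiM|exact: eval_phi_inj].
Qed.

Lemma frac_eval_phiM F G : frac_eval_phi (F * G) = frac_eval_phi F * frac_eval_phi G.
Proof.
by rewrite !frac_eval_phiE; apply: (@frac_extensionM (R2 K));
  [exact: eval_phiM|exact: eval_phi_inj].
Qed.

Lemma frac_eval_phi_tofrac (f : R2 K) : frac_eval_phi (toF f) = eval_phi p f.
Proof.
by rewrite !frac_eval_phiE; apply: (@frac_extension_tofr (R2 K));
  [exact: eval_phiM|exact: eval_phi1|exact: eval_phi_inj].
Qed.

Lemma frac_eval_phiZ c F : frac_eval_phi (c *: F) = monoLF c 0 0 * frac_eval_phi F.
Proof.
by rewrite -[c *: F]/(toF (mono2 c 0 0) * F) frac_eval_phiM frac_eval_phi_tofrac eval_phi_const.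
Qed.

(* p(x) d/dx, acting coefficientwise on K((x))((z)) *)
Definition delta (f : LF K) : LF K := mkLF (fun a => pderiv p (zcoef f a)).

Lemma zcoef_delta f a : zcoef (delta f) a = pderiv p (zcoef f a).
Proof.
rewrite zcoef_mkLF //; have [N fN] := zcoef_bdd f.
by exists N => n nN; rewrite fN // pderiv0.
Qed.

Lemma zcoef_fsupp (f g : LF K) n : fsupp (fun m => zcoef f m * zcoef g (n - m)).
Proof.
have [N fN] := zcoef_bdd f; have [N' gN] := zcoef_bdd g.
apply: (@fsupp1 _ _ (`|n| + `|N| + `|N'|)) => m; rewrite /inbox => mB.
have [mN|Nm] := ltP m N; first by rewrite fN ?mul0r.
by rewrite gN ?mulr0 //; lia.
Qed.

Lemma zcoefD (f g : LF K) a : zcoef (f + g) a = zcoef f a + zcoef g a.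
Proof. by apply/laurentP => b; rewrite coefLD !zcoefE coef2D. Qed.

Lemma deltaM f g : delta (f * g) = delta f * g + f * delta g.
Proof.
apply: zcoef_inj; apply: funext => n; rewrite zcoefD zcoef_delta !zcoefM.
rewrite (fsum_morph (g := pderiv p)); last first.
- exact: zcoef_fsupp.
- exact: pderiv0.
- exact: pderivD.
rewrite -fsum_add; last 2 first.
- exact: zcoef_fsupp.
- exact: zcoef_fsupp.
by apply: fsum_eq => m; rewrite pderivM !zcoef_delta.
Qed.

Definition theta (f : R2 K) : R2 K := (in_x1 p : R2 K) * d1 f + (in_x2 p : R2 K) * d2 f.

Lemma coef2_in_x1 (g : R2 K) a b :
  coef2 (toLF ((in_x1 p : R2 K) * g)) a b =
  \sum_(i \in [set: int]) (p (a - i) * coef2 (toLF g) i b).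
Proof.
have [N pN] := coefL_bdd p.
rewrite toLFM coef2M /conv fsum_pair; last exact: coef2_fsupp.
rewrite (fsum_rev _ a); apply: fsum_eq => i.
have cE m n : coef2 (toLF (in_x1 p)) m n = if n == 0 then p m else 0.
  rewrite coef2_toLF coefs_mk2 //; exists (Num.min N 0) => {}m {}n mn.
  by case: eqP => // n0; rewrite pN //; lia.
rewrite (fsum_single (x := 0)) => [|j j0] /=; first by rewrite cE eqxx subr0 subKr.
by rewrite cE (negbTE j0) scale0r.
Qed.

Lemma coef2_in_x2 (g : R2 K) a b :
  coef2 (toLF ((in_x2 p : R2 K) * g)) a b =
  \sum_(i \in [set: int]) (p (b - i) * coef2 (toLF g) a i).
Proof.
have [N pN] := coefL_bdd p.
rewrite toLFM coef2M /conv fsum_pair; last exact: coef2_fsupp.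
have cE m n : coef2 (toLF (in_x2 p)) m n = if m == 0 then p n else 0.
  rewrite coef2_toLF coefs_mk2 //; exists (Num.min N 0) => {}m {}n mn.
  by case: eqP => // n0; rewrite pN //; lia.
rewrite (fsum_single (x := 0)) => [|j j0] /=; last first.
  by apply: fsum0 => i; rewrite cE (negbTE j0) scale0r.
rewrite (fsum_rev _ b); apply: fsum_eq => i.
by rewrite cE eqxx subr0 subKr.
Qed.

Lemma coef2_d1 (f : R2 K) a b : coef2 (toLF (d1 f)) a b = coef2 (toLF f) (a + 1) b *~ (a + 1).
Proof.
rewrite !coef2_toLF coefs_mk2 //; have [N fN] := coefs_bdd2 f.
by exists (N - 1) => m n mn; rewrite -/(coefs (val2 f) (m + 1) n) fN ?mul0rz //; lia.
Qed.

Lemma coef2_d2 (f : R2 K) a b : coef2 (toLF (d2 f)) a b = coef2 (toLF f) a (b + 1) *~ (b + 1).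
Proof.
rewrite !coef2_toLF coefs_mk2 //; have [N fN] := coefs_bdd2 f.
by exists (N - 1) => m n mn; rewrite -/(coefs (val2 f) m (n + 1)) fN ?mul0rz //; lia.
Qed.

Lemma coef2_x1d1 (f : R2 K) a b : coef2 (toLF ((in_x1 p : R2 K) * d1 f)) a b =
  \sum_(i \in [set: int]) (coef2 (toLF f) i b * pderiv p (xpow K i) a).
Proof.
rewrite coef2_in_x1 (fsum_shift _ 1); apply: fsum_eq => i.
rewrite coef2_d1 subrK pderiv_xpow mulrzAr -mulrzr -mulrA mulrCA; congr (_ * (p _ * _)).
by lia.
Qed.

Lemma coef2_x2d2 (f : R2 K) a b : coef2 (toLF ((in_x2 p : R2 K) * d2 f)) a b =
  \sum_(i \in [set: int]) (coef2 (toLF f) a i * pderiv p (xpow K i) b).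
Proof.
rewrite coef2_in_x2 (fsum_shift _ 1); apply: fsum_eq => i.
rewrite coef2_d2 subrK pderiv_xpow mulrzAr -mulrzr -mulrA mulrCA; congr (_ * (p _ * _)).
by lia.
Qed.

Lemma eval_phi_theta (f : R2 K) :
  eval_phi p (theta f) = eval_phi p ((in_x1 p : R2 K) * d1 f) + eval_phi p ((in_x2 p : R2 K) * d2 f).
Proof. exact: eval_phiD. Qed.

(** The monomial x1^i x2^j becomes (exp(z p d/dx) x^i) x^j. The product rule gives two terms; in the
    first one p d/dx passes through the exponential and acts on x^i, in the second it acts on
    x^j. *)
Lemma delta_eval_phi_coef (f : R2 K) (k : nat) b :
  coef2 (delta (eval_phi p f)) k b =
  \sum_(ij \in [set: int * int]) (coef2 (toLF f) ij.1 ij.2 *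
    ((\sum_(l \in [set: int]) pderiv p (xpow K ij.1) l * phi_pow p l k (b - ij.2)) +
     \sum_(l \in [set: int]) pderiv p (xpow K ij.2) l * phi_pow p ij.1 k (b - l))).
Proof.
have [d d0 pd] := order_bound p; have [N fN] := coef2_bdd2 f.
have [Dlo DE] := pderiv_cont d0 pd.
rewrite -zcoefE zcoef_delta DE.
transitivity (\sum_(m \in [set: int]) \sum_(ij \in [set: int * int])
   (phi_pow p ij.1 k (m - ij.2) * coef2 (toLF f) ij.1 ij.2) * pderiv p (xpow K m) b).
  by apply: fsum_eq => m; rewrite zcoefE eval_phi_coef mulr_fsuml.
rewrite fsum_exch; last first.
  apply: (@fsupp12 _ _ (`|b| + `|k%:Z * d| + `|N| + `|N| + `|d|)) => m i j /=; rewrite /inbox => B.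
  have [h|h] := boolP ((i < N) || (j < N)); first by rewrite fN // mulr0 mul0r.
  have [h'|h'] := ltP (m - j) (i - k%:Z * d).
    by rewrite (phi_pow_lo d0 pd) ?mul0r // h' orbT.
  by rewrite Dlo ?mulr0 //; lia.
apply: fsum_eq => -[i j] /=.
transitivity (coef2 (toLF f) i j * pderiv p (exp_coef p k (xpow K i) * xpow K j) b).
  rewrite DE mulr_fsumr; apply: fsum_eq => m.
  by rewrite coefL_mulxpow phi_powE [_ * coef2 _ _ _]mulrC -mulrA.
congr (_ * _). rewrite pderivM coefLD; congr (_ + _).
  rewrite pderiv_exp_coef coefL_mulxpow.
  have [_ ->] := exp_coef_cont d0 pd k.
  by apply: fsum_eq => l; rewrite phi_powE.
rewrite coefLM (fsum_rev _ b); apply: fsum_eq => l.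
by rewrite subKr phi_powE mulrC.
Qed.

(* p(x) d/dx phi(x, z) = p(phi(x, z)) *)
Lemma delta_eval_phi (f : R2 K) : delta (eval_phi p f) = eval_phi p (theta f).
Proof.
have [d d0 pd] := order_bound p; have [N fN] := coef2_bdd2 f.
have [Dlo DE] := pderiv_cont d0 pd.
apply: coef2_inj; apply: funext2 => -[k|k] b; last first.
  rewrite eval_phi_coef fsum0 => [|mn]; last by rewrite (phi_pow_lo d0 pd) ?mul0r.
  rewrite -zcoefE zcoef_delta DE; apply: fsum0 => m; rewrite zcoefE eval_phi_coef.
  by rewrite fsum0 ?mul0r // => mn; rewrite (phi_pow_lo d0 pd) ?mul0r.
rewrite delta_eval_phi_coef eval_phi_theta coef2D [X in _ = X + _]eval_phi_coef [X in _ = _ + X]eval_phi_coef.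
pose FA (i j l : int) := coef2 (toLF f) i j * (pderiv p (xpow K i) l * phi_pow p l k (b - j)).
pose FB (i j l : int) := coef2 (toLF f) i j * (pderiv p (xpow K j) l * phi_pow p i k (b - l)).
have s1 : fsupp (fun x : int * int * int => FA x.1.1 x.1.2 x.2).
  apply: (@fsupp21 _ _ (`|b| + `|k%:Z * d| + `|N| + `|N| + `|d|)) => i j l /=; rewrite /inbox /FA /FB => B.
  have [h|h] := boolP ((i < N) || (j < N)); first by rewrite fN // mul0r.
  have [h'|h'] := ltP l (i - d); first by rewrite Dlo ?mul0r ?mulr0.
  by rewrite (phi_pow_lo d0 pd) ?mulr0 //; lia.
have s2 : fsupp (fun x : int * int * int => FB x.1.1 x.1.2 x.2).
  apply: (@fsupp21 _ _ (`|b| + `|k%:Z * d| + `|N| + `|N| + `|d|)) => i j l /=; rewrite /inbox /FA /FB => B.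
  have [h|h] := boolP ((i < N) || (j < N)); first by rewrite fN // mul0r.
  have [h'|h'] := ltP l (j - d); first by rewrite Dlo ?mul0r ?mulr0.
  by rewrite (phi_pow_lo d0 pd) ?mulr0 //; lia.
transitivity (\sum_(ij \in [set: int * int]) (
    (\sum_(l \in [set: int]) FA ij.1 ij.2 l) + \sum_(l \in [set: int]) FB ij.1 ij.2 l)).
  by apply: fsum_eq => -[i j]; rewrite mulrDr !mulr_fsumr.
rewrite fsum_add; last 2 first.
- exact: (fsupp_marg s1).
- exact: (fsupp_marg s2).
(* The exponent l produced by p d/dx becomes an exponent of the differentiated series, and the
   exponent from which it came is summed out. *)
congr (_ + _); [rewrite (fsum_swap13 s1) | rewrite (fsum_swap23 s2)].
  apply: fsum_eq => -[l j] /=; rewrite coef2_x1d1 mulr_fsumr; apply: fsum_eq => i.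
  by rewrite /FA mulrA mulrC.
apply: fsum_eq => -[i l] /=; rewrite coef2_x2d2 mulr_fsumr; apply: fsum_eq => j.
by rewrite /FB mulrA mulrC.
Qed.

(** In characteristic 0 and for p nonzero, the kernel of p(x) d/dx on K((x)) consists of the
    constants. *)
Lemma delta_eq0 (f : LF K) : delta f = 0 -> forall a b, b != 0 -> coef2 f a b = 0.
Proof.
move=> f0 a b b0.
have : pderiv p (zcoef f a) = 0.
  by rewrite -zcoef_delta f0; apply/laurentP => n; rewrite zcoefE coef2_0 coefL0.
move=> /eqP; rewrite /pderiv mulf_eq0 (negbTE p0) /= => /eqP /laurentP /(_ (b - 1)).
rewrite derivLE subrK coefL0 zcoefE => /eqP.
by rewrite -mulrzr mulf_eq0 intr_eq0 (negbTE b0) orbF => /eqP.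
Qed.

(** Write F = n / d. The substitution intertwines theta with p(x) d/dx, so theta(n) d = n theta(d)
    becomes the vanishing of the numerator in the quotient rule for F(phi(x, z), x). *)
Lemma Kphi2_const F : Kphi2 p F -> forall a b, b != 0 -> coef2 (frac_eval_phi F) a b = 0.
Proof.
move=> KF; apply: delta_eq0.
pose n : R2 K := \n_(repr F); pose d : R2 K := \d_(repr F).
have d0 : d != 0 := denom_ratioP (repr F).
have FE : F = tofr n / tofr d := fractionE F.
have E : theta n * d = n * theta d.
  exact: (frac_derivation_eq0 d0 KF).
have atd : eval_phi p d != 0 by apply: contra d0 => /eqP/(eval_phi_inj p0) ->.
have fatd : eval_phi p n = frac_eval_phi F * eval_phi p d.
  by rewrite -!frac_eval_phi_tofrac -frac_eval_phiM {1}FE divfK // tofrac_eq0.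
have : delta (eval_phi p n) * eval_phi p d = eval_phi p n * delta (eval_phi p d).
  by rewrite !delta_eval_phi -!eval_phiM E.
rewrite fatd deltaM mulrDl => /eqP; rewrite -subr_eq0 => /eqP H.
have : delta (frac_eval_phi F) * (eval_phi p d * eval_phi p d) = 0.
  by rewrite -[RHS]H; apply: quotient_rule.
by move=> /eqP; rewrite !mulf_eq0 (negbTE atd) !orbF => /eqP.
Qed.

(** [pi_phi] reads only the coefficient of x^0; for F in K_phi((x1, x2)) nothing else is present. *)
Lemma frac_eval_phi_pi F : Kphi2 p F ->
  coef2 (frac_eval_phi F) = fun a b => if b == 0 then pi_phi p F a else 0.
Proof.
move=> KF; apply: funext2 => a b; have [->|b0] := eqVneq b 0; last exact: Kphi2_const.
rewrite coef2_sealL mkLE //; have [N H] := coefL_bdd (frac_at_phi p F).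
by exists N => m mN; rewrite H // coefL0.
Qed.

End FracAt.

(** * Tensor products and the action of a vertex operator on series *)

Section Linear.
Variables (K : fieldType) (V W : lmodType K) (f : V -> W).
Hypothesis lf : linear f.

Lemma lin0 : f 0 = 0.
Proof. by have := lf (-1) 0 0; rewrite scaler0 addr0 scaleN1r addNr. Qed.

Lemma linD u v : f (u + v) = f u + f v.
Proof. by have := lf 1 u v; rewrite !scale1r. Qed.

Lemma linZ a v : f (a *: v) = a *: f v.
Proof. by have := lf a v 0; rewrite lin0 !addr0. Qed.

Lemma lin_sum (X : Type) (s : seq X) (F : X -> V) :
  f (\sum_(x <- s) F x) = \sum_(x <- s) f (F x).
Proof. exact: (big_morph f linD lin0). Qed.

Lemma lin_fsum (I : choiceType) (F : I -> V) : fsupp F ->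
  f (\sum_(i \in [set: I]) F i) = \sum_(i \in [set: I]) f (F i).
Proof. by move=> fF; apply: fsum_morph => //; [exact: linD|exact: lin0]. Qed.

End Linear.

Section LinearClosure.
Variables (K : fieldType) (V W : lmodType K).

Lemma linear_bigsum (X : Type) (s : seq X) (F : X -> V -> W) :
  (forall x, linear (F x)) -> linear (fun v => \sum_(x <- s) F x v).
Proof.
move=> lF a u v; rewrite scaler_sumr -big_split; apply: eq_bigr => x _.
exact: lF.
Qed.

Lemma linear_fsum (I : choiceType) (F : I -> V -> W) :
  (forall i, linear (F i)) -> (forall v, fsupp (fun i => F i v)) ->
  linear (fun v => \sum_(i \in [set: I]) F i v).
Proof.
move=> lF fF a u v; rewrite fsum_scaler // -fsum_add //.
- by apply: fsum_eq => i; apply: lF.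
- have /fsupp_seq[r _ Fr] := fF u; apply: (@fsupp_sub _ _ _ r) => i /Fr ->.
  by rewrite scaler0.
Qed.

End LinearClosure.

Section TensorCalculus.
Variables (K : fieldType) (V U : lmodType K).

Lemma sweedlerE (E : nmodType) (F : V -> U -> E) t :
  sweedler F t = \sum_(x <- repr t) F x.1 x.2.
Proof. by []. Qed.

Lemma sweedler_morph (E E' : lmodType K) (g : E -> E') (F : V -> U -> E) t :
  linear g -> g (sweedler F t) = sweedler (fun v u => g (F v u)) t.
Proof. by move=> lg; rewrite /sweedler /tsum (lin_sum lg). Qed.

Lemma sweedler_sweedler (V' U' : lmodType K) (E : lmodType K)
    (B : V' -> U' -> E) (F : V -> U -> tens V' U') t :
  bilinear_map B -> sweedler B (sweedler F t) = sweedler (fun v u => sweedler B (F v u)) t.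
Proof. by move=> bB; apply: sweedler_morph; apply: sweedler_linear. Qed.

Lemma eq_sweedler (E : nmodType) (F F' : V -> U -> E) t :
  (forall v u, F v u = F' v u) -> sweedler F t = sweedler F' t.
Proof. by move=> FF; apply: eq_bigr => x _; apply: FF. Qed.

End TensorCalculus.

Lemma sweedler_tens_mul (K : fieldType) (V E : lmodType K) (B : V -> frac2 K -> E) F T :
  bilinear_map B -> sweedler B (tens_mul F T) = sweedler (fun v F' => B v (F * F')) T.
Proof.
move=> bB; rewrite sweedler_sweedler //; apply: eq_sweedler => v F'.
exact: sweedler_pure.
Qed.

(* Y(u, x1) X(x1, x2) *)
Definition vop_app (K : fieldType) (V W : lmodType K) (Y : vop V W) (u : V)
    (X : int -> int -> W) : int -> int -> W := fun m n =>
  \sum_(k \in [set: int]) Y u (m - k) (X k n).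

(* A sufficient condition for the coefficients of Y(u, x1) X(x1, x2) to be finite sums. *)
Definition tame (K : fieldType) (V W : lmodType K) (Y : vop V W) (u : V)
    (X : int -> int -> W) : Prop :=
  forall M : int, exists N : int, forall n, n <= M -> forall k : int,
    ((k < N) || (n < N) -> X k n = 0) /\ (forall l, l < N -> Y u l (X k n) = 0).

Section Application.
Variables (K : fieldType) (V W : lmodType K) (Y : vop V W).
Hypothesis vY : vertex_map Y.

Lemma vY_linear v n : linear (Y v n).
Proof. by have [_] := vm_bilinear vY n; apply. Qed.

Lemma vY_linearl n w : linear (fun v => Y v n w).
Proof. by have [l _] := vm_bilinear vY n; apply: l. Qed.

Lemma vop2_bddB u v w : bddB (vop2 Y u v w).
Proof.
have [N vN] := vm_bdd vY v w; apply: (@bddA_of _ _ N) => [n m nN|n].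
  by rewrite /swap2 /vop2 vN // (lin0 (vY_linear _ _)).
exact: (vm_bdd vY).
Qed.

Variable u : V.
Implicit Types X : int -> int -> W.

Lemma tame_bddB X : tame Y u X -> bddB X.
Proof.
move=> tX M; have [N H] := tX M; exists N => n k nM nk.
by apply: (H n nM k).1; rewrite orbC.
Qed.

Lemma vop_app_fsupp X m n : tame Y u X -> fsupp (fun k => Y u (m - k) (X k n)).
Proof.
move=> tX; have [N H] := tX n; apply: (@fsupp1 _ _ (`|m| + `|N|)) => k.
rewrite /inbox => kB; have [H1 H2] := H n (lexx n) k.
have [kN|Nk] := ltP k N; first by rewrite H1 ?kN // (lin0 (vY_linear _ _)).
by rewrite H2 //; lia.
Qed.

Lemma vop_app_bddB X : tame Y u X -> bddB (vop_app Y u X).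
Proof.
move=> tX M; have [N H] := tX M; exists (Num.min N (N + N)) => n m nM nm.
apply: fsum0 => k; have [H1 H2] := H n nM k.
have [kN|Nk] := boolP ((k < N) || (n < N)).
  by rewrite H1 // (lin0 (vY_linear _ _)).
by rewrite H2 //; lia.
Qed.

Lemma vop_app_sum (T : Type) (s : seq T) (X : T -> int -> int -> W) :
  (forall x, tame Y u (X x)) ->
  vop_app Y u (fun m n => \sum_(x <- s) X x m n) = fun m n => \sum_(x <- s) vop_app Y u (X x) m n.
Proof.
move=> tX; apply: funext2 => m n; rewrite -fsum_big; last by move=> x; apply: vop_app_fsupp.
by apply: fsum_eq => k; rewrite (lin_sum (vY_linear _ _)).
Qed.

Lemma tame_sum (T : Type) (s : seq T) (X : T -> int -> int -> W) :
  (forall x, tame Y u (X x)) -> tame Y u (fun m n => \sum_(x <- s) X x m n).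
Proof.
move=> tX M; elim: s => [|x s [N IH]].
  exists 0 => n _ k; rewrite big_nil; split=> // l _.
  by rewrite (lin0 (vY_linear _ _)).
have [N' H'] := tX x M; exists (Num.min N N') => n nM k.
have [H1 H2] := H' n nM k; have [I1 I2] := IH n nM k.
split=> [kn|l lN]; rewrite big_cons ?(linD (vY_linear _ _)).
  by rewrite H1 ?I1 ?addr0 //; lia.
by rewrite H2 ?I2 ?addr0 //; lia.
Qed.

Lemma tame_conv f X : bdd2 f -> tame Y u X -> tame Y u (conv f X).
Proof.
move=> bf tX; have bX := tame_bddB tX; have [Nf fN] := bf => M.
have [N H] := tX (M - Nf); exists (Num.min N (N + Nf)) => n nM k; split.
  move=> kn; apply: fsum0 => -[a b] /=.
  have [ab|ab] := boolP ((a < Nf) || (b < Nf)); first by rewrite fN ?scale0r.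
  have nb : n - b <= M - Nf by lia.
  by rewrite (H _ nb (k - a)).1 ?scaler0 //; lia.
move=> l lN; rewrite /conv (lin_fsum (vY_linear _ _)); last exact: conv_fsuppB.
apply: fsum0 => -[a b] /=; rewrite (linZ (vY_linear _ _)).
have [ab|ab] := boolP ((a < Nf) || (b < Nf)); first by rewrite fN ?scale0r.
have nb : n - b <= M - Nf by lia.
by rewrite (H _ nb (k - a)).2 ?scaler0 //; lia.
Qed.

(** The coefficients of f are scalars and commute with each mode of Y(u, x1); tameness makes the
    double sum finite, so that f may pass as a whole. *)
Lemma conv_vop_app f X : bdd2 f -> tame Y u X -> conv f (vop_app Y u X) = vop_app Y u (conv f X).
Proof.
move=> bf tX; have bX := tame_bddB tX; have [Nf fN] := bf.
apply: funext2 => m n; have [N H] := tX (n - Nf).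
transitivity (\sum_(ab \in [set: int * int]) \sum_(k \in [set: int])
    f ab.1 ab.2 *: Y u (m - k) (X (k - ab.1) (n - ab.2))).
  apply: fsum_eq => -[a b] /=; rewrite {1}/vop_app [in LHS](fsum_shift _ a).
  rewrite fsum_scaler; first by apply: fsum_eq => k; congr (_ *: Y u _ _); lia.
  have /fsupp_seq[r _ rP] := vop_app_fsupp (m - a) (n - b) tX.
  apply: (@fsupp_sub _ _ _ [seq x + a | x <- r]) => k kr; apply: rP.
  by apply: contra kr => kr; apply/mapP; exists (k - a); rewrite ?subrK.
rewrite fsum_exch; last first.
  apply: (@fsupp21 _ _ (`|m| + `|n| + `|N| + `|N| + `|Nf|)) => a b k /=; rewrite /inbox => B.
  have [ab|ab] := boolP ((a < Nf) || (b < Nf)); first by rewrite fN ?scale0r.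
  have nb : n - b <= n - Nf by lia.
  have [H1 H2] := H _ nb (k - a).
  have [kN|Nk] := boolP ((k - a < N) || (n - b < N)).
    by rewrite H1 // (lin0 (vY_linear _ _)) scaler0.
  by rewrite H2 ?scaler0 //; lia.
apply: fsum_eq => k; rewrite /conv (lin_fsum (vY_linear _ _)); last exact: conv_fsuppB.
by apply: fsum_eq => ab; rewrite (linZ (vY_linear _ _)).
Qed.

End Application.

(** * Products of two kinds of vertex operators *)

Section Points.
Variables (K : fieldType) (W : lmodType K).

(* y(x2), as a series in x1 and x2 *)
Definition series_x2 (y : int -> W) : int -> int -> W := fun k n => if k == 0 then y n else 0.

Lemma series_x2_bdd2 y : bdd1 y -> bdd2 (series_x2 y).
Proof.
move=> [N yN]; exists (Num.min 0 N) => m n mn; rewrite /series_x2.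
by case: eqP => // m0; rewrite yN //; lia.
Qed.

Lemma conv_series_x2 c y k n : bdd2 c -> bdd1 y ->
  conv c (series_x2 y) k n = \sum_(l \in [set: int]) (c k l *: y (n - l)).
Proof.
move=> bc /series_x2_bdd2 by_; rewrite /conv fsum_pair; last first.
  by apply: conv_fsupp; apply: bdd2_bddA.
rewrite (fsum_single (x := k)) => [|j jk].
  by apply: fsum_eq => l; rewrite /series_x2 /= subrr eqxx.
apply: fsum0 => l; rewrite /series_x2 /= ifF ?scaler0 //.
by rewrite subr_eq0 eq_sym (negbTE jk).
Qed.

End Points.

(** A series in W (x) K((x)) involves finitely many vectors, so a single truncation bound serves for
    Y(v, x) on all its coefficients. This is what gives a meaning to Y(v, x) c(x) at the same
    variable x. *)
Lemma tensor_lo (K : fieldType) (V W : lmodType K) (Y : vop V W) (v : V) (c : int -> W) :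
  vertex_map Y -> in_tensor setT c ->
  exists2 N : int, (forall k, k < N -> c k = 0) & forall l k, l < N -> Y v l (c k) = 0.
Proof.
move=> vY [s [_ cE]]; have cs : c = fun k => \sum_(q <- s) q.2 k *: q.1 by apply: funext.
rewrite {}cs {cE}; elim: s => [|q s [N IH1 IH2]].
  exists 0 => [k _|l k _]; first by rewrite big_nil.
  by rewrite big_nil (lin0 (vY_linear vY _ _)).
have [N1 H1] := coefL_bdd q.2; have [N2 H2] := vm_bdd vY v q.1.
exists (Num.min N (Num.min N1 N2)) => [k kN|l k lN]; rewrite big_cons.
  by rewrite H1 ?scale0r ?add0r ?IH1 //; lia.
rewrite (linD (vY_linear vY _ _)) (linZ (vY_linear vY _ _)) H2 ?IH2 ?scaler0 ?addr0 //; lia.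
Qed.

Section DiagonalProduct.
Variables (K : fieldType) (U V W : lmodType K) (Y : vop V W) (YH : vop U W).
Hypotheses (vY : vertex_map Y) (vH : vertex_map YH).
Hypothesis tH : forall h w, in_tensor setT (fun n => YH h n w).

(* the coefficients of Y(a, x) Y^H(b, x) w *)
Definition diag_vop (a : V) (b : U) (n : int) (w : W) : W :=
  \sum_(m \in [set: int]) Y a (n - m) (YH b m w).

Lemma diag_vop_fsupp a b n w : fsupp (fun m => Y a (n - m) (YH b m w)).
Proof.
have [N H1 H2] := tensor_lo a vY (tH b w).
apply: (@fsupp1 _ _ (`|n| + `|N|)) => m; rewrite /inbox => mB.
have [mN|Nm] := ltP m N; first by rewrite H1 // (lin0 (vY_linear vY _ _)).
by rewrite H2 //; lia.
Qed.

Lemma diag_vop_bdd a b w : bdd1 (fun n => diag_vop a b n w).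
Proof.
have [N H1 H2] := tensor_lo a vY (tH b w).
exists (N + N) => n nN; apply: fsum0 => m.
have [mN|Nm] := ltP m N; first by rewrite H1 // (lin0 (vY_linear vY _ _)).
by rewrite H2 //; lia.
Qed.

Lemma diag_vop_linear a b n : linear (diag_vop a b n).
Proof.
apply: linear_fsum => [m|w]; last exact: diag_vop_fsupp.
by move=> c w w'; rewrite (vY_linear vH) (vY_linear vY).
Qed.

Lemma diag_vop_bilinear n w : bilinear_map (fun a b => diag_vop a b n w).
Proof.
split=> [b|a]; apply: linear_fsum.
- by move=> m c a a'; rewrite (vY_linearl vY).
- by move=> a; apply: diag_vop_fsupp.
- by move=> m c b b'; rewrite (vY_linearl vH) (vY_linear vY).
- by move=> b; apply: diag_vop_fsupp.
Qed.

(** The tensor condition is used twice: on w, then on each of the finitely many vectors so obtained.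
    Products f(x1) g(x2) are in K((x1, x2)). *)
Lemma vop2_tensor (b b' : U) (w : W) : exists s : seq (W * R2 K),
  forall m n, YH b m (YH b' n w) = \sum_(q <- s) coef2 (toLF q.2) m n *: q.1.
Proof.
have [s [_ sE]] := tH b' w.
have /choice[t tE] : forall w' : W, exists t : seq (W * laurent K),
    forall n, YH b n w' = \sum_(q <- t) q.2 n *: q.1.
  by move=> w'; have [t [_ tE]] := tH b w'; exists t.
pose c (f g : laurent K) : R2 K := mkR2 (fun m n => f m * g n).
exists [seq (r.1, c r.2 q.2) | q <- s, r <- t q.1] => m n.
rewrite big_allpairs_dep sE (lin_sum (vY_linear vH _ _)); apply: eq_bigr => q _.
rewrite (linZ (vY_linear vH _ _)) tE scaler_sumr; apply: eq_bigr => r _ /=.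
rewrite coef2_mkR2 ?scalerA 1?mulrC //.
have [N1 H1] := coefL_bdd r.2; have [N2 H2] := coefL_bdd q.2.
exists (Num.min N1 N2) => i j ij; have [iN|Ni] := ltP i N1; first by rewrite H1 ?mul0r.
by rewrite H2 ?mulr0 //; lia.
Qed.

End DiagonalProduct.

(** * Bilinearity of the product of a fraction and a vector-valued series *)

Section Bilinear.
Variables (K : fieldType) (V W : lmodType K) (i : frac2 K -> LF K).
Hypotheses (embD : forall F G, i (F + G) = i F + i G)
           (iZ : forall c F, i (c *: F) = monoLF c 0 0 * i F).
Variable G : V -> int -> int -> W.
Hypotheses (bG : forall v, bddA (G v)) (lG : forall k n, linear (fun v => G v k n)).

Lemma coef2_iZD c F F' : coef2 (i (c *: F + F')) = fun a b => c * coef2 (i F) a b + coef2 (i F') a b.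
Proof. by apply: funext2 => a b; rewrite embD iZ coef2D coef2_monoM !subr0. Qed.

(** Bilinearity lets [sweedler] carry an identity of V (x) K_*((x1, x2)) over to series. It serves
    for two embeddings i: the expansion iota and the substitution x1 = phi(x2, z). *)
Lemma conv_bilinear k n : bilinear_map (fun v F => conv (coef2 (i F)) (G v) k n).
Proof.
have adm v F : admissible (coef2 (i F)) (G v) by apply: admissibleA; [exact: coef2_bddA|exact: bG].
split=> [F|v] c.
  move=> v v'.
  have -> : G (c *: v + v') = fun a b => c *: G v a b + G v' a b.
    by apply: funext2 => a b; apply: lG.
  rewrite (convDr (F := fun a b => c *: G v a b)) ?convZr //.
  move=> a b; have /fsupp_seq[r _ rP] := adm v F a b.
  apply: (@fsupp_sub _ _ _ r) => x /rP E.
  by rewrite scalerA mulrC -scalerA E scaler0.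
move=> F F'; rewrite coef2_iZD (convDl (f := fun a b => c * coef2 (i F) a b)) ?convZl //.
move=> a b; have /fsupp_seq[r _ rP] := adm v F a b.
by apply: (@fsupp_sub _ _ _ r) => x /rP E; rewrite -scalerA E scaler0.
Qed.

Lemma coef2_bilinear s t : bilinear_map (fun (v : V) F => coef2 (i F) s t *: v).
Proof.
split=> [F|v] c; first by move=> v v'; rewrite scalerDr !scalerA mulrC.
by move=> F F'; rewrite coef2_iZD scalerDl scalerA.
Qed.

End Bilinear.

(** * Expansion of Y(u, x1) Y(v, x2) *)

Section Expansion.
Variables (K : numFieldType) (p : laurent K) (H V W : lmodType K).
Variables (Delta : H -> tens H H) (YVH : vop H V) (YWH : vop H W) (YWV : vop V W).
Hypotheses (vH : vertex_map YWH) (vV : vertex_map YWV).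
Hypothesis tH : forall h w, in_tensor setT (fun n => YWH h n w).
Hypothesis tVH : forall h v, in_tensor (Kphi p) (fun n => YVH h n v).
Hypothesis hv : forall h v w i j,
  YWH h i (YWV v j w) =
  sweedler (fun a b =>
    act_at_x2 YWV (tens_iota (lift_phi p (fun n => YVH a n v)))
              (fun m => YWH b m w) i j) (Delta h).

Definition hat_vop (a : H) (v : V) : tens V (frac2 K) := lift_phi p (fun n => YVH a n v).

(** The decomposition selected by [lift_phi] exists by [tVH], so its default empty list never
    occurs; on K_phi((z)) the selected preimages are genuine ones. *)
Lemma hat_vop_decomp a v : exists s : seq (V * frac2 K),
  [/\ hat_vop a v = tens_of s, forall q, q \in s -> Kphi2 p q.2 &
      forall n, YVH a n v = \sum_(q <- s) pi_phi p q.2 n *: q.1].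
Proof.
rewrite /hat_vop /lift_phi; case: xgetP => [s _ [sP sE]|]; last first.
  by move=> /(_ _)/asboolP; have [s sP] := tVH a v => /(_ s) /asboolP; case.
have inv g : Kphi p g -> Kphi2 p (pi_phi_inv p g) /\ pi_phi p (pi_phi_inv p g) = g.
  move=> [F KF Fg]; rewrite /pi_phi_inv; case: xgetP => [F' _ [] //|].
  by move=> /(_ F); case.
exists [seq (vf.1, pi_phi_inv p vf.2) | vf <- s]; split => //.
  by move=> q /mapP[vf /sP /inv[? _] ->].
move=> n; rewrite sE big_map big_seq [RHS]big_seq; apply: eq_bigr => vf vfs /=.
by have [_ ->] := inv _ (sP _ vfs).
Qed.

Definition vop_x2 (v : V) (w : W) : int -> int -> W := series_x2 (fun n => YWV v n w).

Lemma vop_x2_bdd2 v w : bdd2 (vop_x2 v w).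
Proof. exact: (series_x2_bdd2 (vm_bdd vV v w)). Qed.

Lemma vop_x2_linear w k n : linear (fun v => vop_x2 v w k n).
Proof.
move=> c v v'; rewrite /vop_x2 /series_x2; case: eqP => _; first exact: (vY_linearl vV).
by rewrite scaler0 addr0.
Qed.

Lemma term_fsupp (f : LF K) (c : R2 K) (y : int -> W) k n : bdd1 y ->
  fsupp (fun x : int * (int * int) =>
    coef2 f x.2.1 x.2.2 *: (coef2 (toLF c) (k - x.2.1) x.1 *: y (n - x.1 - x.2.2))).
Proof.
move=> [Q yQ]; have [N cN] := coef2_bdd2 c.
have [P P0 fP] := bddA_at (k - N) (@coef2_bddA _ f).
apply: (@fsupp12 _ _ (`|k| + `|n| + `|N| + `|P| + `|Q|)) => l s t /=; rewrite /inbox => B.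
have [h|h] := boolP ((k - s < N) || (l < N)); first by rewrite cN ?scale0r ?scaler0.
have [h'|h'] := boolP ((s < P) || (t < P)); first by rewrite fP ?scale0r //; lia.
by rewrite yQ ?scaler0 //; lia.
Qed.

Lemma term_conv (f : LF K) (c : R2 K) (y : int -> W) k n : bdd1 y ->
  \sum_(l \in [set: int]) \sum_(st \in [set: int * int])
    (coef2 f st.1 st.2 *: (coef2 (toLF c) (k - st.1) l *: y (n - l - st.2))) =
  conv (coef2 f) (conv (coef2 (toLF c)) (series_x2 y)) k n.
Proof.
move=> by_; rewrite fsum_exch; last exact: term_fsupp.
apply: fsum_eq => -[s t] /=; rewrite conv_series_x2 //; last exact: coef2_bdd2.
rewrite fsum_scaler; last first.
  have [Q yQ] := by_; have [N cN] := coef2_bdd2 c.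
  apply: (@fsupp1 _ _ (`|n - t| + `|N| + `|Q|)) => l; rewrite /inbox => lB.
  have [h|h] := ltP l N; first by rewrite cN ?scale0r // h orbT.
  by rewrite yQ ?scaler0 //; lia.
by apply: fsum_eq => l; congr (_ *: (_ *: y _)); lia.
Qed.

(** After the exchange relation, an H-operator at x1 stands directly before Y_W^H(v2, x2) w. Their
    product is given by [C], so only Y_W^V at x2 survives on vectors, multiplied by scalar
    series. *)
Lemma move_H (u2 : H) (v1 : V) (v2 : H) (w : W)
    (S : H -> seq (V * frac2 K)) (C : H -> seq (W * R2 K)) :
  (forall a, hat_vop a v1 = tens_of (S a)) ->
  (forall b m n, YWH b m (YWH v2 n w) = \sum_(q <- C b) coef2 (toLF q.2) m n *: q.1) ->
  (fun k n => YWH u2 k (diag_vop YWV YWH v1 v2 n w)) = fun k n =>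
  \sum_(ab <- repr (Delta u2)) \sum_(q <- C ab.2) \sum_(r <- S ab.1)
    conv (coef2 (frac_iota r.2)) (conv (coef2 (toLF q.2)) (vop_x2 r.1 q.1)) k n.
Proof.
move=> SE CE; apply: funext2 => k n; rewrite /diag_vop (lin_fsum (vY_linear vH _ _)); last first.
  exact: (diag_vop_fsupp vV tH).
have act a b l : act_at_x2 YWV (tens_iota (hat_vop a v1)) (fun m => YWH b m (YWH v2 l w)) k (n - l) =
    \sum_(q <- C b) \sum_(r <- S a) \sum_(st \in [set: int * int])
      coef2 (frac_iota r.2) st.1 st.2 *:
        (coef2 (toLF q.2) (k - st.1) l *: YWV r.1 (n - l - st.2) q.1).
  rewrite /act_at_x2.
  transitivity (\sum_(st \in [set: int * int]) \sum_(q <- C b) \sum_(r <- S a)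
      coef2 (frac_iota r.2) st.1 st.2 *:
        (coef2 (toLF q.2) (k - st.1) l *: YWV r.1 (n - l - st.2) q.1)).
    apply: fsum_eq => -[s t] /=; rewrite CE (lin_sum (vY_linear vV _ _)).
    apply: eq_bigr => q _; rewrite (linZ (vY_linear vV _ _)).
    have -> : tens_iota (hat_vop a v1) s t = \sum_(r <- S a) coef2 (frac_iota r.2) s t *: r.1.
      rewrite SE /tens_iota.
      transitivity (sweedler (fun v F => coef2 (frac_iota F) s t *: v) (tens_of (S a))).
        by apply: eq_sweedler => v F; rewrite coef2_sealL.
      by rewrite sweedler_of //; apply: coef2_bilinear; [exact: frac_iotaD|exact: frac_iotaZ].
    rewrite (lin_sum (vY_linearl vV _ _)) scaler_sumr; apply: eq_bigr => r _.
    by rewrite (linZ (vY_linearl vV _ _)) !scalerA mulrC.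
  have fs q r := fsupp_slice l (term_fsupp (frac_iota r.2) q.2 k n (vm_bdd vV r.1 q.1)).
  rewrite fsum_big => [|q].
    by apply: eq_bigr => q _; rewrite fsum_big // => r; apply: (fs q r).
  by apply: fsupp_big => r; apply: (fs q r).
transitivity (\sum_(l \in [set: int]) \sum_(ab <- repr (Delta u2))
    \sum_(q <- C ab.2) \sum_(r <- S ab.1) \sum_(st \in [set: int * int])
      coef2 (frac_iota r.2) st.1 st.2 *:
        (coef2 (toLF q.2) (k - st.1) l *: YWV r.1 (n - l - st.2) q.1)).
  by apply: fsum_eq => l; rewrite hv sweedlerE; apply: eq_bigr => ab _; apply: act.
have fs q r : fsupp (fun l => \sum_(st \in [set: int * int])
      coef2 (frac_iota r.2) st.1 st.2 *:
        (coef2 (toLF q.2) (k - st.1) l *: YWV r.1 (n - l - st.2) q.1)).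
  exact: (fsupp_marg (term_fsupp (frac_iota r.2) q.2 k n (vm_bdd vV r.1 q.1))).
rewrite fsum_big => [|ab]; last first.
  by apply: fsupp_big => q; apply: fsupp_big => r; apply: fs.
apply: eq_bigr => ab _; rewrite fsum_big => [|q]; last first.
  by apply: fsupp_big => r; apply: fs.
apply: eq_bigr => q _; rewrite fsum_big => [|r]; last exact: fs.
by apply: eq_bigr => r _; apply: term_conv; apply: (vm_bdd vV).
Qed.

Lemma tame_vop_x2 (u v : V) (w : W) : tame YWV u (vop_x2 v w).
Proof.
have bB := vop2_bddB vV u v w; have [N vN] := vm_bdd vV v w.
move=> M; have [N' H'] := bB M; exists (Num.min 0 (Num.min N N')) => n nM k.
rewrite /vop_x2 /series_x2; split=> [kn|l lN].
  by case: eqP => // k0; rewrite vN //; lia.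
case: eqP => _; last by rewrite (lin0 (vY_linear vV _ _)).
by apply: (H' n l nM); rewrite (_ : l < N') ?orbT //; lia.
Qed.

Lemma vop_app_vop_x2 (u v : V) (w : W) : vop_app YWV u (vop_x2 v w) = vop2 YWV u v w.
Proof.
apply: funext2 => m n; rewrite /vop_app (fsum_single (x := 0)) => [|k k0].
  by rewrite subr0 /vop_x2 /series_x2 eqxx.
by rewrite /vop_x2 /series_x2 (negbTE k0) (lin0 (vY_linear vV _ _)).
Qed.

(** Each coefficient z(n) has its own bound by the tensor condition; only finitely many n <= M
    matter, so the bounds can be made uniform. *)
Lemma tame_H (u1 : V) (u2 : H) (z : int -> W) : bdd1 z ->
  tame YWV u1 (fun k n => YWH u2 k (z n)).
Proof.
move=> [N0 zN] M.
have [|n N mN k|n|N H'] := @uniform_bound (fun n N => forall k : int,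
  (k < N -> YWH u2 k (z n) = 0) /\ (forall l, l < N -> YWV u1 l (YWH u2 k (z n)) = 0))
  N0 _ _ _ M.
- move=> n N N' NN' Hn k; have [H1 H2] := Hn k.
  by split=> [kN|l lN]; [apply: H1|apply: H2]; lia.
- rewrite zN // (lin0 (vY_linear vH _ _)); split=> // l _.
  by rewrite (lin0 (vY_linear vV _ _)).
- have [N H1 H2] := tensor_lo u1 vV (tH u2 (z n)).
  by exists N => k; split=> [|l]; [apply: H1|apply: H2].
exists (Num.min N N0) => n nM k; have [H1 H2] := H' n nM k; split.
  move=> kn; have [nN|Nn] := ltP n N0; first by rewrite zN // (lin0 (vY_linear vH _ _)).
  by apply: H1; lia.
by move=> l lN; apply: H2; lia.
Qed.

(** The list [D] is an explicit witness that f T lies in V (x) K((x1, x2)); it is kept visible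
    because a second multiplier is chosen later for the vectors in it. *)
Definition clears (f : R2 K) (D : seq (V * R2 K)) (T : tens V (frac2 K)) : Prop :=
  tens_mul (toF f) T = tens_of [seq (q.1, toF q.2) | q <- D].

Lemma clears_sum (E : lmodType K) (B : V -> frac2 K -> E) f D s :
  bilinear_map B -> clears f D (tens_of s) ->
  \sum_(q <- D) B q.1 (toF q.2) = \sum_(r <- s) B r.1 (toF f * r.2).
Proof.
move=> bB fD; have := congr1 (sweedler B) fD.
rewrite (sweedler_of _ bB) /tsum big_map /= => <-.
rewrite sweedler_tens_mul // sweedler_of //.
have [l r] := bB; split=> [F|v] c; first by move=> v v'; apply: l.
move=> F F'; have -> : toF f * (c *: F + F') = c *: (toF f * F) + toF f * F'.
  by rewrite mulrDr; congr (_ + _); apply: mulrCA.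
exact: r.
Qed.

(** The right-hand side contains V-operators only, with coefficients in K((x1, x2)): all that comes
    from H has become scalar. *)
Lemma expansion (u1 : V) (u2 : H) (v1 : V) (v2 : H) (w : W) (f : R2 K)
    (D : H -> seq (V * R2 K)) (C : H -> seq (W * R2 K)) :
  (forall ab, ab \in repr (Delta u2) -> clears f (D ab.1) (hat_vop ab.1 v1)) ->
  (forall b m n, YWH b m (YWH v2 n w) = \sum_(q <- C b) coef2 (toLF q.2) m n *: q.1) ->
  conv (coef2 (toLF f)) (vop2 (fun (x : V * H) => diag_vop YWV YWH x.1 x.2) (u1, u2) (v1, v2) w) =
  fun m n => \sum_(ab <- repr (Delta u2)) \sum_(q <- C ab.2) \sum_(r <- D ab.1)
    conv (coef2 (toLF r.2)) (conv (coef2 (toLF q.2)) (vop2 YWV u1 r.1 q.1)) m n.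
Proof.
move=> fD CE; have /choice[S SE] : forall a, exists s : seq (V * frac2 K), hat_vop a v1 = tens_of s.
  by move=> a; have [s [? _ _]] := hat_vop_decomp a v1; exists s.
have tX := tame_H u1 u2 (diag_vop_bdd vV tH v1 v2 w).
have -> : vop2 (fun x : V * H => diag_vop YWV YWH x.1 x.2) (u1, u2) (v1, v2) w =
    vop_app YWV u1 (fun k n => YWH u2 k (diag_vop YWV YWH v1 v2 n w)) by [].
(* f enters under Y_W^V(u1, x1) before the exchange relation is used, since the fractions that this
   relation creates are expanded in K((x2))((x1)) and could not be taken out. *)
rewrite conv_vop_app //; last exact: coef2_bdd2.
rewrite (move_H u2 SE CE).
have bZ (c : R2 K) (v : V) (w' : W) : bddA (conv (coef2 (toLF c)) (vop_x2 v w')).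
  by apply: bdd2_bddA; apply: conv_bdd2; [exact: coef2_bdd2|exact: vop_x2_bdd2].
have badm (F : LF K) (c : R2 K) (v : V) (w' : W) :
    bddA (conv (coef2 F) (conv (coef2 (toLF c)) (vop_x2 v w'))).
  apply: conv_bddA; first exact: coef2_bddA.
  by apply: bdd2_bddA; apply: conv_bdd2; [exact: coef2_bdd2|exact: vop_x2_bdd2].
have -> : conv (coef2 (toLF f)) (fun k n =>
  \sum_(ab <- repr (Delta u2)) \sum_(q <- C ab.2) \sum_(r <- S ab.1)
    conv (coef2 (frac_iota r.2)) (conv (coef2 (toLF q.2)) (vop_x2 r.1 q.1)) k n) =
  fun k n => \sum_(ab <- repr (Delta u2)) \sum_(q <- C ab.2) \sum_(r <- D ab.1)
    conv (coef2 (toLF r.2)) (conv (coef2 (toLF q.2)) (vop_x2 r.1 q.1)) k n.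
  have sum3 (X : Type) (T : H -> seq X) (G : W * R2 K -> X -> int -> int -> W) :
      (forall q x, bddA (G q x)) ->
      conv (coef2 (toLF f)) (fun k n =>
        \sum_(ab <- repr (Delta u2)) \sum_(q <- C ab.2) \sum_(r <- T ab.1) G q r k n) =
      fun k n => \sum_(ab <- repr (Delta u2)) \sum_(q <- C ab.2) \sum_(r <- T ab.1)
        conv (coef2 (toLF f)) (G q r) k n.
    move=> bG; apply: funext2 => k n.
    rewrite conv_sum => [|ab]; last first.
      by apply: admissibleA; [exact: coef2_bddA|apply: bddA_sum => q; apply: bddA_sum => r].
    apply: eq_bigr => ab _; rewrite conv_sum => [|q]; last first.
      by apply: admissibleA; [exact: coef2_bddA|apply: bddA_sum => r].
    apply: eq_bigr => q _; rewrite conv_sum // => r.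
    by apply: admissibleA; [exact: coef2_bddA|].
  rewrite sum3 //; apply: funext2 => k n; rewrite big_seq [RHS]big_seq.
  apply: eq_bigr => ab /fD; rewrite SE => fab; apply: eq_bigr => q _.
  pose B v F := conv (coef2 (frac_iota F)) (conv (coef2 (toLF q.2)) (vop_x2 v q.1)) k n.
  have bB : bilinear_map B.
    apply: conv_bilinear; [exact: frac_iotaD|exact: frac_iotaZ| |].
      by move=> v; apply: bZ.
    move=> k' n'; apply: linear_fsum => [st|v].
      by move=> c v v'; rewrite vop_x2_linear scalerDr !scalerA [c * _]mulrC.
    apply: conv_fsupp; first exact: coef2_bddA.
    by apply: bdd2_bddA; apply: vop_x2_bdd2.
  transitivity (\sum_(r <- S ab.1) B r.1 (toF f * r.2)).
    by apply: eq_bigr => r _; rewrite /B frac_iotaM frac_iota_tofrac (convM _ _ (bZ _ _ _)).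
  rewrite -(clears_sum bB fab); apply: eq_bigr => r _.
  by rewrite /B frac_iota_tofrac.
have tG (r : V * R2 K) (q : W * R2 K) :
    tame YWV u1 (conv (coef2 (toLF r.2)) (conv (coef2 (toLF q.2)) (vop_x2 r.1 q.1))).
  by do 2![apply: tame_conv => //; first exact: coef2_bdd2]; apply: tame_vop_x2.
apply: funext2 => m n.
rewrite vop_app_sum // => [|ab]; last first.
  by apply: tame_sum => // q; apply: tame_sum => // r; apply: tG.
apply: eq_bigr => ab _; rewrite vop_app_sum // => [|q]; last first.
  by apply: tame_sum => // r; apply: tG.
apply: eq_bigr => q _; rewrite vop_app_sum //.
(* The coefficients are now in K((x1, x2)) and can leave Y_W^V(u1, x1). *)
apply: eq_bigr => r _; rewrite -!conv_vop_app ?vop_app_vop_x2 //.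
- exact: coef2_bdd2.
- exact: tame_vop_x2.
- exact: coef2_bdd2.
- by apply: tame_conv => //; [exact: coef2_bdd2|exact: tame_vop_x2].
Qed.

End Expansion.

(** * Clearing the poles *)

Section Clears.
Variables (K : numFieldType) (V : lmodType K).

Lemma pure_mul_bilinear (F : frac2 K) : bilinear_map (fun v F' => pure v (F * F') : tens V (frac2 K)).
Proof.
have [l r] := @pure_bilinear K V (frac2 K); split=> [F'|v] c; first exact: l.
move=> F1 F2; have -> : F * (c *: F1 + F2) = c *: (F * F1) + F * F2.
  by rewrite mulrDr; congr (_ + _); apply: mulrCA.
exact: r.
Qed.

Lemma tens_mulM (F F' : frac2 K) (T : tens V (frac2 K)) :
  tens_mul (F * F') T = tens_mul F (tens_mul F' T).
Proof.
rewrite [RHS]sweedler_tens_mul; last exact: pure_mul_bilinear.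
by apply: eq_sweedler => v F''; rewrite mulrA.
Qed.

Lemma clears_mul (f f' : R2 K) D (T : tens V (frac2 K)) : clears f D T ->
  clears (f' * f) [seq (q.1, f' * q.2) | q <- D] T.
Proof.
move=> fD; have -> : clears (f' * f) [seq (q.1, f' * q.2) | q <- D] T =
   (tens_mul (toF f' * toF f) T =
    tens_of [seq (q.1, toF (q.2 : R2 K)) | q <- [seq (q.1, f' * q.2) | q <- D]]).
  by rewrite -tofracM.
rewrite tens_mulM fD -map_comp /tens_mul sweedler_of; last exact: pure_mul_bilinear.
rewrite tens_ofE /tsum !big_map; apply: eq_bigr => q _ /=.
by rewrite -tofracM.
Qed.

End Clears.

(** The product of the multipliers of the entries serves the whole list, because [P] is stable under
    further multiplication. *)
Lemma common_multiplier (R : comPzRingType) (M : R -> Prop) (X : eqType) (P : X -> R -> Prop)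
    (s : seq X) :
  M 1 -> (forall f g, M f -> M g -> M (f * g)) ->
  (forall x f g, P x f -> P x (g * f)) ->
  (forall x, exists2 f, M f & P x f) ->
  exists2 f, M f & forall x, x \in s -> P x f.
Proof.
move=> M1 MM PM exP; elim: s => [|x s [f Mf Pf]]; first by exists 1.
have [g Mg Pg] := exP x; exists (f * g); first exact: MM.
move=> y; rewrite inE => /predU1P[->|/Pf Py]; first exact: PM.
by rewrite mulrC; apply: PM.
Qed.

(** * Polynomials in x1 / x2 and in x2 / x1 *)

Section Ratio.
Variable K : fieldType.
Implicit Types (q : {poly K}) (c : K).

Definition const2 (a : K) : laurent2 K := mono2 a 0 0.

Fact const2_zmod : zmod_morphism const2.
Proof.
have cD a b : const2 (a + b) = const2 a + const2 b by apply: mono2D.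
by move=> a b; apply: (@addIr _ (const2 b)); rewrite -cD !subrK.
Qed.

Fact const2_monoid : monoid_morphism const2.
Proof. by split=> [|a b]; [exact: mono2_1|rewrite /const2 -mono2M !addr0]. Qed.

HB.instance Definition _ := GRing.isZmodMorphism.Build K (laurent2 K) const2 const2_zmod.
HB.instance Definition _ := GRing.isMonoidMorphism.Build K (laurent2 K) const2 const2_monoid.

Definition x1_over_x2 : laurent2 K := mono2 1 1 (-1).
Definition x2_over_x1 : laurent2 K := mono2 1 (-1) 1.

Lemma x2_over_x1K : x2_over_x1 * x1_over_x2 = 1.
Proof. by rewrite /x2_over_x1 /x1_over_x2 -mono2M mul1r addNr addrN mono2_1. Qed.

(** Seen as the value of a polynomial at a point, the expression is multiplicative in q by the
    general rules of evaluation. *)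
Lemma ratio_x1x2E q : ratio_x1x2 q = (map_poly const2 q).[x1_over_x2].
Proof.
rewrite (@horner_coef_wide _ (size q)) ?size_poly //; apply: eq_bigr => k _.
rewrite coef_map /=; have -> : x1_over_x2 ^+ k = mono2 1 k (- k%:Z).
  elim: (nat_of_ord k) => [|n IH]; first by rewrite expr0 mono2_1.
  by rewrite exprS IH /x1_over_x2 -mono2M mul1r; congr mono2; lia.
by rewrite -mono2M mulr1 !add0r.
Qed.

Lemma ratio_x2x1E q : ratio_x2x1 q = (map_poly const2 q).[x2_over_x1].
Proof.
rewrite (@horner_coef_wide _ (size q)) ?size_poly //; apply: eq_bigr => k _.
rewrite coef_map /=; have -> : x2_over_x1 ^+ k = mono2 1 (- k%:Z) k.
  elim: (nat_of_ord k) => [|n IH]; first by rewrite expr0 mono2_1.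
  by rewrite exprS IH /x2_over_x1 -mono2M mul1r; congr mono2; lia.
by rewrite -mono2M mulr1 !add0r.
Qed.

Lemma ratio_x1x2M q q' : ratio_x1x2 (q * q') = ratio_x1x2 q * ratio_x1x2 q'.
Proof. by rewrite !ratio_x1x2E rmorphM hornerM. Qed.

Lemma ratio_x2x1M q q' : ratio_x2x1 (q * q') = ratio_x2x1 q * ratio_x2x1 q'.
Proof. by rewrite !ratio_x2x1E rmorphM hornerM. Qed.

Lemma ratio_x1x2_1 : ratio_x1x2 1 = 1 :> laurent2 K.
Proof. by rewrite ratio_x1x2E rmorph1 hornerE. Qed.

Lemma ratio_x2x1_1 : ratio_x2x1 1 = 1 :> laurent2 K.
Proof. by rewrite ratio_x2x1E rmorph1 hornerE. Qed.

Lemma ratio_x1x2_factor c : ratio_x1x2 ('X - c%:P) = x1_over_x2 - const2 c.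
Proof. by rewrite ratio_x1x2E map_polyXsubC hornerXsubC. Qed.

Lemma ratio_x2x1_factor c : ratio_x2x1 ('X - c%:P) = x2_over_x1 - const2 c.
Proof. by rewrite ratio_x2x1E map_polyXsubC hornerXsubC. Qed.

(** With y = x2 / x1 this is y - c = - c y (y^-1 - c^-1). *)
Lemma ratio_flip c : c != 0 ->
  ratio_x2x1 ('X - c%:P) = const2 (- c) * x2_over_x1 * ratio_x1x2 ('X - c^-1%:P).
Proof.
move=> c0; rewrite ratio_x2x1_factor ratio_x1x2_factor mulrBr -mulrA x2_over_x1K mulr1.
rewrite mulrAC -rmorphM mulNr divff // !rmorphN rmorph1 mulN1r opprK addrC.
by [].
Qed.

Lemma ratio_x1x2_neq0 c : ratio_x1x2 ('X - c%:P) != 0.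
Proof.
rewrite ratio_x1x2_factor; apply/eqP => H.
have : coef2 (toLF (x1_over_x2 - const2 c : R2 K)) 1 (-1) = 0 by rewrite H toLF0 coef2_0.
rewrite toLFB coef2B !coef2_toLF !coefs_mono2 !eqxx /= subr0 => /eqP.
by rewrite oner_eq0.
Qed.

End Ratio.

(** * The iterate Y(Y(u, z) v, x) *)

Section PoleFactors.
Variables (K : numFieldType) (G : groupType) (chi : G -> K).
Hypothesis chi_char : linear_character chi.

Lemma char_neq0 g : chi g != 0.
Proof.
apply/eqP => g0; have := charM chi_char g g^-1%g.
by rewrite mulgV (char1 chi_char) g0 mul0r => /eqP; rewrite oner_eq0.
Qed.

Lemma charV g : (chi g)^-1 = chi g^-1%g.
Proof.
apply: (mulfI (char_neq0 g)); rewrite divff ?char_neq0 //.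
by rewrite -(charM chi_char) mulgV (char1 chi_char).
Qed.

(* f = e q(x1 / x2) for a unit e and q in the monoid generated by the x - chi(g) *)
Definition pole_factor (f : R2 K) : Prop :=
  exists e e' : R2 K, exists2 q, char_monoid chi q & e' * e = 1 /\ f = e * ratio_x1x2 q.

Lemma char_monoid1 : char_monoid chi 1.
Proof. by exists [::]; rewrite big_nil. Qed.

Lemma char_monoidM q q' : char_monoid chi q -> char_monoid chi q' -> char_monoid chi (q * q').
Proof. by move=> [s ->] [t ->]; exists (s ++ t); rewrite big_cat. Qed.

Lemma pole_factor1 : pole_factor 1.
Proof.
exists 1, 1, 1; first exact: char_monoid1.
by rewrite mulr1 ratio_x1x2_1 mulr1.
Qed.

Lemma pole_factorM f g : pole_factor f -> pole_factor g -> pole_factor (f * g).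
Proof.
move=> [a [a' [q Gq [aa' ->]]]] [b [b' [r Gr [bb' ->]]]].
exists (a * b), (a' * b'), (q * r); first exact: char_monoidM.
by rewrite ratio_x1x2M mulrACA aa' bb' mulr1 mulrACA.
Qed.

Lemma pole_factor_x1x2 q : char_monoid chi q -> pole_factor (ratio_x1x2 q).
Proof. by move=> Gq; exists 1, 1, q; rewrite ?mulr1 ?mul1r. Qed.

Lemma pole_factor_x2x1 q : char_monoid chi q -> pole_factor (ratio_x2x1 q).
Proof.
move=> [s ->]; elim: s => [|g s IH].
  by rewrite big_nil ratio_x2x1_1; apply: pole_factor1.
rewrite big_cons ratio_x2x1M; apply: pole_factorM => //.
rewrite (ratio_flip (char_neq0 g)).
exists (const2 (- chi g) * x2_over_x1 K), (const2 (- chi g)^-1 * x1_over_x2 K), ('X - (chi g)^-1%:P).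
  by rewrite charV; exists [:: g^-1%g]; rewrite big_seq1.
split=> //; rewrite mulrACA [x1_over_x2 K * _]mulrC x2_over_x1K mulr1 -rmorphM mulVf ?rmorph1 //.
by rewrite oppr_eq0 char_neq0.
Qed.

Lemma pole_factor_neq0 f : pole_factor f -> f != 0.
Proof.
move=> [e [e' [_ [s ->] [e'e ->]]]]; rewrite mulf_neq0 //.
  by apply: contraTneq isT => e0; move/eqP: e'e; rewrite e0 mulr0 eq_sym oner_eq0.
elim: s => [|g s IH]; first by rewrite big_nil ratio_x1x2_1 oner_neq0.
by rewrite big_cons ratio_x1x2M mulf_neq0 // ratio_x1x2_neq0.
Qed.

End PoleFactors.

(** * Coassociativity and cocommutativity inside Sweedler sums *)

Section Coassociativity.
Variables (K : fieldType) (H V : lmodType K) (Delta : H -> tens H H) (rho : V -> tens V H).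
Hypothesis coassoc : forall v,
    sweedler (fun a b => pure (rho a) b) (rho v) =
    sweedler (fun a b => sweedler (fun c d => pure (pure a c) d) (Delta b)) (rho v).

(** The trilinear T is turned into a bilinear map on V (x) H and H, to which both sides of the
    coassociativity identity can be submitted. *)
Lemma sweedler_coassoc (E : lmodType K) (T : V -> H -> H -> E) v :
  (forall b c, linear (fun a => T a b c)) -> (forall a c, linear (fun b => T a b c)) ->
  (forall a b, linear (T a b)) ->
  sweedler (fun a b => sweedler (fun c d => T c d b) (rho a)) (rho v) =
  sweedler (fun a b => sweedler (fun c d => T a c d) (Delta b)) (rho v).
Proof.
move=> l1 l2 l3; pose T' (t : tens V H) (h : H) := sweedler (fun c d => T c d h) t.
have bT h : bilinear_map (fun c d => T c d h) by split=> ?; [exact: l1|exact: l2].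
have bT' : bilinear_map T'.
  split=> [h|t]; first exact: sweedler_linear.
  by apply: linear_bigsum => x; apply: l3.
have := congr1 (sweedler T') (coassoc v).
rewrite !sweedler_sweedler //.
under [LHS]eq_sweedler => a b do rewrite sweedler_pure //.
move=> ->; apply: eq_sweedler => a b; rewrite sweedler_sweedler //.
by apply: eq_sweedler => c d; rewrite sweedler_pure // /T' sweedler_pure.
Qed.

Lemma sweedler_cocomm (E : lmodType K) (B : H -> H -> E) h :
  cocommutative Delta -> bilinear_map B ->
  sweedler B (Delta h) = sweedler (fun a b => B b a) (Delta h).
Proof.
move=> cD bB; rewrite -{1}cD sweedler_sweedler //.
by apply: eq_sweedler => a b; rewrite sweedler_pure.
Qed.

End Coassociativity.

Lemma vop2_cst_bdd2 (K : numFieldType) (W : lmodType K) (C : seq (W * R2 K)) :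
  bdd2 (fun m n => \sum_(q <- C) coef2 (toLF q.2) m n *: q.1).
Proof.
elim: C => [|q C [N IH]]; first by exists 0 => m n _; rewrite big_nil.
have [N' H] := coef2_bdd2 q.2; exists (Num.min N N') => m n mn.
by rewrite big_cons IH ?H ?scale0r ?addr0 //; lia.
Qed.

(* Y_W(Y(u, z) v, x) w *)
Definition vop_iterate (K : fieldType) (V W : lmodType K) (Y : vop V V) (YW : vop V W)
    (u v : V) (w : W) : int -> int -> W := fun k n => YW (Y u k v) n w.

Lemma vop_iterate_bddA (K : fieldType) (V W : lmodType K) (Y : vop V V) (YW : vop V W) u v w :
  vertex_map Y -> vertex_map YW -> bddA (vop_iterate Y YW u v w).
Proof.
move=> vY vW; have [N vN] := vm_bdd vY u v; apply: (@bddA_of _ _ N) => [k n kN|k].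
  by rewrite /vop_iterate vN // (lin0 (vY_linearl vW _ _)).
exact: (vm_bdd vW).
Qed.

(** * Iterates of H-operators on W *)

Section Action.
Variables (K : numFieldType) (p : laurent K) (H W : lmodType K).
Hypothesis p0 : p != 0.
Variables (YH : vop H H) (vacH : H) (YWH : vop H W).
Hypotheses (vYH : vertex_map YH) (qH : phi_quasi_module p YH vacH YWH).

(** The product Y_W^H(b, x1) Y_W^H(v2, x2) w is already in W((x1, x2)), so x1 = phi(x2, z) can be
    substituted without any multiplier. The module axiom compares the result with the iterate up to
    the factor f(phi(x2, z), x2), which is invertible in K((x2))((z)); both sides are in
    W((x2))((z)), where it may be cancelled. *)
Lemma vop_iterate_tensor (b v2 : H) (w : W) (C : seq (W * R2 K)) :
  (forall m n, YWH b m (YWH v2 n w) = \sum_(q <- C) coef2 (toLF q.2) m n *: q.1) ->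
  forall k n, YWH (YH b k v2) n w = \sum_(q <- C) coef2 (eval_phi p q.2) k n *: q.1.
Proof.
move=> CE; have [f f0 /(_ w) [bF HF]] := pqm_assoc qH b v2.
have v2E : vop2 YWH b v2 w = fun m n => \sum_(q <- C) coef2 (toLF q.2) m n *: q.1.
  by apply: funext2 => m n; apply: CE.
have bM := vop_iterate_bddA b v2 w vYH (pqm_map qH).
have {}HF : conv (coef2 (eval_phi p f)) (subst (phi p) (vop2 YWH b v2 w)) =
            conv (coef2 (eval_phi p f)) (vop_iterate YH YWH b v2 w).
  rewrite -subst_smul; last by rewrite v2E; apply: vop2_cst_bdd2.
  apply: funext2 => m n; rewrite -smul_coef2 HF.
  by rewrite smul_coefs.
have atf : eval_phi p f != 0 by apply: contra f0 => /eqP/(eval_phi_inj p0) ->.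
have bS : bddA (subst (phi p) (vop2 YWH b v2 w)).
  by apply: subst_phi_bddA; rewrite v2E; apply: vop2_cst_bdd2.
have E : subst (phi p) (vop2 YWH b v2 w) = vop_iterate YH YWH b v2 w.
  have := congr1 (conv (coef2 (eval_phi p f)^-1) (W := W)) HF.
  by rewrite -!convM // mulVf // !conv_coef2_1.
move=> k n; rewrite -[LHS]/(vop_iterate YH YWH b v2 w k n) -E v2E.
have [d d0 pd] := order_bound p.
rewrite (subst_sum (phi_neq0 p) d0 (phi_lo d0 pd)) => [|q].
  apply: eq_bigr => q _; rewrite (substZ (phi_neq0 p) d0 (phi_lo d0 pd)); last exact: coef2_bdd2.
  by rewrite eval_phi_subst.
by have [N qN] := coef2_bdd2 q.2; exists N => i j ij; rewrite qN // scale0r.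
Qed.

End Action.

(** * Coefficients of the iterate of deformed operators *)

Section Deformed.
Variables (K : numFieldType) (p : laurent K) (H V W : lmodType K).
Hypothesis p0 : p != 0.
Variables (YH : vop H H) (vacH : H) (YV : vop V V) (YVH : vop H V).
Variables (YWH : vop H W) (YWV : vop V W).
Hypotheses (vYH : vertex_map YH) (vYV : vertex_map YV) (vYVH : vertex_map YVH).
Hypotheses (vWV : vertex_map YWV) (qH : phi_quasi_module p YH vacH YWH).
Hypothesis tH : forall h w, in_tensor setT (fun n => YWH h n w).
Hypothesis tVH : forall h v, in_tensor setT (fun n => YVH h n v).
Hypothesis tVH_phi : forall h v, in_tensor (Kphi p) (fun n => YVH h n v).

Let vWH : vertex_map YWH := pqm_map qH.

Section Elements.
Variables (v1 : V) (v2 : H) (n : int) (w : W).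

Definition iterate_term (al : V) (be ga : H) (k m l : int) : W :=
  diag_vop YWV YWH (YV al l (YVH ga m v1)) (YH be (k - m - l) v2) n w.

(* the coefficients of
   Y_W(Y_V(al, z) Y^H(ga, z) v1, x) Y_W^H(Y_H(be, z) v2, x) w *)
Definition iterate_coef (k : int) (al : V) (be ga : H) : W :=
  \sum_(m \in [set: int]) \sum_(l \in [set: int]) iterate_term al be ga k m l.

Let opl := diag_vop_bilinear vWV vWH tH n w.

Lemma iterate_term_fsupp k al be ga : fsupp (fun x : int * int => iterate_term al be ga k x.1 x.2).
Proof.
have [N H1 H2] := tensor_lo al vYV (tVH ga v1).
have [N' H3] := vm_bdd vYH be v2.
have [ol or_] := opl.
apply: (@fsupp11 _ _ (`|k| + `|N| + `|N| + `|N'|)) => m l; rewrite /inbox /iterate_term /= => B.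
have [mN|Nm] := ltP m N.
  by rewrite H1 // (lin0 (vY_linear vYV _ _)) (lin0 (ol _)).
have [lN|Nl] := ltP l N; first by rewrite H2 // (lin0 (ol _)).
by rewrite H3 ?(lin0 (or_ _)) //; lia.
Qed.

Lemma iterate_coef_linear1 k be ga : linear (fun al => iterate_coef k al be ga).
Proof.
have [ol _] := opl; apply: linear_fsum => [m|al]; last exact: (fsupp_marg (iterate_term_fsupp k al be ga)).
apply: linear_fsum => [l|al]; last exact: (fsupp_slice m (iterate_term_fsupp k al be ga)).
by move=> c a a'; rewrite /iterate_term (vY_linearl vYV) ol.
Qed.

Lemma iterate_coef_linear2 k al ga : linear (fun be => iterate_coef k al be ga).
Proof.
have [_ or_] := opl; apply: linear_fsum => [m|be]; last exact: (fsupp_marg (iterate_term_fsupp k al be ga)).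
apply: linear_fsum => [l|be]; last exact: (fsupp_slice m (iterate_term_fsupp k al be ga)).
by move=> c a a'; rewrite /iterate_term (vY_linearl vYH) or_.
Qed.

Lemma iterate_coef_linear3 k al be : linear (iterate_coef k al be).
Proof.
have [ol _] := opl; apply: linear_fsum => [m|ga]; last exact: (fsupp_marg (iterate_term_fsupp k al be ga)).
apply: linear_fsum => [l|ga]; last exact: (fsupp_slice m (iterate_term_fsupp k al be ga)).
by move=> c a a'; rewrite /iterate_term (vY_linearl vYVH) (vY_linear vYV) ol.
Qed.

End Elements.

Section IterateProduct.
Variables (u1 : V) (b v2 : H) (w : W) (C : seq (W * R2 K)).
Hypothesis CE : forall m n, YWH b m (YWH v2 n w) = \sum_(q <- C) coef2 (toLF q.2) m n *: q.1.

(* Y_W(Y_V(u1, z) x, x2) Y_W^H(Y_H(b, z) v2, x2) w *)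
Definition iterate_prod (x : V) : int -> int -> W := fun k n =>
  \sum_(l \in [set: int]) diag_vop YWV YWH (YV u1 l x) (YH b (k - l) v2) n w.

(** The H-factor of the iterate is made of scalar series evaluated at x1 = phi(x2, z), so the
    product is a combination of iterates for the V-module W. *)
Lemma iterate_prodE x : iterate_prod x = fun k n =>
  \sum_(q <- C) conv (coef2 (eval_phi p q.2)) (vop_iterate YV YWV u1 x q.1) k n.
Proof.
apply: funext2 => k n.
have fs q : fsupp (fun ij : int * int => coef2 (eval_phi p q.2) (k - ij.1) ij.2 *:
    vop_iterate YV YWV u1 x q.1 (k - (k - ij.1)) (n - ij.2)).
  have := @admissibleA _ _ _ _ (@coef2_bddA _ (eval_phi p q.2)) (vop_iterate_bddA u1 x q.1 vYV vWV) k n.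
  apply: (@fsupp_bij _ _ _ (fun ij : int * int => (k - ij.1, ij.2))).
  by exists (fun ij : int * int => (k - ij.1, ij.2)) => -[i j] /=; rewrite subKr.
transitivity (\sum_(l \in [set: int]) \sum_(j \in [set: int]) \sum_(q <- C)
   (coef2 (eval_phi p q.2) (k - l) j *: vop_iterate YV YWV u1 x q.1 (k - (k - l)) (n - j))).
  apply: fsum_eq => l; apply: fsum_eq => j.
  rewrite (vop_iterate_tensor p0 vYH qH CE) (lin_sum (vY_linear vWV _ _)); apply: eq_bigr => q _.
  by rewrite (linZ (vY_linear vWV _ _)) /vop_iterate subKr.
transitivity (\sum_(l \in [set: int]) \sum_(q <- C) \sum_(j \in [set: int])
   (coef2 (eval_phi p q.2) (k - l) j *: vop_iterate YV YWV u1 x q.1 (k - (k - l)) (n - j))).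
  by apply: fsum_eq => l; rewrite fsum_big // => q; apply: (fsupp_slice l (fs q)).
rewrite fsum_big => [|q]; last exact: (fsupp_marg (fs q)).
apply: eq_bigr => q _; rewrite [RHS]/conv fsum_pair; last first.
  by apply: conv_fsupp; [exact: coef2_bddA|exact: vop_iterate_bddA].
by rewrite [RHS](fsum_rev _ k).
Qed.

Lemma iterate_prod_bddA x : bddA (iterate_prod x).
Proof.
rewrite iterate_prodE; apply: bddA_sum => q.
by apply: conv_bddA; [exact: coef2_bddA|exact: vop_iterate_bddA].
Qed.

Lemma iterate_prod_linear k n : linear (fun x => iterate_prod x k n).
Proof.
apply: linear_fsum => [l|x].
  have [ol _] := diag_vop_bilinear vWV vWH tH n w.
  by move=> c x x'; rewrite (vY_linear vYV) ol.
have [N H1] := vm_bdd vYV u1 x; have [N' H3] := vm_bdd vYH b v2.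
have [ol or_] := diag_vop_bilinear vWV vWH tH n w.
apply: (@fsupp1 _ _ (`|k| + `|N| + `|N'|)) => l; rewrite /inbox => B.
have [lN|Nl] := ltP l N; first by rewrite H1 // (lin0 (ol _)).
by rewrite H3 ?(lin0 (or_ _)) //; lia.
Qed.

(** For F in K_phi((x1, x2)), the series F(phi(x2, z), x2) is [pi_phi p F], in z alone. Multiplying
    by it therefore convolves only the exponents of z, which is how the coefficients of Y^H(a, z) v1
    enter the iterate. *)
Lemma iterate_coef_conv (a : H) (v1 : V) (S : seq (V * frac2 K)) :
  (forall q, q \in S -> Kphi2 p q.2) ->
  (forall n, YVH a n v1 = \sum_(q <- S) pi_phi p q.2 n *: q.1) ->
  forall k n, iterate_coef v1 v2 n w k u1 b a =
    \sum_(r <- S) conv (coef2 (frac_eval_phi p r.2)) (iterate_prod r.1) k n.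
Proof.
move=> SK SE k n.
have fs (r : V * frac2 K) : fsupp (fun m => pi_phi p r.2 m *: iterate_prod r.1 (k - m) n).
  have [N H1] := coefL_bdd (pi_phi p r.2); have [N' _ H2] := bddA_lo (iterate_prod_bddA r.1).
  apply: (@fsupp1 _ _ (`|k| + `|N| + `|N'|)) => m; rewrite /inbox => B.
  have [mN|Nm] := ltP m N; first by rewrite H1 ?scale0r.
  by rewrite H2 ?scaler0 //; lia.
transitivity (\sum_(m \in [set: int]) \sum_(r <- S) (pi_phi p r.2 m *: iterate_prod r.1 (k - m) n)).
  apply: fsum_eq => m; transitivity (iterate_prod (YVH a m v1) (k - m) n); first by [].
  rewrite SE (lin_sum (iterate_prod_linear _ _)); apply: eq_bigr => r _.
  by rewrite (linZ (iterate_prod_linear _ _)).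
rewrite fsum_big // big_seq [RHS]big_seq; apply: eq_bigr => r /SK rK.
rewrite /conv fsum_pair; last by apply: conv_fsupp; [exact: coef2_bddA|exact: iterate_prod_bddA].
apply: fsum_eq => m; rewrite (fsum_single (x := 0)) => [|j j0] /=.
  by rewrite frac_eval_phi_pi // eqxx subr0.
by rewrite frac_eval_phi_pi // (negbTE j0) scale0r.
Qed.

End IterateProduct.

End Deformed.

Lemma sweedler_deformed (K : fieldType) (H V W : lmodType K) (rho : V -> tens V H)
    (Y : vop V W) (YH : vop H W) v n w :
  deformed_vop rho Y YH v n w = sweedler (fun a b => diag_vop Y YH a b n w) (rho v).
Proof. by []. Qed.

(** * The deformed vertex operators and the coaction *)

Section DeformedAlgebra.
Variables (K : numFieldType) (p : laurent K) (H V W : lmodType K).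
Variables (YH : vop H H) (vacH : H) (YV : vop V V) (vacV : V) (YVH : vop H V).
Variables (YWH : vop H W) (YWV : vop V W).
Variables (Delta : H -> tens H H) (eps : H -> K^o) (rho : V -> tens V H).
Hypotheses (vYH : vertex_map YH) (vYV : vertex_map YV) (vYVH : vertex_map YVH).
Hypotheses (vWV : vertex_map YWV) (vWH : vertex_map YWH).
Hypothesis tH : forall h w, in_tensor setT (fun n => YWH h n w).
Hypothesis tVH : forall h v, in_tensor setT (fun n => YVH h n v).
Hypothesis cD : cocommutative Delta.
Hypothesis cr : comodule_nva YH vacH Delta eps YV vacV rho.
Hypothesis rhoH : comodule_compatible YVH rho.

Let lrho : linear rho := hom_linear (comod_hom cr).

Lemma deformed_map : vertex_map (deformed_vop rho YWV YWH).
Proof.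
split=> [n|v w].
  split=> [w|v]; last by apply: linear_bigsum => x; apply: (diag_vop_linear vWV vWH tH).
  move=> c v v'; rewrite /deformed_vop lrho.
  exact: (sweedler_linear (diag_vop_bilinear vWV vWH tH n w)).
have : forall s : seq (V * H), exists N : int, forall n : int, n < N ->
    \sum_(x <- s) diag_vop YWV YWH x.1 x.2 n w = 0.
  elim=> [|x s [N IH]]; first by exists 0 => n _; rewrite big_nil.
  have [N' H'] := diag_vop_bdd vWV tH x.1 x.2 w.
  by exists (Num.min N N') => n nN; rewrite big_cons IH ?H' ?addr0 //; lia.
exact.
Qed.

(** By compatibility, rho carries Y^H(b, x) to an operator on the first tensor factor only; this
    explains why [b] appears beside y.1 and not beside y.2. *)
Lemma sweedler_tens_vop (E : lmodType K) (B : V -> H -> E) (s : tens V H) (b : H)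
    (m j : int) (v : V) : bilinear_map B ->
  sweedler B (tens_vop YV YH s j (rho (YVH b m v))) =
  \sum_(x <- repr s) \sum_(y <- repr (rho v)) \sum_(l \in [set: int])
    B (YV x.1 l (YVH b m y.1)) (YH x.2 (j - l) y.2).
Proof.
move=> bB; rewrite /tens_vop sweedler_sweedler // sweedlerE.
apply: eq_bigr => -[u h] _ /=.
pose P v' k' := \sum_(l \in [set: int]) pure (YV u l v') (YH h (j - l) k').
have [pl pr] := @pure_bilinear K V H.
have fP v' k' : fsupp (fun l => pure (YV u l v') (YH h (j - l) k')).
  have [N H1] := vm_bdd vYV u v'; have [N' H2] := vm_bdd vYH h k'.
  apply: (@fsupp1 _ _ (`|j| + `|N| + `|N'|)) => l; rewrite /inbox => lB.
  have [lN|Nl] := ltP l N; first by rewrite H1 // (lin0 (pl _)).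
  by rewrite H2 ?(lin0 (pr _)) //; lia.
have bP : bilinear_map P.
  split=> [k'|v']; apply: linear_fsum => [l|//].
  - by move=> c x x'; rewrite (vY_linear vYV) pl.
  - by move=> c x x'; rewrite (vY_linear vYH) pr.
rewrite -[fun v' k' => _]/P rhoH [sweedler P _]sweedler_sweedler //.
rewrite sweedler_sweedler // sweedlerE.
apply: eq_bigr => y _; rewrite sweedler_pure // /P.
rewrite (lin_fsum (sweedler_linear bB)) //; apply: fsum_eq => l.
exact: sweedler_pure.
Qed.

Hypotheses (p0 : p != 0) (qH : phi_quasi_module p YH vacH YWH).

(** Applying rho to the inner product uses that it is a homomorphism compatible with the H-action,
    and leads to (rho (x) 1) rho(u). Coassociativity rewrites this through [Delta], the form in
    which the exchange relation delivers the product of two operators. *)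
Lemma deformed_deformed u k v n w :
  deformed_vop rho YWV YWH (deformed_vop rho YV YVH u k v) n w =
  \sum_(x <- repr (rho u)) \sum_(ab <- repr (Delta x.2)) \sum_(y <- repr (rho v))
    iterate_coef YH YV YVH YWH YWV y.1 y.2 n w k x.1 ab.2 ab.1.
Proof.
pose B a b := diag_vop YWV YWH a b n w.
have bB : bilinear_map B := diag_vop_bilinear vWV vWH tH n w.
have lPhi : linear (fun x => sweedler B (rho x)).
  by move=> c x x'; rewrite lrho; apply: sweedler_linear.
pose T c d b := \sum_(y <- repr (rho v)) iterate_coef YH YV YVH YWH YWV y.1 y.2 n w k c d b.
rewrite sweedler_deformed -/B (sweedler_deformed rho YV) (sweedler_morph _ _ lPhi).
transitivity (sweedler (fun a b => sweedler (fun c d => T c d b) (rho a)) (rho u)).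
  apply: eq_sweedler => a b; rewrite /diag_vop (lin_fsum lPhi); last exact: (diag_vop_fsupp vYV tVH).
  transitivity (\sum_(m \in [set: int]) \sum_(x <- repr (rho a)) \sum_(y <- repr (rho v))
     \sum_(l \in [set: int]) iterate_term YH YV YVH YWH YWV y.1 y.2 n w x.1 x.2 b k m l).
    apply: fsum_eq => m; rewrite (hom_vop (comod_hom cr)) sweedler_tens_vop //.
  have fs (x y : V * H) := fsupp_marg (iterate_term_fsupp p0 vYH vYV vWV qH tH tVH y.1 y.2 n w k x.1 x.2 b).
  rewrite fsum_big => [|x]; last by apply: fsupp_big => y; apply: (fs x y).
  by apply: eq_bigr => x _; rewrite fsum_big // => y; apply: (fs x y).
rewrite (sweedler_coassoc (comod_coassoc cr)).
- rewrite !sweedlerE; apply: eq_bigr => x _.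
  (* Coassociativity makes the second leg of [Delta] act on v, whereas in the exchange relation it
     is the first leg: cocommutativity reconciles the two. *)
  rewrite (sweedler_cocomm _ cD) //; split=> [d|c]; apply: linear_bigsum => y.
    exact: (iterate_coef_linear2 p0 vYH vYV vWV qH tH tVH).
  exact: (iterate_coef_linear3 p0 vYH vYV vYVH vWV qH tH tVH).
- by move=> b c; apply: linear_bigsum => y; apply: (iterate_coef_linear1 p0 vYH vYV vWV qH tH tVH).
- by move=> a c; apply: linear_bigsum => y; apply: (iterate_coef_linear2 p0 vYH vYV vWV qH tH tVH).
- by move=> a b; apply: linear_bigsum => y; apply: (iterate_coef_linear3 p0 vYH vYV vYVH vWV qH tH tVH).
Qed.

End DeformedAlgebra.

(** * Finite sums of products of series *)

Section ConvSums.
Variables (K : numFieldType) (W : lmodType K).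
Implicit Types (F : int -> int -> W).

Lemma bddB_sum (X : Type) (s : seq X) (F : X -> int -> int -> W) :
  (forall x, bddB (F x)) -> bddB (fun m n => \sum_(x <- s) F x m n).
Proof. by move=> bF; apply: (@bddA_sum _ _ _ s (fun x => swap2 (F x))). Qed.

Lemma conv_sumA (f : LF K) (X : Type) (s : seq X) (F : X -> int -> int -> W) m n :
  (forall x, bddA (F x)) ->
  conv (coef2 f) (fun a b => \sum_(x <- s) F x a b) m n = \sum_(x <- s) conv (coef2 f) (F x) m n.
Proof.
by move=> bF; rewrite conv_sum // => x; apply: admissibleA; [exact: coef2_bddA|exact: bF].
Qed.

Lemma conv_sumB (f : R2 K) (X : Type) (s : seq X) (F : X -> int -> int -> W) m n :
  (forall x, bddB (F x)) ->
  conv (coef2 (toLF f)) (fun a b => \sum_(x <- s) F x a b) m n =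
  \sum_(x <- s) conv (coef2 (toLF f)) (F x) m n.
Proof.
by move=> bF; rewrite conv_sum // => x; apply: admissibleB; [exact: coef2_bdd2|exact: bF].
Qed.

Lemma conv_bddA_LF (f : LF K) F : bddA F -> bddA (conv (coef2 f) F).
Proof. by apply: conv_bddA; apply: coef2_bddA. Qed.

Lemma conv_bddB_R2 (f : R2 K) F : bddB F -> bddB (conv (coef2 (toLF f)) F).
Proof. by apply: conv_bddB; apply: coef2_bdd2. Qed.

Lemma conv_bdd2_R2 (f : R2 K) F : bdd2 F -> bdd2 (conv (coef2 (toLF f)) F).
Proof. by apply: conv_bdd2; apply: coef2_bdd2. Qed.

Lemma convCA (f g : LF K) F : bddA F ->
  conv (coef2 f) (conv (coef2 g) F) = conv (coef2 g) (conv (coef2 f) F).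
Proof. by move=> bF; rewrite -!convM // mulrC. Qed.

Lemma convCA_B (f g : R2 K) F : bddB F ->
  conv (coef2 (toLF f)) (conv (coef2 (toLF g)) F) = conv (coef2 (toLF g)) (conv (coef2 (toLF f)) F).
Proof. by move=> bF; rewrite -(convM_B f g bF) -(convM_B g f bF) !toLFM mulrC. Qed.

Lemma bdd2_sum (X : eqType) (s : seq X) (F : X -> int -> int -> W) :
  (forall x, x \in s -> bdd2 (F x)) -> bdd2 (fun m n => \sum_(x <- s) F x m n).
Proof.
elim: s => [|x s IH] sF; first by exists 0 => m n _; rewrite big_nil.
have [N H] := sF x (mem_head _ _).
have [|N' H'] := IH; first by move=> y ys; apply: sF; rewrite inE ys orbT.
exists (Num.min N N') => m n mn; rewrite big_cons H ?H' ?addr0 //; lia.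
Qed.

Lemma subst_sum_seq (p : laurent K) (X : eqType) (s : seq X) (F : X -> int -> int -> W) a b :
  (forall x, x \in s -> bdd2 (F x)) ->
  subst (phi p) (fun m n => \sum_(x <- s) F x m n) a b =
  \sum_(x <- s) subst (phi p) (F x) a b.
Proof.
(* The bounds are known only for members of s; outside s the series is replaced by 0, which changes
   no sum. *)
move=> sF; pose F' x : int -> int -> W := if x \in s then F x else fun _ _ => 0.
have bF' x : bdd2 (F' x) by rewrite /F'; case: ifP => [/sF //|_]; exists 0.
transitivity (subst (phi p) (fun m n => \sum_(x <- s) F' x m n) a b).
  congr (@subst _ _ _ _ a b); apply: funext2 => m n.
  by apply: eq_big_seq => x xs; rewrite /F' xs.
have [d d0 pd] := order_bound p.
rewrite (subst_sum (phi_neq0 p) d0 (phi_lo d0 pd)) //.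
by apply: eq_big_seq => x xs; rewrite /F' xs.
Qed.

End ConvSums.

(** * The cleared product and the correspondingly multiplied iterate *)

Section Multiplied.
Variables (K : numFieldType) (p : laurent K) (H V W : lmodType K).
Hypothesis p0 : p != 0.
Variables (YH : vop H H) (vacH : H) (YV : vop V V) (vacV : V) (YVH : vop H V).
Variables (YWH : vop H W) (YWV : vop V W).
Variables (Delta : H -> tens H H) (eps : H -> K^o) (rho : V -> tens V H).
Hypotheses (vYH : vertex_map YH) (vYV : vertex_map YV) (vYVH : vertex_map YVH).
Hypotheses (vWV : vertex_map YWV) (qH : phi_quasi_module p YH vacH YWH).
Hypothesis tH : forall h w, in_tensor setT (fun n => YWH h n w).
Hypothesis tVH : forall h v, in_tensor setT (fun n => YVH h n v).
Hypothesis tVH_phi : forall h v, in_tensor (Kphi p) (fun n => YVH h n v).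
Hypothesis hv : forall h v w i j,
  YWH h i (YWV v j w) =
  sweedler (fun a b =>
    act_at_x2 YWV (tens_iota (lift_phi p (fun n => YVH a n v)))
              (fun m => YWH b m w) i j) (Delta h).
Hypothesis cD : cocommutative Delta.
Hypothesis cr : comodule_nva YH vacH Delta eps YV vacV rho.
Hypothesis rhoH : comodule_compatible YVH rho.

Let vWH : vertex_map YWH := pqm_map qH.
Let Ysh := deformed_vop rho YWV YWH.
Let vYsh : vertex_map Ysh := deformed_map vWV vWH tH cr.

Variables (u v : V) (f1 : R2 K) (D : H * V -> seq (V * R2 K)).
Hypothesis fD : forall x, x \in repr (rho u) -> forall ab, ab \in repr (Delta x.2) ->
  forall y, y \in repr (rho v) -> clears f1 (D (ab.1, y.1)) (hat_vop p YVH ab.1 y.1).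

Variables (w : W) (C : H -> H -> seq (W * R2 K)).
Hypothesis CE : forall b b' m n,
  YWH b m (YWH b' n w) = \sum_(q <- C b b') coef2 (toLF q.2) m n *: q.1.

Let diag_pair (x : V * H) := diag_vop YWV YWH x.1 x.2.

Lemma diag_pair_bddB x y : bddB (vop2 diag_pair x y w).
Proof.
have tX := tame_H vWH vWV tH x.1 x.2 (diag_vop_bdd vWV tH y.1 y.2 w).
exact: (vop_app_bddB vWV tX).
Qed.

Lemma multiplied_f1 : conv (coef2 (toLF f1)) (vop2 Ysh u v w) = fun m n =>
  \sum_(x <- repr (rho u)) \sum_(y <- repr (rho v)) \sum_(ab <- repr (Delta x.2))
    \sum_(q <- C ab.2 y.2) \sum_(r <- D (ab.1, y.1))
      conv (coef2 (toLF r.2)) (conv (coef2 (toLF q.2)) (vop2 YWV x.1 r.1 q.1)) m n.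
Proof.
have -> : vop2 Ysh u v w = fun m n =>
    \sum_(x <- repr (rho u)) \sum_(y <- repr (rho v)) vop2 diag_pair x y w m n.
  apply: funext2 => m n; apply: eq_bigr => x _.
  exact: (lin_sum (diag_vop_linear vWV vWH tH x.1 x.2 m)).
apply: funext2 => m n; rewrite conv_sumB => [|x]; last first.
  by apply: bddB_sum => y; apply: diag_pair_bddB.
apply: eq_big_seq => -[u1 u2] xu; rewrite conv_sumB => [|y]; last exact: diag_pair_bddB.
apply: eq_big_seq => -[v1 v2] yv /=.
have fD' ab : ab \in repr (Delta u2) -> clears f1 (D (ab.1, v1)) (hat_vop p YVH ab.1 v1).
  by move=> abD; apply: (fD xu abD yv).
have := expansion (D := fun a => D (a, v1)) vWH vWV tH tVH_phi hv u1 fD' (fun b => CE b v2).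
by move=> /(congr1 (fun F => F m n)).
Qed.

(** The second multiplier is brought innermost, next to the products of two V-operators for which it
    is chosen. *)
Lemma multiplied f2 : conv (coef2 (toLF (f2 * f1))) (vop2 Ysh u v w) = fun m n =>
  \sum_(x <- repr (rho u)) \sum_(y <- repr (rho v)) \sum_(ab <- repr (Delta x.2))
    \sum_(q <- C ab.2 y.2) \sum_(r <- D (ab.1, y.1))
      conv (coef2 (toLF r.2)) (conv (coef2 (toLF q.2))
        (conv (coef2 (toLF f2)) (vop2 YWV x.1 r.1 q.1))) m n.
Proof.
rewrite convM_B; last exact: vop2_bddB vYsh _ _ _.
rewrite multiplied_f1; apply: funext2 => m n.
have bZ (u1 : V) (r : V * R2 K) (q : W * R2 K) :
    bddB (conv (coef2 (toLF r.2)) (conv (coef2 (toLF q.2)) (vop2 YWV u1 r.1 q.1))).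
  by do 2!apply: conv_bddB_R2; apply: vop2_bddB.
rewrite conv_sumB => [|x]; last by do 4![apply: bddB_sum => ?]; apply: bZ.
apply: eq_bigr => x _; rewrite conv_sumB => [|y]; last by do 3![apply: bddB_sum => ?]; apply: bZ.
apply: eq_bigr => y _; rewrite conv_sumB => [|ab]; last by do 2![apply: bddB_sum => ?]; apply: bZ.
apply: eq_bigr => ab _; rewrite conv_sumB => [|q]; last by apply: bddB_sum => ?; apply: bZ.
apply: eq_bigr => q _; rewrite conv_sumB => [|r]; last exact: bZ.
apply: eq_bigr => r _; have bv := vop2_bddB vWV x.1 r.1 q.1.
by rewrite convCA_B ?(convCA_B f2) //; apply: conv_bddB_R2.
Qed.

Lemma iterate_coef_bddA al (b a : H) v1 v2 :
  bddA (fun k n => iterate_coef YH YV YVH YWH YWV v1 v2 n w k al b a).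
Proof.
have [S [_ SK SE]] := hat_vop_decomp tVH_phi a v1.
have -> : (fun k n => iterate_coef YH YV YVH YWH YWV v1 v2 n w k al b a) = fun k n =>
   \sum_(r <- S) conv (coef2 (frac_eval_phi p r.2)) (iterate_prod YH YV YWH YWV al b v2 w r.1) k n.
  apply: funext2 => k n.
  exact: (iterate_coef_conv p0 vYH vYV vWV qH tH al (CE b v2) SK SE).
apply: bddA_sum => r; apply: conv_bddA_LF.
exact: (iterate_prod_bddA p0 vYH vYV vWV qH al (CE b v2)).
Qed.

(** The list that clears the poles in the expansion also computes the iterate multiplied by
    f1(phi(x2, z), x2): the same identity in V (x) K_*((x1, x2)) is read through x1 = phi(x2, z)
    instead of iota. *)
Lemma multiplied_iterate_coef al (b a : H) v1 v2 k n : clears f1 (D (a, v1)) (hat_vop p YVH a v1) ->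
  \sum_(q <- C b v2) \sum_(r <- D (a, v1))
    conv (coef2 (eval_phi p r.2)) (conv (coef2 (eval_phi p q.2)) (vop_iterate YV YWV al r.1 q.1)) k n =
  conv (coef2 (eval_phi p f1)) (fun k n => iterate_coef YH YV YVH YWH YWV v1 v2 n w k al b a) k n.
Proof.
move=> fD1; have [S [SL SK SE]] := hat_vop_decomp tVH_phi a v1.
have bM x q := vop_iterate_bddA al x q vYV vWV.
have blam x := iterate_prod_bddA p0 vYH vYV vWV qH al (CE b v2) x.
transitivity (\sum_(r <- D (a, v1)) 
  conv (coef2 (eval_phi p r.2)) (iterate_prod YH YV YWH YWV al b v2 w r.1) k n).
  rewrite exchange_big; apply: eq_bigr => r _.
  rewrite (iterate_prodE p0 vYH vYV vWV qH al (CE b v2)) conv_sumA // => q.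
  by apply: conv_bddA_LF; apply: bM.
pose B x F := conv (coef2 (frac_eval_phi p F)) (iterate_prod YH YV YWH YWV al b v2 w x) k n.
have bB : bilinear_map B.
  apply: conv_bilinear; [exact: frac_eval_phiD|exact: frac_eval_phiZ|exact: blam|].
  by move=> k' n'; apply: (iterate_prod_linear p0 vYH vYV vWV qH tH).
rewrite SL in fD1.
transitivity (\sum_(r <- D (a, v1)) B r.1 (toF r.2)).
  by apply: eq_bigr => r _; rewrite /B frac_eval_phi_tofrac.
rewrite (clears_sum bB fD1).
have -> : (fun k n => iterate_coef YH YV YVH YWH YWV v1 v2 n w k al b a) = fun k n =>
   \sum_(r <- S) conv (coef2 (frac_eval_phi p r.2)) (iterate_prod YH YV YWH YWV al b v2 w r.1) k n.
  apply: funext2 => k' n'.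
  exact: (iterate_coef_conv p0 vYH vYV vWV qH tH al (CE b v2) SK SE).
rewrite conv_sumA => [|r]; last exact: conv_bddA_LF.
by apply: eq_bigr => r _; rewrite /B frac_eval_phiM // frac_eval_phi_tofrac // convM.
Qed.

End Multiplied.

(** * The deformed module *)

Section DeformedModule.
Variables (K : numFieldType) (p : laurent K).
Hypothesis p0 : p != 0.
Variables (G : groupType) (chi chi_phi : G -> K).
Variables (H : lmodType K) (YH : vop H H) (vacH : H) (Delta : H -> tens H H) (eps : H -> K^o).
Variable RH : G -> H -> H.
Variables (V : lmodType K) (YV : vop V V) (vacV : V) (RV : G -> V -> V).
Variables (YVH : vop H V) (rho : V -> tens V H).
Variables (W : lmodType K) (YWH : vop H W) (YWV : vop V W).
Hypothesis gH : g_module_nv_bialgebra chi YH vacH Delta eps RH.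
Hypothesis cD : cocommutative Delta.
Hypothesis gV : g_module_nva chi YV vacV RV.
Hypothesis pc : phi_compatible p chi_phi YH vacH Delta eps YV vacV YVH.
Hypothesis cr : comodule_nva YH vacH Delta eps YV vacV rho.
Hypothesis rhoH : comodule_compatible YVH rho.
Hypothesis rhoR : forall g v,
     rho (RV g v) = sweedler (fun a b => pure (RV g a) (RH g b)) (rho v).
Hypothesis chi_char : linear_character chi_phi.
Hypothesis hw : hv_module p chi_phi YH vacH Delta RH YV vacV RV YVH YWH YWV.

Let vYH : vertex_map YH := nva_map (bialg_nva (gbialg_bialg gH)).
Let vYV : vertex_map YV := nva_map (gmod_nva gV).
Let vYVH : vertex_map YVH := mod_map (hmod_module (pc_hmod pc)).
Let qH : phi_quasi_module p YH vacH YWH := eqm_quasi (hv_H hw).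
Let qV : phi_quasi_module p YV vacV YWV := eqm_quasi (hv_V hw).
Let vWH : vertex_map YWH := pqm_map qH.
Let vWV : vertex_map YWV := pqm_map qV.
Let tH := hv_tensor hw.
Let tVH := hmod_tensor (pc_hmod pc).
Let tVH_phi := pc_tensor pc.
Let hv := hv_vop hw.

Notation Ysh := (deformed_vop rho YWV YWH).
Notation Ydf := (deformed_vop rho YV YVH).

Let vYsh : vertex_map Ysh := deformed_map vWV vWH tH cr.

Lemma sweedler_vacuum n w : Ysh vacV n w = if n == 0 then w else 0.
Proof.
rewrite sweedler_deformed (hom_vac (comod_hom cr)) sweedler_pure; last first.
  exact: diag_vop_bilinear.
rewrite /diag_vop (fsum_single (x := 0)) => [|m m0].
  by rewrite (pqm_vac qH) eqxx subr0 (pqm_vac qV).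
by rewrite (pqm_vac qH) (negbTE m0) (lin0 (vY_linear vWV _ _)).
Qed.

Lemma sweedler_equivariant g v n w : Ysh (RV g v) n w = (chi_phi g)^-1 ^ n *: Ysh v n w.
Proof.
have bop := diag_vop_bilinear vWV vWH tH n w.
rewrite !sweedler_deformed rhoR sweedler_sweedler // !sweedlerE scaler_sumr.
apply: eq_bigr => x _; rewrite sweedler_pure // /diag_vop fsum_scaler; last first.
  exact: (diag_vop_fsupp vWV tH).
apply: fsum_eq => m; rewrite (eqm_equivariant (hv_V hw)) (eqm_equivariant (hv_H hw)).
(* The exponents n - m and m of the two scalars add up to n; as they may be negative, this uses that
   a character has no zero. *)
rewrite (linZ (vY_linear vWV _ _)) scalerA -expfzDr ?subrK //.
by rewrite invr_neq0 // char_neq0.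
Qed.

Lemma clear_poles u v : exists2 f : R2 K, pole_factor chi_phi f &
  exists D : H * V -> seq (V * R2 K),
  forall x, x \in repr (rho u) -> forall ab, ab \in repr (Delta x.2) ->
  forall y, y \in repr (rho v) -> clears f (D (ab.1, y.1)) (hat_vop p YVH ab.1 y.1).
Proof.
pose P (a : H) (v' : V) f := exists D, clears f D (hat_vop p YVH a v').
have PM a v' f g : P a v' f -> P a v' (g * f).
  by move=> [D fD]; exists [seq (q.1, g * q.2) | q <- D]; apply: clears_mul.
have exP a v' : exists2 f, pole_factor chi_phi f & P a v' f.
  have [q Gq [D DE]] := pc_poles pc a v'.
  by exists (ratio_x2x1 q); [exact: pole_factor_x2x1|exists D].
have cm := @common_multiplier (R2 K) (pole_factor chi_phi) _ _ _ (pole_factor1 chi_phi)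
  (@pole_factorM _ _ chi_phi).
have ex1 (a : H) : exists2 f, pole_factor chi_phi f &
    forall y, y \in repr (rho v) -> P a y.1 f.
  by apply: (cm _ _ _) => [y f g|y]; [exact: PM|exact: exP].
have ex2 (x : V * H) : exists2 f, pole_factor chi_phi f & forall ab, ab \in repr (Delta x.2) ->
    forall y, y \in repr (rho v) -> P ab.1 y.1 f.
  by apply: (cm _ _ _) => [ab f g Pf y /Pf|ab]; [exact: PM|exact: ex1].
have [f Mf Pf] : exists2 f, pole_factor chi_phi f & forall x, x \in repr (rho u) ->
    forall ab, ab \in repr (Delta x.2) -> forall y, y \in repr (rho v) -> P ab.1 y.1 f.
  by apply: (cm _ _ _) => [x f g Pf ab abD y yv|x]; [apply/PM/Pf|exact: ex2].
(* A witness is available only for the pairs occurring in the finite lists; all other pairs may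
   receive the empty list. *)
exists f => //; have /choice[D DE] : forall z : H * V, exists D, P z.1 z.2 f ->
    clears f D (hat_vop p YVH z.1 z.2).
  by move=> z; have [[D fD]|nP] := pselect (P z.1 z.2 f); [exists D|exists [::]].
exists D => x xu ab abD y yv; apply: (DE (ab.1, y.1)); exact: (Pf x).
Qed.

(** [M] is left open because two kinds of multipliers are needed: pole factors for the equivariant
    pole condition, arbitrary nonzero elements for associativity. *)
Lemma common_factor (M : R2 K -> Prop) (P : V -> V -> R2 K -> Prop) u v
    (D : H * V -> seq (V * R2 K)) :
  M 1 -> (forall f g, M f -> M g -> M (f * g)) ->
  (forall u v f g, P u v f -> P u v (g * f)) -> (forall u v, exists2 f, M f & P u v f) ->
  exists2 f : R2 K, M f &
  forall x, x \in repr (rho u) -> forall ab, ab \in repr (Delta x.2) ->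
  forall y, y \in repr (rho v) -> forall r : V * R2 K, r \in D (ab.1, y.1) -> P x.1 r.1 f.
Proof.
move=> M1 MM PM exP; have cm := @common_multiplier (R2 K) M _ _ _ M1 MM.
apply: (cm _ _ _) => [x f g Pf ab abD y yv r rD|x]; first exact/PM/(Pf ab abD y yv r rD).
apply: (cm _ _ _) => [ab f g Pf y yv r rD|ab]; first exact/PM/(Pf y yv r rD).
apply: (cm _ _ _) => [y f g Pf r rD|y]; first exact/PM/(Pf r rD).
by apply: (cm _ _ _) => [r f g|r]; [exact: PM|exact: exP].
Qed.

Lemma tensor_choice w : exists C : H -> H -> seq (W * R2 K), forall b b' m n,
  YWH b m (YWH b' n w) = \sum_(q <- C b b') coef2 (toLF q.2) m n *: q.1.
Proof.
have /choice[C CE] : forall z : H * H, exists s : seq (W * R2 K), forall m n,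
    YWH z.1 m (YWH z.2 n w) = \sum_(q <- s) coef2 (toLF q.2) m n *: q.1.
  by move=> z; apply: (vop2_tensor vWH tH).
by exists (fun b b' => C (b, b')) => b b'; apply: (CE (b, b')).
Qed.

Lemma bdd2_multiplied u v (D : H * V -> seq (V * R2 K)) (C : H -> H -> seq (W * R2 K)) f2 :
  (forall x, x \in repr (rho u) -> forall ab, ab \in repr (Delta x.2) ->
   forall y, y \in repr (rho v) -> forall r, r \in D (ab.1, y.1) ->
   forall w, bdd2 (conv (coef2 (toLF f2)) (vop2 YWV x.1 r.1 w))) ->
  bdd2 (fun m n =>
  \sum_(x <- repr (rho u)) \sum_(y <- repr (rho v)) \sum_(ab <- repr (Delta x.2))
    \sum_(q <- C ab.2 y.2) \sum_(r <- D (ab.1, y.1))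
      conv (coef2 (toLF r.2)) (conv (coef2 (toLF q.2))
        (conv (coef2 (toLF f2)) (vop2 YWV x.1 r.1 q.1))) m n).
Proof.
move=> b2; apply: bdd2_sum => x xu; apply: bdd2_sum => y yv; apply: bdd2_sum => ab abD.
apply: bdd2_sum => q _; apply: bdd2_sum => r rD.
by do 2!apply: conv_bdd2_R2; apply: (b2 x xu ab abD y yv r rD).
Qed.

Lemma deformed_poles u v : exists2 q, char_monoid chi_phi q &
  forall w, bdd2 (smul (ratio_x1x2 q) (vop2 Ysh u v w)).
Proof.
have [f1 Mf1 [D fD]] := clear_poles u v.
pose P u v f := forall w, bdd2 (conv (coef2 (toLF f)) (vop2 YWV u v w)).
have [| | | |f2 Mf2 Pf2] := @common_factor (pole_factor chi_phi) P u v D.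
- exact: pole_factor1.
- exact: pole_factorM.
- by move=> u' v' f g Pf w; rewrite convM_B; [apply: conv_bdd2_R2|exact: vop2_bddB].
- move=> u' v'; have [q Gq bq] := eqm_poles (hv_V hw) u' v'.
  exists (ratio_x1x2 q); first exact: pole_factor_x1x2.
  by move=> w; rewrite -smul_coef2.
(* f2 f1 equals q(x1 / x2) up to the unit e; multiplying by its inverse e' stays in K((x1, x2)) and
   so preserves boundedness. *)
have [e [e' [q Gq [e'e fE]]]] := pole_factorM Mf2 Mf1.
exists q => // w; rewrite smul_coef2.
have -> : toLF (ratio_x1x2 q : R2 K) = toLF (e' * (f2 * f1)).
  by rewrite fE mulrA e'e mul1r.
rewrite convM_B; last exact: vop2_bddB.
apply: conv_bdd2_R2; have [C CE] := tensor_choice w.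
rewrite (multiplied vWV qH tH tVH_phi hv cr fD CE).
exact: bdd2_multiplied.
Qed.

Lemma deformed_assoc u v : exists2 f : laurent2 K, f != 0 & forall w,
  let F := smul f (vop2 Ysh u v w) in
  bdd2 F /\
  forall a b, subst (phi p) F a b =
    smul (at_phi p f) (fun k n => Ysh (Ydf u k v) n w) a b.
Proof.
have [f1 Mf1 [D fD]] := clear_poles u v.
pose P u v f := forall w, bdd2 (conv (coef2 (toLF f)) (vop2 YWV u v w)) /\
  subst (phi p) (conv (coef2 (toLF f)) (vop2 YWV u v w)) =
  conv (coef2 (eval_phi p f)) (vop_iterate YV YWV u v w).
have [| | | |f2 Mf2 Pf2] := @common_factor (fun f => f != 0) P u v D.
- exact: oner_neq0.
- exact: mulf_neq0.
- move=> u' v' f g Pf w; have [bf sf] := Pf w.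
  rewrite convM_B; last exact: vop2_bddB.
  split; first exact: conv_bdd2_R2.
  rewrite subst_smul // sf eval_phiM convM //; exact: vop_iterate_bddA.
- move=> u' v'; have [f f0 fP] := pqm_assoc qV u' v'; exists f => // w.
  have [bF sF] := fP w; rewrite -smul_coef2; split=> //.
  by apply: funext2 => a b; rewrite sF smul_coefs.
(* Both factors depend on u and v only; the vector w and the decomposition [C] come after. *)
exists (f2 * f1); first by rewrite mulf_neq0 // (pole_factor_neq0 Mf1).
move=> w; have [C CE] := tensor_choice w.
rewrite smul_coef2 (multiplied vWV qH tH tVH_phi hv cr fD CE).
have b2 : forall x, x \in repr (rho u) -> forall ab, ab \in repr (Delta x.2) ->
   forall y, y \in repr (rho v) -> forall r, r \in D (ab.1, y.1) ->
   forall w, bdd2 (conv (coef2 (toLF f2)) (vop2 YWV x.1 r.1 w)).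
  by move=> x xu ab abD y yv r rD w'; have [] := Pf2 x xu ab abD y yv r rD w'.
split=> [|k n]; first exact: bdd2_multiplied.
have bd := iterate_coef_bddA p0 vYH vYV vWV qH tH tVH_phi CE.
have -> : (fun k n => Ysh (Ydf u k v) n w) = fun k n =>
    \sum_(x <- repr (rho u)) \sum_(y <- repr (rho v)) \sum_(ab <- repr (Delta x.2))
      iterate_coef YH YV YVH YWH YWV y.1 y.2 n w k x.1 ab.2 ab.1.
  apply: funext2 => k' n'.
  rewrite (deformed_deformed vYH vYV vYVH vWV vWH tH tVH cD cr rhoH p0 qH).
  (* The sums over rho(v) and [Delta] are put in the order in which they occur in the expansion of
     the product. *)
  by apply: eq_bigr => x _; rewrite exchange_big.
rewrite smul_coefs -[sealL _]/(eval_phi p (f2 * f1)) eval_phiM convM; last first.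
  by do 3![apply: bddA_sum => ?]; apply: bd.
have -> : conv (coef2 (eval_phi p f1)) (fun k n =>
    \sum_(x <- repr (rho u)) \sum_(y <- repr (rho v)) \sum_(ab <- repr (Delta x.2))
      iterate_coef YH YV YVH YWH YWV y.1 y.2 n w k x.1 ab.2 ab.1) = fun k n =>
    \sum_(x <- repr (rho u)) \sum_(y <- repr (rho v)) \sum_(ab <- repr (Delta x.2))
      conv (coef2 (eval_phi p f1))
        (fun k n => iterate_coef YH YV YVH YWH YWV y.1 y.2 n w k x.1 ab.2 ab.1) k n.
  apply: funext2 => k' n'; rewrite conv_sumA => [|x]; last by do 2![apply: bddA_sum => ?]; apply: bd.
  apply: eq_bigr => x _; rewrite conv_sumA => [|y]; last by apply: bddA_sum => ?; apply: bd.
  by apply: eq_bigr => y _; rewrite conv_sumA // => ab; apply: bd.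
have bd1 x b a v1 v2 : bddA (conv (coef2 (eval_phi p f1))
    (fun k n => iterate_coef YH YV YVH YWH YWV v1 v2 n w k x b a)).
  by apply: conv_bddA_LF; apply: bd.
rewrite conv_sumA => [|x]; last by do 2![apply: bddA_sum => ?]; apply: bd1.
have bZ x y ab q r : x \in repr (rho u) -> y \in repr (rho v) -> ab \in repr (Delta x.2) ->
    r \in D (ab.1, y.1) ->
    bdd2 (conv (coef2 (toLF (r.2 : R2 K))) (conv (coef2 (toLF (q.2 : R2 K)))
      (conv (coef2 (toLF f2)) (vop2 YWV x.1 r.1 (q.1 : W))))).
  by move=> xu yv abD rD; do 2!apply: conv_bdd2_R2; apply: (b2 x xu ab abD y yv r rD).
(* The sums are peeled off on both sides in parallel, keeping membership in the lists, since f2 is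
   known to serve only the pairs that occur there. *)
rewrite subst_sum_seq => [|x xu]; last first.
  apply: bdd2_sum => y yv; apply: bdd2_sum => ab abD;
  apply: bdd2_sum => q _; apply: bdd2_sum => r rD; exact: (bZ x y ab q r).
apply: eq_big_seq => x xu; rewrite conv_sumA => [|y]; last by apply: bddA_sum => ?; apply: bd1.
rewrite subst_sum_seq => [|y yv]; last first.
  apply: bdd2_sum => ab abD; apply: bdd2_sum => q _; apply: bdd2_sum => r rD; exact: (bZ x y ab q r).
apply: eq_big_seq => y yv; rewrite conv_sumA => [|ab]; last exact: bd1.
rewrite subst_sum_seq => [|ab abD]; last first.
  apply: bdd2_sum => q _; apply: bdd2_sum => r rD; exact: (bZ x y ab q r).
apply: eq_big_seq => ab abD.
have -> : conv (coef2 (eval_phi p f1))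
    (fun k n => iterate_coef YH YV YVH YWH YWV y.1 y.2 n w k x.1 ab.2 ab.1) = fun k n =>
    \sum_(q <- C ab.2 y.2) \sum_(r <- D (ab.1, y.1))
      conv (coef2 (eval_phi p r.2)) (conv (coef2 (eval_phi p q.2)) (vop_iterate YV YWV x.1 r.1 q.1)) k n.
  apply: funext2 => k' n'; symmetry.
  apply: (multiplied_iterate_coef p0 vYH vYV vWV qH tH tVH_phi CE).
  exact: (fD x xu ab abD y yv).
have bM (r : V * R2 K) (q : W * R2 K) := vop_iterate_bddA x.1 r.1 q.1 vYV vWV.
rewrite conv_sumA => [|q]; last by apply: bddA_sum => r; do 2!apply: conv_bddA_LF.
rewrite subst_sum_seq => [|q qC]; last first.
  apply: bdd2_sum => r rD; exact: (bZ x y ab q r).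
apply: eq_big_seq => q qC; rewrite conv_sumA => [|r]; last by do 2!apply: conv_bddA_LF.
rewrite subst_sum_seq => [|r rD]; last exact: (bZ x y ab q r).
(* A single term remains. It is the associativity of the V-module W for the pair (x.1, r.1),
   multiplied by the scalar series q.2 and r.2, which the substitution respects. *)
apply: eq_big_seq => r rD; have [b2r s2r] := Pf2 x xu ab abD y yv r rD q.1.
rewrite subst_smul; last exact: conv_bdd2_R2.
rewrite subst_smul // s2r (convCA (eval_phi p q.2)) // (convCA (eval_phi p r.2)) //.
exact: conv_bddA_LF.
Qed.

Theorem deformed_equivariant_module :
  equivariant_phi_quasi_module p chi_phi Ydf vacV RV Ysh.
Proof.
split; [split | exact: sweedler_equivariant | exact: deformed_poles].
- exact: vYsh.
- exact: sweedler_vacuum.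
- exact: deformed_assoc.
Qed.

End DeformedModule.

Close Scope classical_set_scope.
Close Scope quotient_scope.
Unset Implicit Arguments.

Theorem corollary4p24 (R : realType)
  (p : laurent R[i]) (p_neq0 : p != 0)
  (G : groupType) (chi chi_phi : G -> R[i])
  (H : lmodType R[i]) (YH : vop H H) (vacH : H)
  (Delta : H -> tens H H) (eps : H -> (R[i])^o) (RH : G -> H -> H)
  (V : lmodType R[i]) (YV : vop V V) (vacV : V) (RV : G -> V -> V)
  (YVH : vop H V) (rho : V -> tens V H)
  (W : lmodType R[i]) (YWH : vop H W) (YWV : vop V W) :
  linear_character chi ->
  g_module_nv_bialgebra chi YH vacH Delta eps RH ->
  cocommutative Delta ->
  g_module_nva chi YV vacV RV ->
  phi_compatible p chi_phi YH vacH Delta eps YV vacV YVH ->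
  (forall g h n v, RV g (YVH h n v) = chi g ^ n *: YVH (RH g h) n (RV g v)) ->
  comodule_nva YH vacH Delta eps YV vacV rho ->
  comodule_compatible YVH rho ->
  (forall g v,
     rho (RV g v) = sweedler (fun a b => pure (RV g a) (RH g b)) (rho v)) ->
  linear_character chi_phi ->
  phi_characters p chi_phi chi ->
  hv_module p chi_phi YH vacH Delta RH YV vacV RV YVH YWH YWV ->
  equivariant_phi_quasi_module p chi_phi
    (deformed_vop rho YV YVH) vacV RV (deformed_vop rho YWV YWH).
Proof.
move=> _ gH cD gV pc _ cr rhoH rhoR chi_char _ hw.
exact: (deformed_equivariant_module p_neq0 gH cD gV pc cr rhoH rhoR chi_char hw).
Qed.
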